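(* Let $\Omega\subset\mathbb{R}^d$ be a bounded domain with smooth boundary, $H\in C^1(\overline{\Omega};\mathbb{R}^d)$ with $|H(x)|\ge\delta_0>0$ on $\overline{\Omega}$, and $p\in L^\infty(\Omega)$. Assume that there exist a constant vector $v\in S^{d-1}$ and a constant $\delta_1>0$ such that $(H(x)\cdot v)\ge\delta_1$ for all $x\in\overline{\Omega}$. Assume $$T>\frac{2\bigl(\max_{x\in\overline{\Omega}}|x|\bigr)\bigl(\delta_1+\|H\|_{C(\overline{\Omega})}\bigr)}{\delta_1^2}.$$ Then there is a constant $C>0$ such that $$\|u(\cdot,0)\|_{L^2(\Omega)}\le C\|u\|_{L^2(\partial\Omega\times(0,T))}$$ for all $u\in H^1(\Omega\times(0,T))$ satisfying $\partial_tu(x,t)+(H(x)\cdot\nabla u(x,t))+p(x)u(x,t)=0$ in $\Omega\times(0,T)$.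
   Context: $(v\cdot w)$ is the Euclidean scalar product, $S^{d-1}$ the unit sphere of $\mathbb{R}^d$, $\nabla$ the gradient in $x$, $\|H\|_{C(\overline\Omega)}=\max_{x\in\overline\Omega}|H(x)|$. Boundary and initial values of $u$ are traces. *)

(* Defs.v *)
From HB Require Import structures.
From mathcomp Require Import all_boot all_order all_algebra.
From mathcomp Require Import all_classical all_reals all_analysis.

Set Implicit Arguments.
Unset Strict Implicit.
Unset Printing Implicit Defensive.

Import Order.TTheory GRing.Theory Num.Theory.
Import numFieldNormedType.Exports.

Local Open Scope classical_set_scope.
Local Open Scope ring_scope.

Definition dotv (R : realType) (d : nat) (x y : 'rV[R]_d) : R :=
  \sum_(i < d) x 0 i * y 0 i.

(* The norm [`|x|] of the library on ['rV[R]_d] is the sup norm. *)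
Definition enorm (R : realType) (d : nat) (x : 'rV[R]_d) : R :=
  Num.sqrt (dotv x x).

(* ['rV[R]_n] carries the product sigma-algebra, like the library's tuples. *)
Definition rV_display : measure_display -> measure_display.
Proof. exact. Qed.

Section measurable_rV.
Context (R : realType) (n : nat).

Let coord (i : 'I_n) (v : 'rV[R]_n) : measurableTypeR R := v 0 i.

Let rV_set0 : g_sigma_preimage coord set0.
Proof. exact: sigma_algebra0. Qed.

Let rV_setC A : g_sigma_preimage coord A -> g_sigma_preimage coord (~` A).
Proof. exact: sigma_algebraC. Qed.

Let rV_bigcup (F : _^nat) : (forall i, g_sigma_preimage coord (F i)) ->
  g_sigma_preimage coord (\bigcup_i (F i)).
Proof. exact: sigma_algebra_bigcup. Qed.

HB.instance Definition _ := @isMeasurable.Build (rV_display default_measure_display)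
  'rV[R]_n (g_sigma_preimage coord) rV_set0 rV_setC rV_bigcup.

Lemma measurable_coord (i : 'I_n) :
  measurable_fun [set: 'rV[R]_n] (fun v : 'rV[R]_n => v 0 i : measurableTypeR R).
Proof.
move=> _ Y mY; rewrite setTI; apply: sub_sigma_algebra => /=.
rewrite -bigcup_seq/=; exists i => /=; first by rewrite mem_index_enum.
by exists Y => //; rewrite setTI.
Qed.

Lemma measurable_fun_rVP dT (T : measurableType dT) (f : T -> 'rV[R]_n) :
  (forall i, measurable_fun [set: T] (fun x => f x 0 i : measurableTypeR R)) ->
  measurable_fun [set: T] f.
Proof.
move=> mf _ A mA; rewrite setTI; move: A mA.
suff: g_sigma_preimage coord `<=` [set A | measurable (f @^-1` A)] by [].
apply: smallest_sub.
  split; rewrite /= ?preimage_set0//.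
  - by move=> A mA; rewrite setTD preimage_setC; exact: measurableC.
  - by move=> F mF; rewrite preimage_bigcup; exact: bigcupT_measurable.
elim/big_ind: _ => [//|A B hA hB|i _ A [B mB <-]/=].
  by move=> X [/hA|/hB].
by rewrite setTI -[X in measurable X]setTI; exact: (mf i).
Qed.
End measurable_rV.

Section lebesgue_rV.
Context (R : realType).

Definition rVcons (n : nat) (x : measurableTypeR R * 'rV[R]_n) : 'rV[R]_n.+1 :=
  row_mx (x.1)%:M x.2.

Definition rVuncons (n : nat) (v : 'rV[R]_n.+1) :
  measurableTypeR R * 'rV[R]_n := (v 0 0, \row_i v 0 (lift 0 i)).

Lemma rVconsK n : cancel (@rVcons n) (@rVuncons n).
Proof.
move=> [x v]; congr pair => /=.
  have -> : 0 = lshift n (0 : 'I_1) :> 'I_(1 + n) by exact: val_inj.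
  by rewrite [LHS]row_mxEl mxE.
apply/rowP => i; rewrite mxE.
have -> : lift 0 i = rshift 1 i :> 'I_(1 + n) by exact: val_inj.
by rewrite [LHS]row_mxEr.
Qed.

Lemma measurable_rVcons n : measurable_fun [set: _] (@rVcons n).
Proof.
apply: measurable_fun_rVP => i.
have [j ij|j ij] := @fintype.splitP 1 n i.
  rewrite (_ : (fun _ => _) = fst).
    exact: measurable_fst.
  apply/funext => x; have -> : i = lshift n j :> 'I_(1 + n) by exact: val_inj.
  by rewrite [LHS]row_mxEl ord1 mxE.
rewrite (_ : (fun _ => _) = (fun v : 'rV[R]_n => v 0 j) \o snd).
  by apply: measurableT_comp => //; exact: measurable_coord.
apply/funext => x; have -> : i = rshift 1 j :> 'I_(1 + n) by exact: val_inj.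
by rewrite [LHS]row_mxEr.
Qed.

Lemma measurable_rVuncons n : measurable_fun [set: _] (@rVuncons n).
Proof.
apply/measurable_fun_pairP; split; first exact: measurable_coord.
apply: measurable_fun_rVP => i /=.
rewrite (_ : (fun _ => _) = (fun v : 'rV[R]_n.+1 => v 0 (lift 0 i))).
  exact: measurable_coord.
by apply/funext => v; rewrite /= mxE.
Qed.

Section step.
Context (n : nat) (mu : {sigma_finite_measure set 'rV[R]_n -> \bar R}).

Let step : set 'rV[R]_n.+1 -> \bar R :=
  pushforward (@lebesgue_measure R \x mu)%E (@rVcons n).

Let mcons : measurable_fun [set: _] (@rVcons n) := @measurable_rVcons n.

Let step0 : step set0 = 0%E. Proof. exact: measure0. Qed.

Let step_ge0 A : (0 <= step A)%E. Proof. exact: measure_ge0. Qed.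

Let step_sigma_additive : semi_sigma_additive step.
Proof. exact: measure_semi_sigma_additive. Qed.

HB.instance Definition _ := isMeasure.Build _ _ _ step
  step0 step_ge0 step_sigma_additive.

Let step_sigma_finite : sigma_finite setT step.
Proof.
have /sigma_finiteP[F [FT ndF Foo]] := sigma_finiteT (@lebesgue_measure R).
have /sigma_finiteP[G [GT ndG Goo]] := sigma_finiteT mu.
exists (fun k => @rVuncons n @^-1` (F k `*` G k)).
  rewrite -preimage_bigcup (_ : \bigcup_k _ = setT) ?preimage_setT//.
  apply/seteqP; split => // -[x y] _.
  have [k _ Fkx] : (\bigcup_k F k) x by rewrite -FT.
  have [l _ Gly] : (\bigcup_k G k) y by rewrite -GT.
  exists (maxn k l) => //; split => /=.
    by move: Fkx; exact/subsetPset/ndF/leq_maxl.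
  by move: Gly; exact/subsetPset/ndG/leq_maxr.
move=> k; have [mF Fk] := Foo k; have [mG Gk] := Goo k; split.
  rewrite -[X in measurable X]setTI; apply: measurable_rVuncons => //.
  exact: measurableX.
rewrite /step /pushforward -comp_preimage.
rewrite (_ : _ \o _ = id); last by apply/funext => x; exact: rVconsK.
by rewrite product_measure1E// lte_mul_pinfty// ge0_fin_numE.
Qed.

HB.instance Definition _ :=
  @Measure_isSigmaFinite.Build _ _ _ step step_sigma_finite.

Definition lebesgue_step : {sigma_finite_measure set 'rV[R]_n.+1 -> \bar R} :=
  step.
End step.

(* Lebesgue measure on [R^n]: ['rV[R]_0] is a point, of mass one. *)
Fixpoint lebesgue_rV (n : nat) : {sigma_finite_measure set 'rV[R]_n -> \bar R} :=
  if n is m.+1 then lebesgue_step (lebesgue_rV m) else \d_(0 : 'rV[R]_0).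

End lebesgue_rV.

Section hausdorff.
Local Open Scope ereal_scope.
Context (R : realType) (n : nat).
Implicit Types (A B : set 'rV[R]_n) (r : R).

Definition ediam A : \bar R :=
  ereal_sup [set (enorm (x.1 - x.2))%:E | x in A `*` A].

(* The sets of diameter at most [r] form a semiring, so that the [r]-size
   approximation of the Hausdorff measure is an instance of [mu_ext]. *)
Definition small_sets (r : R) : Type := 'rV[R]_n.

Definition small_display : measure_display.
Proof. exact: default_measure_display. Qed.

Section small_sets.
Context (r : R).

Let small : set (set (small_sets r)) := [set A | ediam A <= r%:E].

Let small_sub A B : A `<=` B -> small B -> small A.
Proof.
move=> AB; apply: le_trans; apply: ereal_sup_le.
by move=> _ [x [? ?] <-]; exists x => //; split; exact: AB.
Qed.

Let small0 : small set0.
Proof.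
by rewrite /small /= /ediam set0X image_set0 ereal_sup0 leNye.
Qed.

Let smallI : setI_closed small.
Proof. by move=> A B sA _; exact: small_sub (@subIsetl _ A B) sA. Qed.

Let smallD : semi_setD_closed small.
Proof.
move=> A B sA _; exists [set A `\` B]; split => //.
- by move=> _ ->; exact: small_sub (@subDsetl _ A B) sA.
- by rewrite bigcup_set1.
- by move=> _ _ -> ->.
Qed.

HB.instance Definition _ := Pointed.on (small_sets r).
HB.instance Definition _ := @isSemiRingOfSets.Build small_display
  (small_sets r) small small0 smallI smallD.
End small_sets.

(* [s]-dimensional Hausdorff measure for the Euclidean distance, normalised to
   coincide with Lebesgue measure on [R^s]: the weight of a set is the volume of
   the [s]-dimensional ball with the same diameter. *)
Context (s : nat).

Definition hausdorff_weight A : \bar R :=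
  if A == set0 then 0
  else lebesgue_rV R s [set x | enorm x < 2^-1]%R * ediam A ^+ s.

Definition hausdorff_outer A : \bar R :=
  ereal_sup [set mu_ext (hausdorff_weight : set (small_sets r) -> \bar R) A
            | r in [set r | 0 < r]%R].

Let weight0 : hausdorff_weight set0 = 0.
Proof. by rewrite /hausdorff_weight eqxx. Qed.

Let weight_ge0 A : 0 <= hausdorff_weight A.
Proof.
rewrite /hausdorff_weight; case: ifPn => // /set0P[x Ax].
rewrite mule_ge0// expe_ge0//; apply: ereal_sup_ubound; exists (x, x) => //=.
by rewrite subrr /enorm /dotv big1 ?sqrtr0// => i _; rewrite mxE mul0r.
Qed.

Let hausdorff0 : hausdorff_outer set0 = 0.
Proof.
apply/eqP; rewrite eq_le; apply/andP; split.
  by apply: ge_ereal_sup => _ [r _ <-]; rewrite mu_ext0.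
by apply: ereal_sup_ubound; exists 1%R => //=; rewrite mu_ext0.
Qed.

Let hausdorff_ge0 A : 0 <= hausdorff_outer A.
Proof.
by apply: le_ereal_sup_tmp; exists (mu_ext
  (hausdorff_weight : set (small_sets 1) -> \bar R) A);
  [exists 1%R => /=|exact: mu_ext_ge0].
Qed.

Let le_hausdorff : {homo hausdorff_outer : A B / A `<=` B >-> A <= B}.
Proof.
move=> A B AB; apply: ge_ereal_sup => _ [r r0 <-].
apply: le_ereal_sup_tmp; eexists; first by exists r.
exact: le_mu_ext.
Qed.

Let hausdorff_sigma_subadditive : sigma_subadditive hausdorff_outer.
Proof.
move=> F; apply: ge_ereal_sup => _ [r r0 <-].
apply: (le_trans (@mu_ext_sigma_subadditive _ (small_sets r) R
  hausdorff_weight weight_ge0 F)).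
apply: lee_nneseries => [k _ _|k _].
  exact: (@mu_ext_ge0 _ (small_sets r) R _ weight_ge0).
by apply: ereal_sup_ubound; exists r.
Qed.

HB.instance Definition _ := isOuterMeasure.Build R 'rV[R]_n hausdorff_outer
  hausdorff0 hausdorff_ge0 le_hausdorff hausdorff_sigma_subadditive.

Definition hausdorff : {outer_measure set 'rV[R]_n -> \bar R} :=
  hausdorff_outer.

End hausdorff.

Section function_spaces.
Context (R : realType).

(* [C^k] regularity by iterated directional derivatives: in finite dimension this
   is the usual notion. *)
Fixpoint is_Ck (V : normedModType R) (k : nat) (f : V -> R) : Prop :=
  continuous f /\
  if k is k'.+1 then
    forall v, (forall x, derivable f x v) /\ is_Ck k' ('D_v f)
  else True.

Definition smooth (V : normedModType R) (f : V -> R) := forall k, is_Ck k f.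

(* [C^1(closure A)]: continuously differentiable in [A], the function and its first
   derivatives extending continuously to the closure. *)
Definition C1_closure (V W : normedModType R) (A : set V) (f : V -> W) : Prop :=
  {within closure A, continuous f} /\
  forall v, (forall x, A x -> derivable f x v) /\
    exists g : V -> W, {within closure A, continuous g} /\
      forall x, A x -> 'D_v f x = g x.

Definition boundary (T : topologicalType) (A : set T) : set T :=
  closure A `\` interior A.

(* Near each of its boundary points, [A] is the strict epigraph or hypograph of a
   smooth function of the coordinates other than some [i]. *)
Definition smooth_boundary (d : nat) (A : set 'rV[R]_d) : Prop :=
  forall x0, boundary A x0 ->
    exists (i : 'I_d) (b : bool) (gamma : 'rV[R]_d.-1 -> R),
      smooth gamma /\
      \forall x \near x0, A x <-> 0 < (-1) ^+ b * (x 0 i - gamma (col' i x)).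

Definition smooth_bounded_domain (d : nat) (A : set 'rV[R]_d) : Prop :=
  [/\ open A, connected A, A !=set0, bounded_set A & smooth_boundary A].

Definition in_Lp dT (T : measurableType dT) (mu : {measure set T -> \bar R})
    (p : \bar R) (D : set T) (f : T -> R) : Prop :=
  f \_ D \in Lfun mu p.

Definition L2norm dT (T : measurableType dT) (mu : {measure set T -> \bar R})
    (D : set T) (f : T -> R) : \bar R :=
  ('N[mu]_2%:E[EFin \o (f \_ D)])%E.

End function_spaces.

Notation spacetime R d := ('rV[R]_d * measurableTypeR R)%type.

Section sobolev.
Context (R : realType) (d : nat).

Definition spacetime_measure : {measure set (spacetime R d) -> \bar R} :=
  (lebesgue_rV R d \x @lebesgue_measure R)%E.

Local Notation mu := spacetime_measure.
Implicit Types (Q : set (spacetime R d)) (u g phi : spacetime R d -> R).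
Implicit Types (e : spacetime R d).

Definition test_function Q phi : Prop :=
  smooth phi /\
  exists K, [/\ compact K, K `<=` Q & forall z, ~ K z -> phi z = 0].

(* [g] is the weak derivative of [u] on [Q] in the direction [e], and is square
   integrable. *)
Definition L2_weak_derivative Q u e g : Prop :=
  in_Lp mu 2%:E Q g /\
  forall phi, test_function Q phi ->
    \int[mu]_(z in Q) (u z * 'D_e phi z) = - \int[mu]_(z in Q) (g z * phi z).

Definition H1 Q u : Prop :=
  in_Lp mu 2%:E Q u /\ forall e, exists g, L2_weak_derivative Q u e g.

(* Convergence in [H1 Q] of smooth functions to an element [u] of [H1 Q]. *)
Definition H1_cvg Q (f : (spacetime R d -> R)^nat) u : Prop :=
  (L2norm mu Q (f n \- u) @[n --> \oo] --> 0%E) /\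
  forall e g, L2_weak_derivative Q u e g ->
    L2norm mu Q ('D_e (f n) \- g) @[n --> \oo] --> 0%E.

(* [g], in [L^2(S, nu)], is the trace of [u] on the image of [S] under [iota]: the
   trace operator is the continuous extension to [H1 Q] of the restriction of smooth
   functions. *)
Definition is_trace Q dS (S : measurableType dS) (nu : {measure set S -> \bar R})
    (D : set S) (iota : S -> spacetime R d) u (g : S -> R) : Prop :=
  in_Lp nu 2%:E D g /\
  exists f : (spacetime R d -> R)^nat,
    [/\ forall n, smooth (f n), H1_cvg Q f u &
        L2norm nu D ((f n \o iota) \- g) @[n --> \oo] --> 0%E].

Definition cylinder (A : set 'rV[R]_d) (T : R) : set (spacetime R d) :=
  A `*` `]0, T[.

(* The initial value [u(., 0)]. *)
Definition is_initial_trace (A : set 'rV[R]_d) (T : R) u (a : 'rV[R]_d -> R) :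
    Prop :=
  is_trace (cylinder A T) (lebesgue_rV R d) A (fun x => (x, 0)) u a.

(* Surface measure is the [(d-1)]-dimensional Hausdorff measure, on its
   Caratheodory sigma-algebra. *)
Definition surface : Type := caratheodory_type (@hausdorff R d d.-1).

HB.instance Definition _ := Measurable.on surface.

Definition surface_measure : {measure set surface -> \bar R} :=
  (@hausdorff R d d.-1 : set (caratheodory_type (@hausdorff R d d.-1)) -> _).

Definition lateral_measure :
    {measure set (surface * measurableTypeR R)%type -> \bar R} :=
  (surface_measure \x @lebesgue_measure R)%E.

Definition lateral_boundary (A : set 'rV[R]_d) (T : R) :
    set (surface * measurableTypeR R) :=
  (boundary A : set surface) `*` `]0, T[.

Definition is_lateral_trace (A : set 'rV[R]_d) (T : R) u
    (g : surface * measurableTypeR R -> R) : Prop :=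
  is_trace (cylinder A T) lateral_measure (lateral_boundary A T)
    (fun z => (z.1 : 'rV[R]_d, z.2)) u g.

(* [d/dt u + H . grad u + p u = 0] in [A * (0, T)]. *)
Definition transport_equation (A : set 'rV[R]_d) (T : R)
    (H : 'rV[R]_d -> 'rV[R]_d) (p : 'rV[R]_d -> R) u : Prop :=
  exists (ut : spacetime R d -> R) (Du : spacetime R d -> 'rV[R]_d),
    [/\ L2_weak_derivative (cylinder A T) u (0, 1) ut,
        forall i : 'I_d, L2_weak_derivative (cylinder A T) u
          (delta_mx 0 i, 0) (fun z => Du z 0 i) &
        {ae mu, forall z, cylinder A T z ->
          ut z + dotv (H z.1) (Du z) + p z.1 * u z = 0}].

End sobolev.

Definition sup_norm (R : realType) (d : nat) (A : set 'rV[R]_d)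
    (f : 'rV[R]_d -> 'rV[R]_d) : R :=
  sup [set enorm (f x) | x in A].

(* Main.v *)
(* Let [w] be smooth and [psi = (x . v - beta t - a)^m] with [m] odd and
   [beta < delta1].  Along the flow of [d_t + H . grad] the base of the power grows
   at rate at least [delta1 - beta], so for [m] large
   [d_t (psi w^2) + div (psi w^2 H)] is bounded below by [- C (Lw)^2], where [Lw] is
   the left-hand side of the equation.  The condition on [T] leaves room to choose
   [a] and [beta] with [psi <= 0] at [t = T] and [psi >= c > 0] at [t = 0], and
   integrating over the cylinder bounds [w(., 0)] by the lateral values of [w] and by
   [Lw].

   The divergence is integrated without regularity of the boundary.  On a line
   parallel to an axis, a grid reduces the integral of a derivative over an open set
   to the values at boundary points of the set; the integral over the lines of the
   sum of these values is controlled by the Hausdorff measure because coordinate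
   projections do not increase it, up to a constant.

   Finally the estimate passes to the limit along smooth approximations of [u].  The
   initial and the lateral traces may come from different approximating sequences,
   whose difference tends to zero at [t = 0] since [w(., 0)] is bounded by [w] and
   [d_t w] in [L^2]. *)
Require Import Defs.
From HB Require Import structures.
From mathcomp Require Import all_boot all_order all_algebra.
From mathcomp Require Import all_classical all_reals all_analysis.
From mathcomp Require Import measurable_realfun ess_sup_inf.
From mathcomp Require Import ring lra.

Set Implicit Arguments.
Unset Strict Implicit.
Unset Printing Implicit Defensive.

Import Order.TTheory GRing.Theory Num.Theory.
Import numFieldNormedType.Exports.

Local Open Scope classical_set_scope.
Local Open Scope ring_scope.

(** * The Hausdorff measure *)

(** Why an odd power: [psi] has to change sign in time, but its derivative along the flow carries
    the even power q of the base, which is nonnegative, multiplied by the exponent, while |psi| is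
    at most a constant times q. A large exponent therefore absorbs every zeroth-order term at once
    (the divergence of [H], the potential [p], the cross term with Lw), also where [psi] is
    negative. The obstacle in the divergence is that a line may meet the boundary in infinitely many
    points, and that values at selected points need not depend measurably on the line. The grid
    keeps at most two boundary points per cell, and their values are replaced by measurable
    majorants attached to compact slabs of the boundary. The error from cells not contained in the
    open set vanishes on each line separately, at a rate depending on the line; hence Fatou's lemma.
    Sigma-finiteness of the Hausdorff measure is not established here, so Tonelli's theorem on the
    lateral boundary appears as an inequality, in the direction that bounds the surface integral of
    time integrals. *)

Section hausdorff_caratheodory.
Local Open Scope ereal_scope.
Context (R : realType) (n s : nat).
Local Notation mu := (hausdorff R n s).
Local Notation mu_ r :=
  (mu_ext (@hausdorff_weight R n s : set (small_sets n r) -> \bar R)).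
Implicit Types (A B X : set 'rV[R]_n) (r : R).

Lemma hausdorff_weight_ge0 A : 0 <= hausdorff_weight s A.
Proof.
rewrite /hausdorff_weight; case: ifPn => // /set0P[x Ax].
rewrite mule_ge0// expe_ge0//; apply: ereal_sup_ubound; exists (x, x) => //=.
by rewrite subrr /enorm /dotv big1 ?sqrtr0// => i _; rewrite mxE mul0r.
Qed.

Lemma hausdorff_sizeW r1 r2 A : (r1 <= r2)%R -> mu_ r2 A <= mu_ r1 A.
Proof.
move=> r12; apply: le_ereal_inf => _ [F [mF AF] <-]; exists F => //; split => // i.
by apply: le_trans (mF i) _; rewrite lee_fin.
Qed.

(** A covering set of diameter at most [r] cannot meet both [A] and [B], so every cover of the union
    contains disjoint subfamilies covering each. The sets left out are replaced by the empty set,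
    which has weight zero. *)
Lemma hausdorff_sizeU r A B : (forall x y, A x -> B y -> (r < enorm (x - y))%R) ->
  mu_ r A + mu_ r B <= mu_ r (A `|` B).
Proof.
move=> rAB; apply: le_ereal_inf_tmp => _ [F [mF ABF] <-].
pose G D k := if `[< F k `&` D !=set0 >] then F k else set0.
have GD D : D `<=` \bigcup_k F k -> mu_ r D <= \sum_(k <oo) hausdorff_weight s (G D k).
  move=> DF; apply: ereal_inf_lbound; exists (G D) => //; split => [k|x Dx].
    by rewrite /G; case: ifPn => // _; exact: measurable0.
  have [k _ Fx] := DF x Dx; exists k => //.
  by rewrite /G; case: ifPn => // /asboolPn[]; exists x.
apply: le_trans (leeD (GD A _) (GD B _)) _.
- by move=> x Ax; apply: ABF; left.
- by move=> x Bx; apply: ABF; right.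
rewrite -nneseriesD; last 2 first.
- by move=> *; exact: hausdorff_weight_ge0.
- by move=> *; exact: hausdorff_weight_ge0.
apply: lee_nneseries => [k _ _|k _].
  by apply: adde_ge0; exact: hausdorff_weight_ge0.
have w0 : hausdorff_weight s (set0 : set 'rV[R]_n) = 0%E.
  by rewrite /hausdorff_weight eqxx.
rewrite /G; case: asboolP => [[x [Fx Ax]]|_]; case: asboolP => [[y [Fy By]]|_];
  rewrite ?w0 ?adde0 ?add0e// ?hausdorff_weight_ge0//.
have h : (enorm (x - y))%:E <= ediam (F k).
  by apply: ereal_sup_ubound; exists (x, y).
have := le_trans h (mF k : ediam (F k) <= r%:E).
by rewrite lee_fin leNgt rAB.
Qed.

(** Once [z = +oo] is set aside, all elements and both suprema are finite, so subtraction is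
    legitimate and one supremum can be taken at a time. *)
Lemma ereal_supD_le (S S' : set (\bar R)) (z : \bar R) :
  (forall x, S x -> 0 <= x) -> (forall x, S' x -> 0 <= x) ->
  S !=set0 -> S' !=set0 ->
  (forall x y, S x -> S' y -> x + y <= z) -> ereal_sup S + ereal_sup S' <= z.
Proof.
move=> S0 S'0 [a Sa] [b S'b] SS'.
have [->|zoo] := eqVneq z +oo; first exact: leey.
have z0 : 0 <= z by apply: le_trans (SS' _ _ Sa S'b); apply: adde_ge0; [exact: S0|exact: S'0].
have zfin : z \is a fin_num by rewrite ge0_fin_numE// ltey.
have fS x : S x -> x \is a fin_num.
  move=> Sx; rewrite ge0_fin_numE; last exact: S0.
  apply: (@le_lt_trans _ _ z).
    by apply: le_trans (SS' _ _ Sx S'b); rewrite leeDl//; exact: S'0.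
  by rewrite ltey.
have supS' x : S x -> ereal_sup S' <= z - x.
  move=> Sx; apply: ge_ereal_sup => y S'y.
  by rewrite leeBrDr ?fS// addeC SS'.
have fS' : ereal_sup S' \is a fin_num.
  rewrite ge0_fin_numE; last exact: le_trans (S'0 _ S'b) (ereal_sup_ubound S'b).
  apply: le_lt_trans (supS' _ Sa) _.
  by rewrite ltey_eq fin_numB zfin fS.
rewrite -leeBrDr//; apply: ge_ereal_sup => x Sx.
by rewrite leeBrDr// -leeBrDl ?fS// supS'.
Qed.

(** This makes [mu] a metric outer measure. Smaller sizes only increase the approximations, so those
    of [A] and [B] may be taken at one common size not exceeding the separation [r]. *)
Lemma hausdorffU r A B : (0 < r)%R ->
  (forall x y, A x -> B y -> (r < enorm (x - y))%R) ->
  mu A + mu B <= mu (A `|` B).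
Proof.
move=> r0 rAB; apply: ereal_supD_le.
- by move=> _ [e _ <-]; apply: mu_ext_ge0; exact: hausdorff_weight_ge0.
- by move=> _ [e _ <-]; apply: mu_ext_ge0; exact: hausdorff_weight_ge0.
- by eexists; exists r.
- by eexists; exists r.
move=> _ _ [e1 /= e10 <-] [e2 /= e20 <-].
pose e := Num.min r (Num.min e1 e2).
have e0 : (0 < e)%R by rewrite !lt_min r0 e10 e20.
apply: (@le_trans _ _ (mu_ e (A `|` B))); last first.
  by apply: ereal_sup_ubound; exists e.
apply: le_trans (hausdorff_sizeU _); last first.
  by move=> x y Ax By; apply: le_lt_trans (rAB _ _ Ax By); rewrite ge_min lexx.
by apply: leeD; apply: hausdorff_sizeW; rewrite !ge_min lexx ?orbT.
Qed.

(** Caratheodory's argument for metric outer measures. The part of [X] where [g] is at least 1/(k+1)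
    lies at positive distance from the sublevel set, so the two measures add up. What this part
    still misses outside the sublevel set is the tail of a convergent series over shells. *)
Lemma caratheodory_hausdorff (g : 'rV[R]_n -> R) :
  (forall x y, g x - g y <= enorm (x - y))%R ->
  mu.-caratheodory [set x | g x <= 0]%R.
Proof.
move=> lipg; apply: le_caratheodory_measurable => X.
have [->|Xoo] := eqVneq (mu X) +oo; first exact: leey.
have Xfin : mu X \is a fin_num by rewrite ge0_fin_numE ?outer_measure_ge0// ltey.
set C := [set x | (g x <= 0)%R].
pose A k := X `&` [set x | (k.+1%:R^-1 <= g x)%R].
pose D k := A k.+1 `\` A k.
have sep k : (0 < k.+1%:R^-1 - k.+2%:R^-1 :> R)%R.
  by rewrite subr_gt0 ltf_pV2 ?posrE// ltr_nat.
have CA k : mu (X `&` C) + mu (A k) <= mu X.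
  apply: (@le_trans _ _ (mu (A k `|` (X `&` C)))); last first.
    by apply: le_outer_measure => x [|] [].
  rewrite addeC; apply: (@hausdorffU (k.+2%:R^-1)%R) => // x y [_ /= gx] [_ /= gy].
  apply: lt_le_trans (lipg x y).
  move: (sep k) gx (gy : (g y <= 0)%R); move: (k.+1%:R^-1)%R (k.+2%:R^-1)%R => a b *; lra.
(* The shell [D k] lies between [A k] and [D k.+1] and keeps them apart. *)
have AD k : mu (A k) + mu (D k.+1) <= mu (A k.+2).
  apply: (@le_trans _ _ (mu (A k `|` D k.+1))); last first.
    apply: le_outer_measure => x [[Xx /= gx]|[]//]; split => //=.
    by apply: le_trans gx; rewrite lef_pV2 ?posrE// ler_nat leqW.
  apply: (@hausdorffU ((k.+1%:R^-1 - k.+2%:R^-1) / 2)%R) => [|x y [_ /= gx]].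
    by rewrite divr_gt0.
  move=> [[Xy _]] /not_andP[//|/= /negP]; rewrite -ltNge => gy.
  apply: lt_le_trans (lipg x y).
  by move: (sep k) gx gy; move: (k.+1%:R^-1)%R (k.+2%:R^-1)%R => a b *; lra.
(* Even and odd shells are summed together: each new shell raises the smaller of the two indices by
   two. The whole series is thus at most twice [mu X], finite in this case. *)
have sD k : \sum_(i < k.+1) mu (D i) <= mu (A k) + mu (A k.+1).
  elim: k => [|k ih].
    rewrite big_ord1 -[leLHS]add0e leeD ?outer_measure_ge0//.
    by apply: le_outer_measure => x [].
  rewrite big_ord_recr/=; apply: le_trans (leeD ih (lexx _)) _.
  by rewrite addeAC [leRHS]addeC leeD.
have AX k : mu (A k) <= mu X by apply: le_outer_measure => x [].
have cD : \sum_(0 <= i <oo) mu (D i) < +oo.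
  apply: (@le_lt_trans _ _ (mu X + mu X)); last by rewrite lte_add_pinfty// ltey.
  apply: lime_le.
    by apply: is_cvg_nneseries => i _ _; exact: outer_measure_ge0.
  near=> k; rewrite big_mkord.
  have -> : k = k.-1.+1 by rewrite prednK//; near: k; exact: nbhs_infty_gt.
  by apply: le_trans (sD _) _; exact: leeD.
(* A point with [g] positive belongs to [A k] for some [k]; if it is not in [A m], it entered
   through a shell of index at least [m]. *)
have tail m : mu (X `&` ~` C) <= mu (A m) + \sum_(m <= i <oo) mu (D i).
  apply: (@le_trans _ _ (mu (A m `|` \bigcup_(i in ~` `I_m) D i))).
    apply: le_outer_measure => x [Xx /= /negP]; rewrite -ltNge => gx.
    have [k kx] : exists k, A k x.
      have [k hk] := ltr_add_invr gx; exists k; split => //=.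
      by rewrite add0r in hk; exact: ltW.
    have [mk|km] := leqP k m.
      left; split => //=; case: kx => _ /=; apply: le_trans.
      by rewrite lef_pV2 ?posrE// ler_nat ltnS.
    elim: k km kx => // k ih km kx.
    have [Akx|nAkx] := pselect (A k x).
      move: km; rewrite ltnS leq_eqVlt => /predU1P[->|mk]; first by left.
      exact: ih.
    by right; exists k => //=; rewrite ltnNge; exact/negP/negPn.
  apply: le_trans (outer_measureU2 _ _ _) _; rewrite leeD2l//.
  exact: outer_measure_sigma_subadditive_tail.
apply/lee_addgt0Pr => e e0.
have := @nneseries_tail_cvg _ (mu \o D) xpredT cD.
move=> /(_ (fun k _ => outer_measure_ge0 mu (D k))) /fine_cvgP[tfin].
move=> /cvgr0Pnorm_lt /(_ e e0) => tlt.
have [m [mfin me]] : exists m, \sum_(m <= i <oo) mu (D i) \is a fin_num /\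
    (`|fine (\sum_(m <= i <oo) mu (D i))| < e)%R.
  by near (\oo : set_system nat) => m; exists m; split; near: m.
apply: (@le_trans _ _ (mu (X `&` C) + (mu (A m) + \sum_(m <= i <oo) mu (D i)))).
  by rewrite leeD2l.
rewrite addeA leeD ?CA// -(fineK mfin) lee_fin.
by rewrite (le_trans (ler_norm _))// ltW.
Unshelve. all: by end_near. Qed.

(** Coordinates are 1-Lipschitz for the Euclidean norm. Half-spaces generate the product
    sigma-algebra, which is thereby contained in the Caratheodory one. *)
Lemma measurable_hausdorff_le (j : 'I_n) (c : R) :
  mu.-caratheodory [set x : 'rV[R]_n | x ord0 j <= c]%R.
Proof.
rewrite (_ : mkset _ = [set x : 'rV[R]_n | x ord0 j - c <= 0]%R); last first.
  by apply/seteqP; split => x /=; rewrite subr_le0.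
apply: caratheodory_hausdorff => x y; rewrite opprB addrA subrK.
rewrite /enorm; apply: (@le_trans _ _ (Num.sqrt ((x ord0 j - y ord0 j) ^+ 2))).
  by rewrite sqrtr_sqr ler_norm.
rewrite ler_sqrt /dotv; last by apply: sumr_ge0 => i _; rewrite -expr2 sqr_ge0.
by rewrite (bigD1 j)//= !mxE -expr2 lerDl sumr_ge0// => i _; rewrite -expr2 sqr_ge0.
Qed.

End hausdorff_caratheodory.

(** * Lebesgue measure and lines parallel to an axis *)

Section open_measurable.
Context (R : realType).

(** The sigma-algebras in use are generated by coordinates, not by the topology. With countably many
    centres [q], open sets become countable unions of balls, which are boxes for the sup norm and
    hence measurable. *)
Lemma open_bigcup_ball (T : pseudoMetricType R) (U : Type) (q : U -> T) :
  (forall x e, 0 < e -> exists u, ball (q u) e x) ->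
  forall A : set T, open A ->
  A = \bigcup_(p in [set p : U * nat | ball (q p.1) p.2.+1%:R^-1 `<=` A])
        ball (q p.1) p.2.+1%:R^-1.
Proof.
move=> dq A oA; apply/seteqP; split => [x Ax|x [p pA]]; last exact: pA.
have /nbhs_ballP[e /= e0 eA] : nbhs x A by apply: open_nbhs_nbhs.
have [k hk] := ltr_add_invr (divr_gt0 e0 (ltr0n R 2)); rewrite add0r in hk.
have k0 : 0 < k.+1%:R^-1 :> R by [].
have [u qu] := dq x _ k0.
exists (u, k) => //= y qy; apply: eA.
have : ball x (k.+1%:R^-1 + k.+1%:R^-1) y.
  by apply: ball_triangle qy; exact: ball_sym.
by apply: le_ball; rewrite [leRHS]splitr lerD ?ltW.
Qed.

Lemma dense_ratr_row n (x : 'rV[R]_n) (e : R) : 0 < e ->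
  exists u : 'rV[rat]_n, ball (map_mx ratr u : 'rV[R]_n) e x.
Proof.
move=> e0.
have h (j : 'I_n) : {r : rat | ball (ratr r : R) e (x 0 j)}.
  have : (x 0 j - e) < (x 0 j + e) by rewrite ltrBlDr -addrA ltrDl addr_gt0.
  move=> /rat_in_itvoo/cid[r]; rewrite in_itv/= => /andP[h1 h2]; exists r.
  by rewrite /ball/= ltr_distl; apply/andP; split; lra.
exists (\row_j sval (h j)); split => // i j; rewrite !mxE ord1.
exact: svalP (h j).
Qed.

Lemma measurable_rV_ball n (x : 'rV[R]_n) e : measurable (ball x e).
Proof.
have [e0|e0] := leP e 0.
  rewrite (_ : ball x e = set0)//; apply/seteqP; split => // y [].
  by rewrite ltNge e0.
rewrite (_ : ball x e = \bigcap_(j : 'I_n)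
    ((fun y : 'rV[R]_n => y 0 j : measurableTypeR R) @^-1` ball (x 0 j) e)).
  apply: fin_bigcap_measurable => // j _.
  rewrite -[X in measurable X]setTI; apply: measurable_coord => //.
  exact: measurable_ball.
apply/seteqP; split => [y [_ xy] j _|y xy]; first exact: xy.
by split => // i j; rewrite ord1; exact: xy.
Qed.

Lemma measurable_open_rV n (A : set 'rV[R]_n) : open A -> measurable A.
Proof.
move=> /(open_bigcup_ball (@dense_ratr_row n)) ->; rewrite bigcup_mkcond.
apply: countable_bigcupT_measurable => [|p]; first exact: countableP.
by case: ifPn => // _; exact: measurable_rV_ball.
Qed.

Lemma measurable_closed_rV n (A : set 'rV[R]_n) : closed A -> measurable A.
Proof.
move=> cA; rewrite -[A]setCK; apply: measurableC; apply: measurable_open_rV.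
exact: closed_openC.
Qed.

Lemma measurable_open_spacetime n (A : set (spacetime R n)) :
  open A -> measurable A.
Proof.
have dq (x : spacetime R n) e : 0 < e -> exists u : 'rV[rat]_n * rat,
    ball ((map_mx ratr u.1 : 'rV[R]_n, ratr u.2 : R) : spacetime R n) e x.
  move=> e0; have [u hu] := dense_ratr_row x.1 e0.
  have : (x.2 - e) < (x.2 + e) by rewrite ltrBlDr -addrA ltrDl addr_gt0.
  move=> /rat_in_itvoo[r]; rewrite in_itv/= => /andP[h1 h2].
  exists (u, r); split => //=.
  by rewrite /ball/= ltr_distl; apply/andP; split; lra.
move=> /(open_bigcup_ball dq) ->; rewrite bigcup_mkcond.
apply: countable_bigcupT_measurable => [|p]; first exact: countableP.
case: ifPn => // _.
rewrite (_ : ball _ _ = ball (map_mx ratr p.1.1 : 'rV[R]_n) p.2.+1%:R^-1 `*`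
   (ball (ratr p.1.2 : R) p.2.+1%:R^-1 : set (measurableTypeR R))).
  by apply: measurableX; [exact: measurable_rV_ball|exact: measurable_ball].
by apply/seteqP; split => y [].
Qed.

Lemma within_continuous_measurable_rV n (D E : set 'rV[R]_n) (f : 'rV[R]_n -> R) :
  open D -> D `<=` E -> {within E, continuous f} -> measurable_fun D f.
Proof.
move=> oD DE cf; have cfD x : D x -> {for x, continuous f}.
  move=> Dx; have := @continuous_subspaceW _ _ _ _ _ DE cf.
  by rewrite continuous_open_subspace// => /(_ x (mem_set Dx)).
apply: (measurability _ (RGenOpens.measurableE R)) => _ [_ [a [b ->]] <-].
apply: measurable_open_rV; rewrite openE => x [Dx fUx].
rewrite /interior; apply: filterI; first exact: open_nbhs_nbhs.
by apply: cfD => //; apply: open_nbhs_nbhs; split => //; exact: interval_open.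
Qed.

Lemma continuous_measurable_rV n (f : 'rV[R]_n -> R) :
  continuous f -> measurable_fun setT f.
Proof.
move=> cf; apply: (measurability _ (RGenOpens.measurableE R)) => _ [_ [a [b ->]] <-].
rewrite setTI; apply: measurable_open_rV; by move/continuousP: cf; apply; exact: interval_open.
Qed.

Lemma continuous_measurable_spacetime n (f : spacetime R n -> R) :
  continuous f -> measurable_fun setT f.
Proof.
move=> cf; apply: (measurability _ (RGenOpens.measurableE R)) => _ [_ [a [b ->]] <-].
rewrite setTI; apply: measurable_open_spacetime.
by move/continuousP: cf; apply; exact: interval_open.
Qed.

End open_measurable.

Section insertion.
Context (R : realType).

(** Parametrises the lines parallel to an arbitrary axis; [rVcons], from which [lebesgue_rV] is
    built, covers axis 0 only. *)
Definition rVinsert n (i : 'I_n.+1) (s : R) (y : 'rV[R]_n) : 'rV[R]_n.+1 :=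
  \row_k if unlift i k is Some j then y 0 j else s.

Lemma rVinsert_id n (i : 'I_n.+1) s y : rVinsert i s y 0 i = s.
Proof. by rewrite mxE unlift_none. Qed.

Lemma rVinsert_lift n (i : 'I_n.+1) s y j : rVinsert i s y 0 (lift i j) = y 0 j.
Proof. by rewrite mxE liftK. Qed.

Lemma col'_rVinsert n (i : 'I_n.+1) s y : col' i (rVinsert i s y) = y.
Proof. by apply/rowP => j; rewrite mxE rVinsert_lift. Qed.

Lemma rVinsertD n (i : 'I_n.+1) s t y :
  rVinsert i (s + t) y = rVinsert i s y + t *: delta_mx 0 i.
Proof.
apply/rowP => k; rewrite !mxE eqxx/=; case: (unliftP i k) => [j ->|->].
  by rewrite eq_sym (negbTE (neq_lift _ _)) mulr0 addr0.
by rewrite eqxx mulr1.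
Qed.

Lemma measurable_rVinsert n (i : 'I_n.+1) :
  measurable_fun [set: 'rV[R]_n * measurableTypeR R]
    (fun p => rVinsert i p.2 p.1).
Proof.
apply: measurable_fun_rVP => k; case: (unliftP i k) => [j ->|->].
  under eq_fun do rewrite rVinsert_lift.
  exact: measurableT_comp (measurable_coord j) measurable_fst.
by under eq_fun do rewrite rVinsert_id; exact: measurable_snd.
Qed.

Lemma measurable_rVinsert2 n (i : 'I_n.+1) y :
  measurable_fun [set: measurableTypeR R] (fun s => rVinsert i s y).
Proof.
exact: measurableT_comp (measurable_rVinsert i) (pair1_measurable y).
Qed.

Lemma rVconsE n (x : measurableTypeR R * 'rV[R]_n) : rVcons x = rVinsert 0 x.1 x.2.
Proof.
have := rVconsK x; case: x => s y [h1 /rowP h2]; apply/rowP => k.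
case: (unliftP 0 k) => [j ->|->]; first by rewrite rVinsert_lift -h2 mxE.
by rewrite rVinsert_id.
Qed.

Lemma rVinsert_rVcons n (i : 'I_n.+1) (s t : R) (y : 'rV[R]_n) :
  rVinsert (lift 0 i) s (rVcons (t, y)) = rVcons (t, rVinsert i s y).
Proof.
apply/rowP => k; rewrite !rVconsE/=.
case: (unliftP 0 k) => [j ->|->].
  rewrite rVinsert_lift; case: (unliftP i j) => [l ->|->].
    rewrite [RHS]rVinsert_lift.
    have -> : lift 0 (lift i l) = lift (lift 0 i) (lift 0 l).
      by apply: val_inj; rewrite /= /bump/= add1n add1n addnS ltnS.
    by rewrite !rVinsert_lift.
  by rewrite !rVinsert_id.
rewrite rVinsert_id.
have -> : 0 = lift (lift 0 i) (0 : 'I_n.+1) by apply: val_inj.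
by rewrite rVinsert_lift rVinsert_id.
Qed.

Local Open Scope ereal_scope.
Local Notation leb := (@lebesgue_measure R).

Lemma integral_rVcons n (f : 'rV[R]_n.+1 -> \bar R) :
  measurable_fun setT f -> (forall x, 0 <= f x) ->
  \int[lebesgue_rV R n.+1]_x f x = \int[leb \x lebesgue_rV R n]_z f (rVcons z).
Proof.
move=> mf f0.
by rewrite (ge0_integral_pushforward (@measurable_rVcons R n))// => x _; exact: f0.
Qed.

(** The measure is built by adding coordinate 0. For another axis, by induction: Tonelli peels
    coordinate 0 off, the line direction is chosen among the remaining coordinates, and coordinate 0
    is put back. *)
Lemma integral_rVinsert n (i : 'I_n.+1) (f : 'rV[R]_n.+1 -> \bar R) :
  measurable_fun setT f -> (forall x, 0 <= f x) ->
  \int[lebesgue_rV R n.+1]_x f x =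
    \int[lebesgue_rV R n]_y \int[leb]_s f (rVinsert i s y).
Proof.
elim: n i f => [|n ih] i f mf f0; have mfc := measurableT_comp mf (@measurable_rVcons R _);
  rewrite (integral_rVcons mf f0).
  rewrite (fubini_tonelli2 _ mfc (fun=> f0 _)).
  apply: eq_integral => y _; apply: eq_integral => s _ /=.
  by rewrite rVconsE ord1.
case: (unliftP ord0 i) => [j ->|->]; last first.
  rewrite (fubini_tonelli2 _ mfc (fun=> f0 _)).
  by apply: eq_integral => y _; apply: eq_integral => s _ /=; rewrite rVconsE.
rewrite (fubini_tonelli1 _ mfc (fun=> f0 _)).
pose g (y : 'rV[R]_n.+1) := \int[leb]_s f (rVinsert (lift ord0 j) s y).
have mg : measurable_fun setT g.
  apply: (measurable_fun_fubini_tonelli_F _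
    (measurableT_comp mf (measurable_rVinsert _)) (fun=> f0 _)).
have g0 y : 0 <= g y by exact: integral_ge0.
rewrite [RHS](integral_rVcons mg)//.
rewrite (fubini_tonelli1 _ (measurableT_comp mg (@measurable_rVcons R _)) (fun=> g0 _)).
apply: eq_integral => t _ /=.
rewrite /fubini_F/= (ih j (fun x => f (rVcons (t, x))))//; last first.
  exact: measurableT_comp mfc (pair1_measurable t).
apply: eq_integral => y _; apply: eq_integral => s _.
by rewrite rVinsert_rVcons.
Qed.

Lemma measurable_rV_box n (x : 'rV[R]_n) (r : R) :
  measurable [set y : 'rV[R]_n | forall i, (`|y 0 i - x 0 i| <= r)%R].
Proof.
rewrite (_ : mkset _ = \bigcap_(i : 'I_n)
  ((fun y : 'rV[R]_n => y ord0 i : measurableTypeR R) @^-1`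
    `[(x ord0 i - r)%R, (x ord0 i + r)%R]%classic)).
  apply: fin_bigcap_measurable => // j _.
  by rewrite -[X in measurable X]setTI; apply: measurable_coord.
apply/seteqP; split => [y yx i _|y yx i]/=.
  by have := yx i; rewrite ler_distl in_itv.
by have := yx i Logic.I; rewrite /= ler_distl in_itv.
Qed.

Lemma lebesgue_rV_box n (x : 'rV[R]_n) (r : R) : (0 <= r)%R ->
  lebesgue_rV R n [set y | forall i, (`|y 0 i - x 0 i| <= r)%R] = ((2 * r) ^+ n)%:E.
Proof.
move=> r0; elim: n x => [|n ih] x.
  rewrite /= diracE mem_set ?expr0// => -[]//.
rewrite /= /pushforward.
rewrite (_ : _ @^-1` _ =
    (`[(x ord0 ord0 - r)%R, (x ord0 ord0 + r)%R]%classic : set (measurableTypeR R)) `*`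
    [set y : 'rV[R]_n | forall i, (`|y 0 i - (col' ord0 x) 0 i| <= r)%R]); last first.
  apply/seteqP; split => -[s y] /= h.
    split; first by have := h ord0; rewrite rVconsE rVinsert_id ler_distl in_itv.
    by move=> i; have := h (lift ord0 i); rewrite rVconsE rVinsert_lift/= mxE.
  move=> i; rewrite rVconsE; case: h => h1 h2.
  case: (unliftP ord0 i) => [j ->|->].
    by rewrite rVinsert_lift; have := h2 j; rewrite mxE.
  by rewrite rVinsert_id ler_distl; move: h1; rewrite in_itv.
rewrite product_measure1E//; last exact: measurable_rV_box.
have h : leb `[(x ord0 ord0 - r)%R, (x ord0 ord0 + r)%R]%classic = (2 * r)%:E.
  rewrite lebesgue_measure_itv/= lte_fin; case: ltP => ?.
    by rewrite -EFinB; congr (_%:E); ring.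
  by congr (_%:E); lra.
transitivity ((2 * r)%:E * ((2 * r) ^+ n)%:E); last by rewrite -EFinM -exprS.
by congr (_ * _); [exact: h|exact: ih].
Qed.

End insertion.

Section projection.
Context (R : realType).

Lemma le_enorm n (x : 'rV[R]_n) i : `|x 0 i| <= enorm x.
Proof.
rewrite -sqrtr_sqr /enorm ler_sqrt /dotv.
  by rewrite (bigD1 i)//= -expr2 lerDl sumr_ge0// => j _; rewrite -expr2 sqr_ge0.
by apply: sumr_ge0 => j _; rewrite -expr2 sqr_ge0.
Qed.

Lemma continuous_coord n (i : 'I_n) : continuous (fun x : 'rV[R]_n => x 0 i).
Proof. exact: coord_continuous. Qed.

Lemma continuous_dotv n (v : 'rV[R]_n) : continuous (fun x : 'rV[R]_n => dotv x v).
Proof.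
apply: continuous_big => [|i _ x]; first exact: add_continuous.
by apply: continuousM; [exact: continuous_coord|exact: cst_continuous].
Qed.

Lemma continuous_enorm n : continuous (@enorm R n).
Proof.
move=> x; apply: continuous_comp; last exact: sqrt_continuous.
move: x; apply: continuous_big => [|i _ x]; first exact: add_continuous.
by apply: continuousM; exact: continuous_coord.
Qed.

Local Open Scope ereal_scope.

(* The volume of the ball normalising the Hausdorff measure is only bounded from
   below, by that of an inscribed cube. *)
Lemma lebesgue_projection_le_hausdorff n (i : 'I_n.+1) :
  exists2 C : R, (0 < C)%R & forall K : set 'rV[R]_n.+1, measurable (col' i @` K) ->
    lebesgue_rV R n (col' i @` K) <= C%:E * hausdorff R n.+1 n K.
Proof.
(* Half the side of a cube inside the ball of radius 1/2: n r^2 is less than 1/4. *)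
pose r : R := ((2 * n.+1%:R)^-1)%R.
have r0 : (0 < r)%R by rewrite invr_gt0 mulr_gt0.
pose w : R := ((2 * r) ^+ n)%R.
pose W := lebesgue_rV R n [set x : 'rV[R]_n | enorm x < 2^-1]%R.
have w0 : (0 < w)%R by rewrite exprn_gt0// mulr_gt0.
have wW : w%:E <= W.
  rewrite /w -(lebesgue_rV_box (0 : 'rV[R]_n) (ltW r0)); apply: le_measure.
  - by rewrite inE; exact: measurable_rV_box.
  - rewrite inE; apply: measurable_open_rV.
    rewrite (_ : mkset _ = @enorm R n @^-1` [set t | t < 2^-1]%R)//.
    by move/continuousP: (@continuous_enorm n); apply; exact: open_lt.
  - move=> x /= xr; rewrite -[ltRHS]ger0_norm ?invr_ge0//.
    rewrite -sqrtr_sqr ltr_sqrt ?exprn_gt0//.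
    apply: (@le_lt_trans _ _ (\sum_(i < n) r ^+ 2)%R).
      apply: ler_sum => j _; rewrite -expr2 -real_normK ?num_real//.
      by rewrite lerXn2r ?nnegrE ?(ltW r0)//; have := xr j; rewrite mxE subr0.
    rewrite sumr_const card_ord -[X in (X < _)%R]mulr_natl.
    have -> : (r ^+ 2 = 2^-1 ^+ 2 * (n.+1%:R ^+ 2)^-1)%R.
      by rewrite /r invfM exprMn [(n.+1%:R^-1 ^+ 2)%R]exprVn.
    rewrite mulrCA gtr_pMr ?exprn_gt0// ltr_pdivrMr ?exprn_gt0// mul1r.
    by rewrite -natrX ltr_nat expnS expn1; apply: leq_trans (leq_pmulr _ _).
(* A set of diameter e projects into a cube of volume (2 e)^n, while its weight is at least [w]
   times e^n. *)
exists (2 ^+ n / w)%R => [|K mK]; first by rewrite divr_gt0// exprn_gt0.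
have C0 : (0 < 2 ^+ n / w :> R)%R by rewrite divr_gt0// exprn_gt0.
rewrite -lee_pdivrMl//.
(* A single size bounds the supremum from below; size 1 also makes all diameters in the cover
   finite. *)
apply: (@le_trans _ _ (mu_ext (@hausdorff_weight R n.+1 n :
  set (small_sets n.+1 1%R) -> \bar R) K)); last first.
  by apply: ereal_sup_ubound; exists 1%R => //; exact: ltr01.
apply: le_ereal_inf_tmp => _ [F [mF KF] <-].
rewrite lee_pdivrMl//.
have [x Fx] : {x : nat -> 'rV[R]_n.+1 & forall k, F k !=set0 -> F k (x k)}.
  apply: (@choice _ _ (fun k z => F k !=set0 -> F k z)) => k.
  have [[z Fz]|nF] := pselect (F k !=set0); first by exists z.
  by exists 0%R => /nF.
pose B k := if `[< F k !=set0 >] then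
  [set y : 'rV[R]_n | forall j, (`|y 0 j - (col' i (x k)) 0 j| <= fine (ediam (F k)))%R]
  else set0.
have mB k : measurable (B k).
  by rewrite /B; case: ifPn => // _; exact: measurable_rV_box.
have ed0 k : F k !=set0 -> 0 <= ediam (F k).
  move=> [z Fz]; apply: ereal_sup_ubound; exists (z, z) => //=.
  by rewrite subrr /enorm /dotv big1 ?sqrtr0// => j _; rewrite mxE mul0r.
have edE k : F k !=set0 -> (fine (ediam (F k)))%:E = ediam (F k).
  move=> /ed0 Fk; rewrite fineK// ge0_fin_numE//.
  exact: le_lt_trans (mF k : ediam (F k) <= 1%:E) (ltry _).
apply: (@le_trans _ _ (\sum_(k <oo) lebesgue_rV R n (B k))).
  apply: measure_sigma_subadditive => // _ [z Kz <-].
  have [k _ Fz] := KF z Kz; exists k => //.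
  rewrite /B; case: asboolP => [Fk|[]]; last by exists z.
  move=> j /=; rewrite -lee_fin edE//.
  apply: (@le_trans _ _ (enorm (z - x k))%:E).
    by rewrite lee_fin; apply: le_trans (le_enorm _ (lift i j)); rewrite !mxE.
  by apply: ereal_sup_ubound; exists (z, x k) => //; split => //; exact: Fx.
rewrite -nneseriesZl; last by move=> k _; exact: hausdorff_weight_ge0.
apply: lee_nneseries => // k _.
rewrite /B; case: asboolP => [Fk|nF]; last first.
  rewrite measure0; apply: mule_ge0; first by rewrite lee_fin ltW.
  exact: (@hausdorff_weight_ge0 R n.+1 n (F k)).
rewrite /hausdorff_weight ifF; last by apply/negbTE/set0P.
have e0 : (0 <= fine (ediam (F k)))%R by apply: fine_ge0; exact: ed0.
rewrite lebesgue_rV_box// -/W; move: (edE k Fk) e0.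
set e := fine _ => <- e0; rewrite -EFin_expe.
apply: (@le_trans _ _ ((2 ^+ n / w)%:E * (w%:E * (e ^+ n)%:E))).
  by rewrite -!EFinM lee_fin exprMn -mulrA mulKf// gt_eqF.
apply: lee_wpmul2l; first by rewrite lee_fin ltW.
by apply: lee_wpmul2r; rewrite ?lee_fin ?exprn_ge0.
Qed.
End projection.

(** * Integrating a derivative over an open subset of the line *)

Section line.
Context (R : realType).
Local Notation leb := (@lebesgue_measure R).

Lemma bounded_globally (T : Type) (f : T -> R) (D : set T) (M : R) :
  (forall x, D x -> `|f x| <= M) -> [bounded f x | x in D].
Proof.
move=> fM; exists M; split; first exact: num_real.
by move=> N MN x Dx /=; rewrite (le_trans _ (ltW MN))// fM.
Qed.

Lemma Rintegral_FTC (f g : R -> R) (a b : R) : a < b ->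
  {within `[a, b], continuous f} -> {within `[a, b], continuous g} ->
  (forall x, a < x < b -> is_derive x 1 f (g x)) ->
  \int[leb]_(x in `[a, b]) g x = f b - f a.
Proof.
move=> ab cf cg dfg; rewrite /Rintegral (@continuous_FTC2 _ g f)//.
  have [_ fa fb] := (continuous_within_itvP _ ab).1 cf.
  by split => // x; rewrite in_itv/= => /dfg[].
move=> x; rewrite in_itv/= => /dfg[dx dE].
by rewrite derive1E.
Qed.

Section gridS.
Context (U V : set R) (a h : R).
Context (oU : open U) (cV : closed V) (UV : U `<=` V) (h0 : 0 < h).

Let pt k : R := a + k%:R * h.
Let J k := `[pt k, pt k.+1]%classic.
Let I k : set (measurableTypeR R) := `]pt k, pt k.+1]%classic.
Let bad k := `[< ~ (J k `<=` U) >].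

(** Cells inside [U] are treated exactly by the fundamental theorem of calculus. Only cells that
    leave [U] cause an error, proportional to the measure of [U] in them. *)
Definition grid_defect k := if bad k then fine (leb (U `&` I k)) else 0.

Let ptS k : pt k.+1 = pt k + h.
Proof. by rewrite /pt -natr1 mulrDl mul1r addrA. Qed.

Let pt_lt k : pt k < pt k.+1.
Proof. by rewrite ptS ltrDl. Qed.

Let mU : measurable (U : set (measurableTypeR R)).
Proof. exact: open_measurable. Qed.

Let mUI k : measurable (U `&` I k : set (measurableTypeR R)).
Proof. by apply: measurableI => //; exact: measurable_itv. Qed.

Let finUI k : (leb (U `&` I k) < +oo)%E.
Proof.
apply: (@le_lt_trans _ _ (leb (I k))).
  by apply: le_measure; rewrite ?inE; [exact: mUI|exact: measurable_itv|move=> x []].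
by rewrite lebesgue_measure_itv/= lte_fin pt_lt -EFinD ltry.
Qed.

Let J_compact k : bad k -> J k `\` U !=set0 /\ compact (J k `\` U).
Proof.
move=> /asboolP bk; split.
  apply: contrapT => /set0P/negP/negPn/eqP JU0; apply: bk => x Jx.
  by apply: contrapT => Ux; have : (J k `\` U) x by []; rewrite JU0.
rewrite setDE; apply: (@subclosed_compact _ _ (J k)).
- apply: closedI; [by rewrite /J; exact: interval_closed|exact: open_closedC].
- exact: segment_compact.
- by move=> x [].
Qed.

(** The maximum of the compact set [J k] minus [U]. It belongs to the closed set [V], where [f] is
    controlled, as a limit of points of [U] lying to its right. *)
Let last_gap k : bad k -> U (pt k.+1) ->
  {z | [/\ J k z, V z, ~ U z & forall x, z < x <= pt k.+1 -> U x]}.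
Proof.
move=> bk Upt; apply: cid; have [JU0 JUc] := J_compact bk.
have [z /set_mem[Jz Uz] zmax] := compact_EVT_max JU0 JUc
  (continuous_subspaceT (fun x : R => cvg_id)).
have zU x : z < x <= pt k.+1 -> U x.
  move=> /andP[zx xpt]; apply: contrapT => Ux.
  have : (J k `\` U) x.
    split => //; rewrite /J /= in_itv/= xpt andbT (le_trans _ (ltW zx))//.
    by move: Jz; rewrite /J /= in_itv/= => /andP[].
  by move=> /mem_set/zmax; rewrite leNgt zx.
exists z; split => //.
have zpt : z < pt k.+1.
  move: Jz; rewrite /J /= in_itv/= => /andP[_]; rewrite le_eqVlt => /predU1P[|//].
  by move=> zE; rewrite zE in Uz.
apply: cV => B /nbhs_ballP[e /= e0 eB].
pose x := z + Num.min (e / 2) (pt k.+1 - z).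
have m0 : 0 < Num.min (e / 2) (pt k.+1 - z) by rewrite lt_min divr_gt0//= subr_gt0.
exists x; split; last first.
  apply: eB; rewrite /ball/= /x opprD addrA subrr sub0r normrN gtr0_norm//.
  by rewrite gt_min ltr_pdivrMr// ltr_pMr// ltr1n.
by apply/UV/zU; rewrite /x ltrDl m0/= -lerBrDl ge_min lexx orbT.
Qed.

Let first_gap k : bad k -> U (pt k) ->
  {z | [/\ J k z, V z, ~ U z & forall x, pt k <= x < z -> U x]}.
Proof.
move=> bk Upt; apply: cid; have [JU0 JUc] := J_compact bk.
have [z /set_mem[Jz Uz] zmin] := compact_EVT_min JU0 JUc
  (continuous_subspaceT (fun x : R => cvg_id)).
have zU x : pt k <= x < z -> U x.
  move=> /andP[ptx xz]; apply: contrapT => Ux.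
  have : (J k `\` U) x.
    split => //; rewrite /J /= in_itv/= ptx/= (le_trans (ltW xz))//.
    by move: Jz; rewrite /J /= in_itv/= => /andP[].
  by move=> /mem_set/zmin; rewrite leNgt xz.
exists z; split => //.
have zpt : pt k < z.
  move: Jz; rewrite /J /= in_itv/= => /andP[+ _]; rewrite le_eqVlt => /predU1P[|//].
  by move=> zE; rewrite -zE in Uz.
apply: cV => B /nbhs_ballP[e /= e0 eB].
pose x := z - Num.min (e / 2) (z - pt k).
have m0 : 0 < Num.min (e / 2) (z - pt k) by rewrite lt_min divr_gt0//= subr_gt0.
exists x; split; last first.
  apply: eB; rewrite /ball/= /x opprB addrC subrK gtr0_norm//.
  by rewrite gt_min ltr_pdivrMr// ltr_pMr// ltr1n.
by apply/UV/zU; rewrite /x ltrBlDr ltrDl m0 andbT lerBrDl -lerBrDr ge_min lexx orbT.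
Qed.

(* Points outside [U] nearest to the ends of the cell [J k].  [U] contains the
   stretch between such a point and the end, so [f] changes by at most [M] times the
   defect there; adding up the cells telescopes. *)
Definition grid_gaps k : seq R :=
  match pselect (bad k /\ U (pt k)) with
  | left H => [:: sval (first_gap H.1 H.2)]
  | right _ => [::]
  end ++
  match pselect (bad k /\ U (pt k.+1)) with
  | left H => [:: sval (last_gap H.1 H.2)]
  | right _ => [::]
  end.

Lemma size_grid_gaps k : (size (grid_gaps k) <= 2)%N.
Proof. by rewrite /grid_gaps; do 2 case: pselect. Qed.

Lemma grid_gapsP k z : z \in grid_gaps k ->
  [/\ a + k%:R * h <= z <= a + k.+1%:R * h, V z & ~ U z].
Proof.
rewrite /grid_gaps mem_cat => /orP[]; case: pselect => // H; rewrite inE => /eqP ->.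
  by case: first_gap => x /= [].
by case: last_gap => x /= [].
Qed.

Section bound.
Context (f g : R -> R) (M : R).
Context (cf : {within V, continuous f}) (cg : {within V, continuous g}).
Context (dfg : forall x, U x -> is_derive x 1 f (g x)).
Context (gM : forall x, U x -> `|g x| <= M).

(** Extending [f] by zero makes the increments over the cells telescope to zero once both ends of
    the grid lie outside [U]. *)
Let F x := if `[< U x >] then f x else 0.

Let mg : measurable_fun (U : set (measurableTypeR R)) g.
Proof.
apply: open_continuous_measurable_fun => //.
have := continuous_subspaceW UV cg.
by rewrite continuous_open_subspace.
Qed.

Let ig (D : set (measurableTypeR R)) : measurable D -> D `<=` U -> (leb D < +oo)%E ->
  leb.-integrable D (EFin \o g).
Proof.
move=> mD DU Doo; apply: measurable_bounded_integrable => //.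
  exact: measurable_funS mg.
by apply: (@bounded_globally _ _ _ M) => x /DU; exact: gM.
Qed.

Let le_defect (D : set (measurableTypeR R)) k : measurable D -> D `<=` U `&` I k ->
  fine (leb D) <= fine (leb (U `&` I k)).
Proof.
move=> mD DUI; have le : (leb D <= leb (U `&` I k))%E.
  by apply: le_measure; rewrite ?inE; [exact: mD|exact: mUI|exact: DUI].
apply: fine_le => //; rewrite ge0_fin_numE// ?finUI//.
exact: le_lt_trans le (finUI k).
Qed.

(** On a cell inside [U] the two sides agree exactly. On any other cell the integral and the two end
    values are bounded separately: the integral by [M] times the defect, each end value by the same
    amount plus [|f|] at the nearest gap. Hence the factor 3. *)
Lemma grid_step k : `|\int[leb]_(x in U `&` I k) g x - (F (pt k.+1) - F (pt k))| <=
  \sum_(z <- grid_gaps k) `|f z| + 3 * M * grid_defect k.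
Proof.
have gaps0 : 0 <= \sum_(z <- grid_gaps k) `|f z| by apply: sumr_ge0 => z _.
rewrite /grid_defect; case: ifPn => [bk|/asboolP/contrapT JU]; last first.
  have IU : U `&` I k = I k.
    apply/setIidPr => x; rewrite /I /= in_itv/= => /andP[h1 h2]; apply: JU.
    by rewrite /J /= in_itv/= (ltW h1).
  have iI : leb.-integrable (I k) (EFin \o g).
    by apply: ig; [exact: measurable_itv|rewrite -IU => x []|rewrite -IU; exact: finUI].
  have FTC : \int[leb]_(x in J k) g x = f (pt k.+1) - f (pt k).
    apply: Rintegral_FTC => //.
    - by apply: continuous_subspaceW cf => x /JU/UV.
    - by apply: continuous_subspaceW cg => x /JU/UV.
    - move=> x /andP[h1 h2]; apply/dfg/JU; rewrite /J /= in_itv/=.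
      by rewrite (ltW h1) (ltW h2).
  rewrite IU Rintegral_itv_obnd_cbnd// FTC.
  have Fpt x : J k x -> F x = f x by move=> /JU Ux; rewrite /F asboolT.
  rewrite !Fpt; last 2 first.
  - by rewrite /J /= in_itv/= lexx ltW.
  - by rewrite /J /= in_itv/= lexx ltW.
  by rewrite subrr normr0 mulr0 addr0.
set L := fine _.
have L0 : 0 <= L by exact: fine_ge0.
have int_le : `|\int[leb]_(x in U `&` I k) g x| <= M * L.
  have i1 : leb.-integrable (U `&` I k) (EFin \o g) by apply: ig => // x [].
  apply: (le_trans (le_normr_Rintegral (mUI k) i1)).
  apply: (@le_trans _ _ (\int[leb]_(_ in U `&` I k) M)); last by rewrite Rintegral_cst.
  apply: le_Rintegral => //.
  - exact: integrable_norm.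
  - apply: (@measurable_bounded_integrable _ _ _ _ (cst M)).
    + exact: mUI.
    + exact: finUI.
    + exact: measurable_cst.
    + exact: (@bounded_globally _ _ _ `|M|).
  - by move=> x [/gM].
have ML0 : 0 <= M * L := le_trans (normr_ge0 _) int_le.
rewrite /grid_gaps big_cat/=.
set S1 := \sum_(z <- _) _; set S2 := \sum_(z <- _) _.
have F1 : `|F (pt k)| <= S1 + M * L.
  rewrite /S1; case: pselect => [H|nH]; last first.
    rewrite big_nil add0r /F asboolF ?normr0//.
    by move=> Uk; exact: nH.
  rewrite big_seq1; case: first_gap => z/= [Jz Vz Uz zU].
  have zpt : pt k < z.
    move: Jz; rewrite /J /= in_itv/= => /andP[+ _]; rewrite le_eqVlt => /predU1P[|//].
    by case: H => _ + zE; rewrite zE => /Uz.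
  have sub x : pt k <= x <= z -> V x.
    move=> /andP[h1]; rewrite le_eqVlt => /predU1P[->//|h2].
    by apply/UV/zU; rewrite h1.
  have [c cpt fE] : exists2 c, c \in `]pt k, z[ & f z - f (pt k) = g c * (z - pt k).
    apply: MVT => //; last by apply: continuous_subspaceW cf => x /=; rewrite in_itv; exact: sub.
    by move=> x; rewrite in_itv/= => /andP[h1 h2]; apply/dfg/zU; rewrite (ltW h1).
  rewrite /F asboolT; last by case: H.
  have -> : f (pt k) = f z - g c * (z - pt k) by rewrite -fE; ring.
  apply: le_trans (ler_normB _ _) _; rewrite lerD2l normrM.
  move: cpt; rewrite in_itv/= => /andP[c1 c2].
  have Uc : U c by apply: zU; rewrite (ltW c1).
  rewrite ler_pM//; first exact: gM.
  have -> : `|z - pt k| = fine (leb `]pt k, z[).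
    by rewrite lebesgue_measure_itv/= lte_fin zpt -EFinD/= gtr0_norm// subr_gt0.
  apply: le_defect => //; move=> x /=; rewrite in_itv/= => /andP[h1 h2].
  split; first by apply: zU; rewrite (ltW h1).
  rewrite /I /= in_itv/= h1 (le_trans (ltW h2))//.
  by move: Jz; rewrite /J/= in_itv => /andP[].
have F2 : `|F (pt k.+1)| <= S2 + M * L.
  rewrite /S2; case: pselect => [H|nH]; last first.
    rewrite big_nil add0r /F asboolF ?normr0//.
    by move=> Uk; exact: nH.
  rewrite big_seq1; case: last_gap => z/= [Jz Vz Uz zU].
  have zpt : z < pt k.+1.
    move: Jz; rewrite /J /= in_itv/= => /andP[_]; rewrite le_eqVlt => /predU1P[|//].
    by case: H => _ + zE; rewrite -zE => /Uz.
  have sub x : z <= x <= pt k.+1 -> V x.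
    move=> /andP[]; rewrite le_eqVlt => /predU1P[<-//|h1 h2].
    by apply/UV/zU; rewrite h1.
  have [c cpt fE] : exists2 c, c \in `]z, pt k.+1[ & f (pt k.+1) - f z = g c * (pt k.+1 - z).
    apply: MVT => //; last by apply: continuous_subspaceW cf => x /=; rewrite in_itv; exact: sub.
    by move=> x; rewrite in_itv/= => /andP[h1 h2]; apply/dfg/zU; rewrite h1 ltW.
  rewrite /F asboolT; last by case: H.
  have -> : f (pt k.+1) = f z + g c * (pt k.+1 - z) by rewrite -fE; ring.
  apply: le_trans (ler_normD _ _) _; rewrite lerD2l normrM.
  move: cpt; rewrite in_itv/= => /andP[c1 c2].
  have Uc : U c by apply: zU; rewrite c1 ltW.
  rewrite ler_pM//; first exact: gM.
  have -> : `|pt k.+1 - z| = fine (leb `]z, pt k.+1[).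
    by rewrite lebesgue_measure_itv/= lte_fin zpt -EFinD/= gtr0_norm// subr_gt0.
  apply: le_defect => //; move=> x /=; rewrite in_itv/= => /andP[h1 h2].
  split; first by apply: zU; rewrite h1 ltW.
  rewrite /I /= in_itv/= (ltW h2) andbT (le_lt_trans _ h1)//.
  by move: Jz; rewrite /J/= in_itv => /andP[].
apply: le_trans (ler_normB _ _) _.
have := ler_normB (F (pt k.+1)) (F (pt k)).
by move: int_le F1 F2; rewrite -mulrA; move: (M * L) => ?; lra.
Qed.

Lemma Rintegral_grid_le N : (forall x, U x -> a < x < a + N%:R * h) ->
  `|\int[leb]_(x in U) g x| <=
  \sum_(k < N) (\sum_(z <- grid_gaps k) `|f z| + 3 * M * grid_defect k).
Proof.
move=> UaN.
have UE : U = U `&` `]pt 0, pt N]%classic.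
  apply/esym/setIidPl => x /UaN /andP[h1 h2].
  by rewrite /= in_itv/= /pt mul0r addr0 h1 ltW.
have Unot m : (m = 0 \/ m = N)%N -> F (pt m) = 0.
  move=> mE; rewrite /F asboolF// => /UaN.
  by case: mE => ->; rewrite /pt ?mul0r ?addr0 ltxx ?andbF.
have int m : \int[leb]_(x in U `&` `]pt 0, pt m]%classic) g x =
    \sum_(k < m) \int[leb]_(x in U `&` I k) g x.
  elim: m => [|m ih].
    by rewrite big_ord0 set_itvoc0 setI0 Rintegral_set0.
  have p0m : pt 0 <= pt m by rewrite /pt mul0r addr0 lerDl mulr_ge0// ltW.
  have splitE : U `&` `]pt 0, pt m.+1]%classic =
      (U `&` `]pt 0, pt m]%classic) `|` (U `&` I m).
    rewrite -setIUr; congr (_ `&` _); rewrite /I.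
    apply/seteqP; split => x /=; rewrite !in_itv/=.
      move=> /andP[h1 h2]; have [h3|h3] := leP x (pt m); first by left; rewrite h1.
      by right; rewrite h2.
    move=> [/andP[-> /= hx]|/andP[hx ->]].
      by rewrite (le_trans hx)// ltW.
    by rewrite andbT (le_lt_trans p0m).
  have moo : (leb (U `&` `]pt 0, pt m.+1]%classic) < +oo)%E.
    apply: (@le_lt_trans _ _ (leb `]pt 0, pt m.+1]%classic)).
      apply: le_measure; rewrite ?inE; [|exact: measurable_itv|by move=> x []].
      by apply: measurableI => //; exact: measurable_itv.
    by rewrite lebesgue_measure_itv/=; case: ifPn => _; rewrite -?EFinD ltry.
  have mUm i : measurable (U `&` `]pt 0, pt i]%classic : set (measurableTypeR R)).
    by apply: measurableI => //; exact: measurable_itv.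
  rewrite splitE Rintegral_setU; first by rewrite big_ord_recr/= ih.
  - exact: mUm.
  - exact: mUI.
  - by rewrite -splitE; apply: ig; [exact: mUm|move=> x []|exact: moo].
  - apply/disj_setPS => x [[_ /= ] + [_]]; rewrite /I /= !in_itv/=.
    by move=> /andP[_ h1] /andP[h2 _]; move: (lt_le_trans h2 h1); rewrite ltxx.
have -> : \int[leb]_(x in U) g x = \sum_(k < N) \int[leb]_(x in U `&` I k) g x.
  by rewrite [in LHS]UE int.
have tel : \sum_(k < N) (F (pt k.+1) - F (pt k)) = 0.
  rewrite -(big_mkord xpredT (fun k => F (pt k.+1) - F (pt k))).
  by rewrite (telescope_sumr (F \o pt))//= !Unot ?subrr//; [left|right].
rewrite -[X in `|X|]subr0 -[X in _ - X]tel -sumrB.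
apply: le_trans (ler_norm_sum _ _ _) _; apply: ler_sum => k _.
exact: grid_step.
Qed.

End bound.
End gridS.

Lemma sum_indic_itvoc (pt : nat -> R) m x : nondecreasing_seq pt ->
  \sum_(k < m) \1_(`]pt k, pt k.+1]%classic : set R) x =
    \1_(`]pt 0, pt m]%classic : set R) x :> R.
Proof.
move=> npt; elim: m => [|m ih]; first by rewrite big_ord0 set_itvoc0 indic0.
have p0m : pt 0 <= pt m by exact: npt.
have pmS : pt m <= pt m.+1 by exact: npt.
rewrite big_ord_recr/= ih !indicE !mem_setE !in_itv/=.
have [h1|h1] := leP x (pt m); have [h2|h2] := ltP (pt 0) x => //=;
  rewrite ?add0r ?addr0 ?andbF//.
- by rewrite (le_trans h1).
- by have := lt_le_trans h1 (le_trans h2 p0m); rewrite ltxx.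
Qed.

(** The sum is the integral over [U] of [s N], the indicator of the union of the cells leaving [U].
    A point of [U] has a ball inside [U], which contains its cell as soon as the mesh is below the
    radius, so [s N] tends to zero pointwise and dominated convergence applies. *)
Lemma grid_defect_cvg0 (U : set R) (a L : R) : open U -> 0 < L ->
  (forall x, U x -> a < x < a + L) ->
  (\sum_(k < N.+1) grid_defect U a (L / N.+1%:R) k) @[N --> \oo] --> (0 : R).
Proof.
move=> oU L0 UaL.
pose h N := L / N.+1%:R : R; pose pt N k := a + k%:R * h N.
have h0 N : 0 < h N by rewrite divr_gt0.
pose I N k : set (measurableTypeR R) := `]pt N k, pt N k.+1]%classic.
pose bad N k := `[< ~ (`[pt N k, pt N k.+1]%classic `<=` U) >].
pose s N (x : R) := \sum_(k < N.+1) (bad N k)%:R * \1_(I N k) x : R.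
have mU : measurable (U : set (measurableTypeR R)) by exact: open_measurable.
have Uoo : (leb U < +oo)%E.
  apply: (@le_lt_trans _ _ (leb `]a, a + L[%classic)); last first.
    by rewrite lebesgue_measure_itv/= lte_fin ltrDl L0 -EFinD ltry.
  by apply: le_measure; rewrite ?inE; [exact: mU|exact: measurable_itv|exact: UaL].
have pt_le N k : pt N k <= pt N k.+1.
  by rewrite lerD2l ler_wpM2r ?ler_nat// ltW.
have s01 N x : 0 <= s N x <= 1.
  apply/andP; split; first by apply: sumr_ge0 => k _; rewrite mulr_ge0.
  apply: (@le_trans _ _ (\sum_(k < N.+1) \1_(I N k) x)).
    by apply: ler_sum => k _; case: (bad N k); rewrite ?mul1r// mul0r.
  rewrite (@sum_indic_itvoc (pt N)); first by rewrite indicE; case: (_ \in _).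
  by apply/nondecreasing_seqP => k; exact: pt_le.
have ms N : measurable_fun U (EFin \o s N).
  apply/measurable_EFinP; apply: measurable_sum => k.
  by apply: measurable_funM => //; apply: measurable_indic; exact: measurable_itv.
have intE N : (\int[leb]_(x in U) (s N x)%:E = (\sum_(k < N.+1) grid_defect U a (h N) k)%:E)%E.
  under eq_integral do rewrite -sumEFin.
  rewrite ge0_integral_sum//; last first.
  - move=> k; apply/measurable_EFinP; apply: measurable_funM => //.
    by apply: measurable_indic; exact: measurable_itv.
  rewrite -sumEFin; apply: eq_bigr => k _.
  under eq_integral do rewrite EFinM.
  rewrite ge0_integralZl//; last first.
  - apply/measurable_EFinP; apply: measurable_indic; exact: measurable_itv.
  rewrite integral_indic//; last exact: measurable_itv.
  rewrite /grid_defect -/(pt N k) -/(pt N k.+1) -/(bad N k) setIC.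
  case: (bad N k); last by rewrite mul0e.
  rewrite mul1e fineK// ge0_fin_numE//; apply: le_lt_trans Uoo.
  apply: le_measure; rewrite ?inE; [|exact: mU|by move=> x []].
  by apply: measurableI => //; exact: measurable_itv.
have := @dominated_convergence _ _ _ leb U mU (fun N => EFin \o s N) (cst 0%E) (cst 1%E) ms.
case => //.
- apply: aeW => x Ux.
  have /nbhs_ballP[e /= e0 eU] : nbhs x U by apply: open_nbhs_nbhs.
  apply: cvg_near_cst; near=> N; rewrite /s /= big1// => k _.
  rewrite indicE; case: (boolP (x \in _)) => [|_]; last by rewrite mulr0.
  rewrite inE /I /= in_itv/= => /andP[h1 h2]; rewrite /bad asboolF ?mul0r// => -[] y /=.
  rewrite in_itv/= => /andP[h3 h4]; apply: eU; rewrite /ball/=.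
  have hN : h N < e.
    rewrite /h ltr_pdivrMr// mulrC -ltr_pdivrMr//.
    apply: (@lt_trans _ _ N%:R); last by rewrite ltr_nat.
    by near: N; exact: nbhs_infty_gtr.
  have hk : pt N k.+1 = pt N k + h N by rewrite /pt -natr1 mulrDl mul1r addrA.
  by rewrite ltr_distl; apply/andP; split; lra.
- apply: (@measurable_bounded_integrable _ _ _ leb (cst 1)) => //.
  by apply: (@bounded_globally _ _ _ 1) => x _; rewrite normr1.
- by apply: aeW => x N _; have /andP[? ?] := s01 N x; rewrite /= lee_fin ger0_norm.
move=> _ _; rewrite integral0.
under eq_fun do rewrite intE.
by move/fine_cvgP => [_].
Unshelve. all: by end_near. Qed.

End line.

(** * The flux of a field through an arbitrary boundary *)

Section surface_measurability.
Context (R : realType).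

(** Bridge between the two sigma-algebras on the same space: the product one and the Caratheodory
    one carried by [surface]. *)
Lemma measurable_surface_id d :
  measurable_fun [set: surface R d] (fun x : surface R d => x : 'rV[R]_d).
Proof.
apply: measurable_fun_rVP => i.
apply: (measurability _ (RGenOInfty.measurableE R)) => _ [_ [c ->] <-].
rewrite setTI (_ : _ @^-1` _ = ~` [set x : surface R d | (x : 'rV[R]_d) ord0 i <= c]).
  by apply: measurableC; exact: measurable_hausdorff_le.
by apply/seteqP; split => x /=; rewrite in_itv/= andbT ltNge => /negP.
Qed.

Lemma measurable_surface d (A : set 'rV[R]_d) : measurable A ->
  measurable (A : set (surface R d)).
Proof.
move=> mA; rewrite -[X in measurable X]setTI.
exact: measurable_surface_id.
Qed.

Lemma continuous_measurable_surface d (f : 'rV[R]_d -> R) :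
  continuous f -> measurable_fun [set: surface R d] f.
Proof.
move=> /continuous_measurable_rV mf.
exact: measurableT_comp mf (@measurable_surface_id d).
Qed.

Lemma continuous_col' n (i : 'I_n.+1) :
  continuous (fun x : 'rV[R]_n.+1 => col' i x : 'rV[R]_n).
Proof.
move=> x; apply/cvg_ballP; first exact: (nbhs_filter x).
move=> e e0.
apply: filterS (nbhsx_ballx x e e0) => y [_ xy].
by split => // j k; rewrite !mxE; exact: xy.
Qed.

Lemma continuous_rVinsert n (i : 'I_n.+1) (y : 'rV[R]_n) :
  continuous (fun s : R => rVinsert i s y).
Proof.
move=> s; apply/cvg_ballP => e e0.
apply: filterS (nbhsx_ballx s e e0) => t st.
by split => // j k; rewrite !mxE; case: unlift => // a; exact: ballxx.
Qed.

Lemma measurable_compact_rV n (K : set 'rV[R]_n) : compact K -> measurable K.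
Proof. by move=> /(compact_closed (@norm_hausdorff _ _)); exact: measurable_closed_rV. Qed.

End surface_measurability.

Section fiber_majorant.
Local Open Scope ereal_scope.
Context (R : realType).

(* [4 (min(q, c/2) - min(q, c/4))] telescopes along [c = B / 2 ^ l]. *)
Lemma dyadic_superlevel_sum_le (B q : R) m : (0 <= q)%R -> (0 < B)%R ->
  (\sum_(l < m) B / 2 ^+ l * ((B / 2 ^+ l.+1 <= q)%R)%:R <= 4 * q)%R.
Proof.
move=> q0 B0.
pose t l : R := (- Num.min q (B / 2 ^+ l.+1))%R.
have B2 l : (0 < B / 2 ^+ l)%R by rewrite divr_gt0// exprn_gt0.
have BS l : (B / 2 ^+ l.+1 = B / 2 ^+ l / 2)%R by rewrite exprSr invfM mulrA.
apply: (@le_trans _ _ (\sum_(l < m) 4 * (t l.+1 - t l))%R).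
  apply: ler_sum => l _; rewrite /t opprK.
  have := B2 l; rewrite !BS; set c := (B / _)%R => c0.
  have [h|h] := leP (c / 2)%R q; rewrite ?mulr1 ?mulr0 !minElt;
    have [h1|h1] := ltP q (c / 2)%R; have [h2|h2] := ltP q (c / 2 / 2)%R; lra.
rewrite -mulr_sumr ler_wpM2l// -(big_mkord xpredT (fun l => t l.+1 - t l)%R).
rewrite telescope_sumr// /t opprK.
have h1 : (0 <= Num.min q (B / 2 ^+ m.+1))%R by rewrite le_min q0 ltW.
have h2 : (Num.min q (B / 2 ^+ 1) <= q)%R by rewrite ge_min lexx.
lra.
Qed.

(* [m] is a dyadic sum of indicators of projected superlevel sets of [q]. *)
Lemma fiber_majorant n (i : 'I_n.+1) : exists2 C : R, (0 < C)%R &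
  forall (K : set 'rV[R]_n.+1) (q : 'rV[R]_n.+1 -> R), compact K -> continuous q ->
    (forall x, 0 <= q x)%R ->
  exists m : 'rV[R]_n -> \bar R, [/\ measurable_fun setT m, forall y, 0 <= m y,
    forall x, K x -> (q x)%:E <= m (col' i x) &
    \int[lebesgue_rV R n]_y m y <=
      C%:E * \int[surface_measure R n.+1]_(x in K) (q x)%:E].
Proof.
have [C C0 projC] := @lebesgue_projection_le_hausdorff R n i.
exists (C * 4)%R => [|K q cK cq q0]; first by rewrite mulr_gt0.
have [B B0 qB] : exists2 B : R, (0 < B)%R & forall x, K x -> (q x <= B)%R.
  have [[x0 Kx0]|nK] := pselect (K !=set0); last first.
    by exists 1%R => // x Kx; exfalso; apply: nK; exists x.
  have [c _ cmax] : exists2 c, c \in K & forall x, x \in K -> (q x <= q c)%R.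
    by apply: compact_EVT_max => //; [exists x0|exact: continuous_subspaceT].
  exists (q c + 1)%R => [|x /mem_set/cmax]; first by rewrite ltr_wpDl.
  by move/le_trans; apply; rewrite lerDl.
pose lev l : R := (B / 2 ^+ l)%R.
have lev0 l : (0 < lev l)%R by rewrite divr_gt0// exprn_gt0.
(* The set is cut at half of the height [lev l] with which it is counted. This is what makes [m] a
   majorant, at the price of a factor 4. *)
pose Kl l := K `&` [set x | (lev l.+1 <= q x)%R].
have cKl l : compact (Kl l).
  apply: (subclosed_compact _ cK); last by move=> x [].
  apply: closedI; first exact: compact_closed (@norm_hausdorff _ _) cK.
  rewrite (_ : mkset _ = q @^-1` [set t | (lev l.+1 <= t)%R])//.
  by apply: closed_comp => [x _|]; [exact: cq|exact: closed_ge].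
(* Projections of measurable sets need not be measurable; those of compact sets are compact. *)
have mpKl l : measurable (col' i @` Kl l : set 'rV[R]_n).
  apply: measurable_compact_rV; apply: continuous_compact => //.
  by apply: continuous_subspaceT; exact: continuous_col'.
have mKl l : measurable (Kl l : set (surface R n.+1)).
  by apply: measurable_surface; exact: measurable_compact_rV.
have mK : measurable (K : set (surface R n.+1)).
  by apply: measurable_surface; exact: measurable_compact_rV.
pose m y := \sum_(l <oo) ((lev l)%:E * (\1_(col' i @` Kl l) y)%:E).
have term0 l y : 0 <= (lev l)%:E * (\1_(col' i @` Kl l) y)%:E.
  by rewrite mule_ge0// lee_fin ltW.
have mterm l : measurable_fun setT (fun y => (lev l)%:E * (\1_(col' i @` Kl l) y)%:E).
  by apply: measurable_funeM; apply/measurable_EFinP; exact: measurable_indic.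
exists m; split.
- by apply: ge0_emeasurable_sum => // l _.
- by move=> y; exact: nneseries_ge0.
- move=> x Kx; have := q0 x; rewrite le_eqVlt => /predU1P[<-|qx0].
    by apply: nneseries_ge0.
  (* The first level whose successor is below [q x]: by minimality [q x] is under the level itself,
     so the single term of index [l] already dominates. *)
  have [l /andP[levl qlev]] : exists l, (lev l.+1 <= q x <= lev l)%R.
    have ex : exists l, (lev l.+1 <= q x)%R.
      have Bq : (0 <= B / q x)%R by rewrite divr_ge0// ltW.
      exists (Num.bound (B / q x)).
      rewrite /lev ler_pdivrMr ?exprn_gt0// mulrC -ler_pdivrMr//.
      apply: ltW; apply: lt_le_trans (archi_boundP Bq) _.
      by rewrite -natrX ler_nat ltnW// (leq_trans (ltn_expl _ (ltnSn 1)))// leq_pexp2l.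
    case: (ex_minnP ex) => l hl lmin; exists l; rewrite hl/=.
    case: l => [|l] in hl lmin *; first by rewrite /lev expr0 divr1 qB.
    by rewrite leNgt; apply/negP => /ltW/lmin; rewrite ltnn.
  apply: (@le_trans _ _ (\sum_(0 <= j < l.+1) ((lev j)%:E * (\1_(col' i @` Kl j) (col' i x))%:E))).
    rewrite big_nat_recr//=; apply: (@le_trans _ _ (lev l)%:E); first by rewrite lee_fin.
    rewrite indicE mem_set ?mule1; last by exists x.
    by rewrite leeDr// sume_ge0.
  exact: nneseries_lim_ge.
rewrite integral_nneseries//.
apply: (@le_trans _ _ (\sum_(l <oo) (C%:E * \int[surface_measure R n.+1]_(x in K)
    ((lev l)%:E * (\1_(Kl l) x)%:E)))).
  apply: lee_nneseries => [l _ _|l _]; first exact: integral_ge0.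
  rewrite ge0_integralZl//; last 2 first.
  - by apply/measurable_EFinP; exact: measurable_indic.
  - by rewrite lee_fin ltW.
  rewrite ge0_integralZl//; last 2 first.
  - by apply/measurable_EFinP; exact: measurable_indic.
  - by rewrite lee_fin ltW.
  have h1 := integral_indic (lebesgue_rV R n) measurableT (mpKl l).
  have h2 := integral_indic (surface_measure R n.+1) mK (mKl l).
  rewrite h1.
  rewrite setIT.
  rewrite h2.
  rewrite muleCA; apply: lee_wpmul2l; first by rewrite lee_fin ltW.
  have -> : Kl l `&` K = Kl l by apply/setIidPl => x [].
  exact: projC.
have Kterm0 l x : 0 <= (lev l)%:E * (\1_(Kl l) x)%:E.
  by apply: mule_ge0; rewrite lee_fin// ltW.
rewrite nneseriesZl; last first.
  by move=> l _; apply: integral_ge0 => x _; exact: Kterm0.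
rewrite EFinM -muleA; apply: lee_wpmul2l; first by rewrite lee_fin ltW.
have mKterm l : measurable_fun (K : set (surface R n.+1))
    (fun x : surface R n.+1 => (lev l)%:E * (\1_(Kl l) x)%:E).
  by apply: measurable_funeM; apply/measurable_EFinP; exact: measurable_indic.
rewrite -integral_nneseries//.
have mq : measurable_fun (K : set (surface R n.+1)) (EFin \o q).
  apply/measurable_EFinP; apply: measurable_funTS.
  exact: continuous_measurable_surface.
rewrite -ge0_integralZl//; last by move=> x _; rewrite lee_fin.
apply: ge0_le_integral.
- exact: mK.
- by move=> x _; apply: nneseries_ge0 => l _ _; exact: Kterm0.
- by apply: ge0_emeasurable_sum => [l x _ _|l _]; [exact: Kterm0|exact: mKterm].
- by apply: measurable_funeM.
move=> x Kx; apply: lime_le; first by apply: is_cvg_nneseries => l _ _.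
apply: nearW => k; rewrite big_mkord.
have -> : \sum_(l < k) (lev l)%:E * (\1_(Kl l) x)%:E =
    (\sum_(l < k) B / 2 ^+ l * ((B / 2 ^+ l.+1 <= q x)%R)%:R)%:E.
  rewrite -sumEFin; apply: eq_bigr => l _; rewrite -EFinM indicE.
  have [h|h] := leP (B / 2 ^+ l.+1)%R (q x); first by rewrite mem_set.
  by rewrite memNset// => -[_] /=; rewrite leNgt h.
by rewrite lee_fin dyadic_superlevel_sum_le.
Qed.

End fiber_majorant.

(** * Continuity, integrability and iterated integrals over the space-time cylinder *)

Section cylinder_integrals.
Context (R : realType).
Local Notation leb := (@lebesgue_measure R).

Lemma integrable_bounded_itv (f : R -> R) (a b : R) :
  continuous f -> leb.-integrable `]a, b[ (EFin \o f).
Proof.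
move=> cf; have : leb.-integrable `[a, b] (EFin \o f).
  apply: continuous_compact_integrable; first exact: segment_compact.
  exact: continuous_subspaceT.
apply: integrableS; [exact: measurable_itv|exact: measurable_itv|].
exact: subset_itv_oo_cc.
Qed.

Lemma continuous_slice d (w : spacetime R d -> R) (x : 'rV[R]_d) :
  continuous w -> continuous (fun t : R => w (x, t)).
Proof.
have cpair : continuous (fun t : R => (x, t) : spacetime R d).
  move=> t; apply/cvg_ballP => e e0.
  by apply: filterS (nbhsx_ballx t e e0) => t' tt'; split => //=; exact: ballxx.
by move=> cw t; apply: continuous_comp; [exact: cpair|exact: cw].
Qed.

Lemma continuous_slice1 d (w : spacetime R d -> R) (t : R) :
  continuous w -> continuous (fun x : 'rV[R]_d => w (x, t)).
Proof.
have cpair : continuous (fun x : 'rV[R]_d => (x, t) : spacetime R d).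
  move=> x; apply/cvg_ballP; first exact: (nbhs_filter x).
  move=> e e0.
  by apply: filterS (nbhsx_ballx x e e0) => x' xx'; split => //=; exact: ballxx.
by move=> cw x; apply: continuous_comp; [exact: cpair|exact: cw].
Qed.

(** Compactness of [0, T] makes the continuity of [w] near [x0] uniform in time; an error [e / T] in
    the integrand then costs [e] in the integral. *)
Lemma continuous_Rintegral_param d (w : spacetime R d -> R) (T : R) :
  continuous w -> continuous (fun x : 'rV[R]_d => \int[leb]_(t in `]0, T[) w (x, t)).
Proof.
move=> cw; have [T0|T0] := leP T 0.
  by rewrite set_itv_ge -?leNgt//; under eq_fun do rewrite Rintegral_set0; exact: cst_continuous.
move=> x0; apply/cvgrPdist_le; first exact: (nbhs_filter x0).
move=> e e0.
have cov : \forall x \near x0, `[0, T]%classic `<=` [set t | `|w (x0, t) - w (x, t)| <= e / T].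
  have /compact_near_coveringP := @segment_compact R 0 T.
  move=> /(_ _ (nbhs x0) (fun x t => `|w (x0, t) - w (x, t)| <= e / T)).
  apply => t _.
  have eT : 0 < e / T / 2 by rewrite !divr_gt0.
  have /cvgrPdist_le/(_ _ eT) : w z @[z --> (x0, t)] --> w (x0, t) by exact: cw.
  move=> [[A B] /= [x0A tB] AB].
  exists (B, A) => //= -[t' x'] /= [Bt' Ax'].
  have h1 := AB (x', t') (conj Ax' Bt').
  have h2 := AB (x0, t') (conj (nbhs_singleton x0A) Bt').
  rewrite /= in h1 h2.
  have -> : w (x0, t') - w (x', t') = (w (x0, t) - w (x', t')) - (w (x0, t) - w (x0, t')) by ring.
  by apply: le_trans (ler_normB _ _) _; rewrite (splitr (e / T)) lerD.
apply: filterS cov => x wx.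
have int z : leb.-integrable `]0, T[ (EFin \o (fun t => w (z, t))).
  by apply: integrable_bounded_itv; exact: continuous_slice.
have intB : leb.-integrable `]0, T[ (EFin \o (fun t => w (x0, t) - w (x, t))).
  by apply: integrable_bounded_itv => t; apply: continuousB; exact: continuous_slice.
rewrite -RintegralB//.
apply: (le_trans (le_normr_Rintegral _ _)) => //.
apply: (@le_trans _ _ (\int[leb]_(t in `]0, T[) (e / T))).
  apply: le_Rintegral => //.
  - exact: integrable_norm.
  - by apply: integrable_bounded_itv; exact: cst_continuous.
  - by move=> t /subset_itv_oo_cc; exact: wx.
rewrite Rintegral_cst//.
have -> : fine (leb `]0, T[%classic) = T.
  by rewrite lebesgue_measure_itv/= lte_fin T0 -EFinD/= subr0.
by rewrite divfK// gt_eqF.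
Qed.

Lemma lebesgue_bounded_lty n (A : set 'rV[R]_n) : bounded_set A -> measurable A ->
  (lebesgue_rV R n A < +oo)%E.
Proof.
move=> [M [_ AM]] mA; pose r := `|M| + 1 : R.
have r0 : 0 <= r by rewrite addr_ge0.
apply: (@le_lt_trans _ _ ((2 * r) ^+ n)%:E); last exact: ltry.
rewrite -(lebesgue_rV_box (0 : 'rV[R]_n) r0); apply: le_measure; rewrite ?inE.
- exact: mA.
- exact: measurable_rV_box.
move=> x Ax i; rewrite mxE subr0; have Mr : M < r by rewrite /r (le_lt_trans (ler_norm _))// ltrDl.
have := AM _ Mr x Ax; rewrite /=; apply: le_trans.
by rewrite [leRHS]mx_normrE; exact: (le_bigmax _ (fun ij : 'I_1 * 'I_n => `|x ij.1 ij.2|) (0, i)).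
Qed.

Lemma measurable_cylinder d (A : set 'rV[R]_d) T : measurable A -> measurable (cylinder A T).
Proof. by move=> mA; apply: measurableX => //; exact: measurable_itv. Qed.

Lemma cylinder_lty d (A : set 'rV[R]_d) T : bounded_set A -> measurable A ->
  (spacetime_measure R d (cylinder A T) < +oo)%E.
Proof.
move=> bA mA.
have -> : spacetime_measure R d (cylinder A T) = (lebesgue_rV R d A * leb `]0%R, T[%classic)%E.
  by apply: product_measure1E => //; exact: measurable_itv.
apply: lte_mul_pinfty => //.
  by rewrite ge0_fin_numE//; exact: lebesgue_bounded_lty.
by rewrite lebesgue_measure_itv/=; case: ifPn => _; rewrite -?EFinD ltry.
Qed.

Lemma sum_indic_itvco (pt : nat -> R) m x : nondecreasing_seq pt ->
  \sum_(k < m) \1_(`[pt k, pt k.+1[%classic : set R) x =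
    \1_(`[pt 0, pt m[%classic : set R) x :> R.
Proof.
move=> npt; elim: m => [|m ih]; first by rewrite big_ord0 set_itvco0 indic0.
have p0m : pt 0 <= pt m by exact: npt.
have pmS : pt m <= pt m.+1 by exact: npt.
rewrite big_ord_recr/= ih !indicE !mem_setE !in_itv/=.
have [h1|h1] := ltP x (pt m); have [h2|h2] := leP (pt 0) x => //=;
  rewrite ?add0r ?addr0 ?andbF//.
- by rewrite (lt_le_trans h1).
- by have := lt_le_trans h2 (le_trans p0m h1); rewrite ltxx.
Qed.

(** A grid point belongs to two cells. Closed cells are used, despite the overlap, because they cut
    the boundary into compact slabs, as [fiber_majorant] requires. *)
Lemma sum_indic_itvcc (pt : nat -> R) m x : (forall k, pt k < pt k.+1) ->
  \sum_(k < m) \1_(`[pt k, pt k.+1]%classic : set R) x <= 2 :> R.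
Proof.
move=> ipt; have npt : nondecreasing_seq pt by apply/nondecreasing_seqP => k; exact: ltW.
apply: (@le_trans _ _ (\sum_(k < m)
   (\1_(`]pt k, pt k.+1]%classic : set R) x + \1_(`[pt k, pt k.+1[%classic : set R) x))).
  apply: ler_sum => k _; rewrite !indicE !mem_setE !in_itv/=.
  have := ipt k; case: (ltgtP x (pt k)) => //= h1 hk; case: (ltgtP x (pt k.+1)) => //= h2 /=;
    rewrite ?addr0 ?add0r//.
  - by rewrite lerDl.
  - by move: hk; rewrite -h1 h2 ltxx.
rewrite big_split/= sum_indic_itvoc// sum_indic_itvco// (_ : 2 = 1 + 1)//.
by rewrite lerD// indicE; case: (_ \in _).
Qed.

End cylinder_integrals.

Section iterated.
Context (R : realType).
Local Notation leb := (@lebesgue_measure R).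
Local Open Scope ereal_scope.

Lemma integrable_rVinsert n (i : 'I_n.+1) (f : 'rV[R]_n.+1 -> \bar R) :
  (lebesgue_rV R n.+1).-integrable setT f ->
  (lebesgue_rV R n \x leb).-integrable setT (fun p => f (rVinsert i p.2 p.1)).
Proof.
move=> /integrableP[mf foo]; have mfi := measurableT_comp mf (measurable_rVinsert i).
apply/integrableP; split; first exact: mfi.
have ma : measurable_fun setT (fun x => `|f x|) by exact: measurableT_comp mf.
have mb := measurableT_comp ma (measurable_rVinsert i).
rewrite (fubini_tonelli1 _ mb (fun=> abse_ge0 _)).
have h := integral_rVinsert i ma (fun=> abse_ge0 _).
by move: foo; rewrite h.
Qed.

Lemma integral_rVinsert_integrable n (i : 'I_n.+1) (f : 'rV[R]_n.+1 -> \bar R) :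
  (lebesgue_rV R n.+1).-integrable setT f ->
  \int[lebesgue_rV R n.+1]_x f x =
    \int[lebesgue_rV R n]_y \int[leb]_s f (rVinsert i s y).
Proof.
move=> intf; have inti := integrable_rVinsert i intf.
have mf := measurable_int _ intf.
rewrite -[RHS]/(\int[lebesgue_rV R n]_y fubini_F leb (fun p => f (rVinsert i p.2 p.1)) y).
rewrite (integral12_prod_meas1 inti) integralE [RHS]integralE.
have E (g : 'rV[R]_n.+1 -> \bar R) : measurable_fun setT g -> (forall x, 0 <= g x) ->
    \int[lebesgue_rV R n.+1]_x g x =
    \int[lebesgue_rV R n \x leb]_p g (rVinsert i p.2 p.1).
  move=> mg g0; rewrite (integral_rVinsert i mg g0).
  by rewrite (fubini_tonelli1 _ (measurableT_comp mg (measurable_rVinsert i)) (fun=> g0 _)).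
rewrite (E _ (measurable_funepos mf) (funepos_ge0 _)).
rewrite (E _ (measurable_funeneg mf) (funeneg_ge0 _)).
by congr (_ - _); apply: eq_integral => p _; rewrite ?funeposE ?funenegE.
Qed.

Lemma integral_spacetime_line n (i : 'I_n.+1) (g : spacetime R n.+1 -> \bar R) :
  (spacetime_measure R n.+1).-integrable setT g ->
  \int[spacetime_measure R n.+1]_z g z =
  \int[lebesgue_rV R n]_y \int[leb]_s \int[leb]_t g (rVinsert i s y, t).
Proof.
move=> intg; have h := integral_rVinsert_integrable i (integrable_fubini_F intg).
exact: etrans (esym (integral12_prod_meas1 intg)) h.
Qed.

Lemma le_limn_einf_of_vanishing (u : (\bar R)^nat) (eps : R^nat) (x : \bar R) :
  (forall n, x <= u n + (eps n)%:E) -> eps n @[n --> \oo] --> (0 : R)%R ->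
  x <= limn_einf u.
Proof.
move=> xu eps0; apply/lee_addgt0Pr => e e0.
have /cvgr0Pnorm_lt/(_ e e0)[n0 _ epsn] := eps0.
rewrite -leeBlDr//; apply: (@le_trans _ _ (einfs u n0)).
  apply: le_ereal_inf_tmp => _ [k n0k <-]; rewrite leeBlDr//.
  apply: le_trans (xu k) _; rewrite leeD2l// lee_fin.
  by apply: le_trans (ler_norm _) _; rewrite ltW// epsn.
rewrite limn_einf_lim; apply: (@le_trans _ _ (ereal_sup (range (einfs u)))).
  by apply: ereal_sup_ubound; exists n0.
by rewrite (cvg_lim _ (ereal_nondecreasing_cvgn (nondecreasing_einfs u))).
Qed.

Lemma limn_einf_le (u : (\bar R)^nat) (c : \bar R) :
  (forall n, u n <= c) -> limn_einf u <= c.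
Proof.
move=> uc; rewrite limn_einf_lim.
rewrite (cvg_lim _ (ereal_nondecreasing_cvgn (nondecreasing_einfs u)))//.
apply: ge_ereal_sup => _ [n _ <-]; apply: le_trans (uc n).
by apply: ereal_inf_lbound; exists n => /=.
Qed.

End iterated.

Section line_derivative.
Context (R : realType).

Lemma is_derive_line (V : normedModType R) (f : V -> R) (x v : V) (s l : R) :
  is_derive (x + s *: v) v f l -> is_derive s 1 (fun r : R => f (x + r *: v)) l.
Proof.
move=> [df fE].
have E : (fun h : R => h^-1 *: (f (x + (h *: (1 : R) + s) *: v) - f (x + s *: v))) =
   (fun h : R => h^-1 *: (f (h *: v + (x + s *: v)) - f (x + s *: v))).
  apply/funext => h; congr (_ *: (f _ - _)).
  by rewrite scalerDl [h *: 1]mulr1 addrCA.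
split; first by rewrite /derivable/= E; exact: df.
by rewrite /derive/= E; exact: fE.
Qed.

Lemma within_continuous_comp (S T U : topologicalType) (A : set S) (B : set T)
    (g : S -> T) (f : T -> U) : continuous g -> (forall s, A s -> B (g s)) ->
  {within B, continuous f} -> {within A, continuous (fun s => f (g s))}.
Proof.
move=> cg AB /subspace_continuousP cf; apply/subspace_continuousP => s As.
apply: (@cvg_comp _ _ _ g f _ (within B (nbhs (g s)))); last exact: cf (AB _ As).
move=> X /cg; rewrite /fmap/= /within/= !near_simpl; apply: filterS => s' h As'.
by apply: h; exact: AB.
Qed.

Lemma Rintegral_sum_seq (I : eqType) (r : seq I) (f : I -> R -> R) (T : R) :
  (forall z, continuous (f z)) ->
  \int[lebesgue_measure]_(t in `]0, T[) (\sum_(z <- r) f z t) =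
  \sum_(z <- r) \int[lebesgue_measure]_(t in `]0, T[) f z t.
Proof.
move=> cf; elim: r => [|a r ih].
  by under eq_Rintegral do rewrite big_nil; rewrite Rintegral_cst// mul0r big_nil.
under eq_Rintegral do rewrite big_cons.
rewrite RintegralD//; first by rewrite ih big_cons.
- exact: integrable_bounded_itv.
- apply: integrable_bounded_itv; apply: continuous_big => [|i _]; last exact: cf.
  exact: add_continuous.
Qed.

End line_derivative.

Section line_estimate.
Context (R : realType).
Local Notation leb := (@lebesgue_measure R).

(** Fubini puts the line variable innermost, where the grid bound holds at each fixed time. Neither
    [U] nor [V] depends on time, hence neither do the gaps, and the time integral can be moved
    inside the sum over them. The majorant [w] is continuous in time, which makes these integrals
    meaningful although [f] is controlled on the open time interval only. *)
Lemma iterated_line_estimate (U V : set R) (a h T M : R) (N : nat)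
    (oU : open U) (cV : closed V) (UV : U `<=` V) (h0 : 0 < h)
    (f g w : R * R -> R) :
  (forall x, U x -> a < x < a + N%:R * h) -> 0 < T ->
  (forall t, 0 < t < T -> {within V, continuous (fun s => f (s, t))}) ->
  (forall t, 0 < t < T -> {within V, continuous (fun s => g (s, t))}) ->
  (forall s t, U s -> 0 < t < T -> is_derive s 1 (fun r : R => f (r, t)) (g (s, t))) ->
  (forall s t, U s -> 0 < t < T -> `|g (s, t)| <= M) ->
  measurable_fun [set: measurableTypeR R * measurableTypeR R]
    (g \_ (U `*` `]0, T[)) ->
  (forall z, continuous (fun t => w (z, t))) ->
  (forall s t, V s -> 0 < t < T -> `|f (s, t)| <= w (s, t)) ->
  (`|\int[leb]_s \int[leb]_t ((g \_ (U `*` `]0, T[)) (s, t))%:E| <=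
   (\sum_(k < N) (\sum_(z <- grid_gaps a h oU cV UV k)
        \int[leb]_(t in `]0, T[) w (z, t)) +
    3 * M * T * \sum_(k < N) grid_defect U a h k)%:E)%E.
Proof.
move=> UaN T0 cf cg dfg gM mgt cw fw.
set gt := g \_ _ in mgt *.
pose D : set (measurableTypeR R * measurableTypeR R) := U `*` `]0, T[.
have mU : measurable (U : set (measurableTypeR R)) by exact: open_measurable.
have mD : measurable D by apply: measurableX => //; exact: measurable_itv.
have Uoo : (leb U < +oo)%E.
  apply: (@le_lt_trans _ _ (leb `]a, a + N%:R * h[%classic)); last first.
    by rewrite lebesgue_measure_itv/=; case: ifPn => _; rewrite -?EFinD ltry.
  by apply: le_measure; rewrite ?inE; [exact: mU|exact: measurable_itv|exact: UaN].
have Too : (leb `]0%R, T[ = T%:E)%E.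
  by rewrite lebesgue_measure_itv/= lte_fin T0 -EFinD subr0.
have Doo : ((leb \x leb)%E D < +oo)%E.
  have -> : ((leb \x leb) D = leb U * leb `]0%R, T[)%E.
    by apply: product_measure1E => //; exact: measurable_itv.
  rewrite Too; apply: lte_mul_pinfty => //; [by rewrite ge0_fin_numE|exact: ltry].
have igt : (leb \x leb)%E.-integrable setT (EFin \o gt).
  have -> : EFin \o gt = (EFin \o g) \_ D by rewrite restrict_EFin.
  apply/(integrable_mkcond _ mD); apply: measurable_bounded_integrable => //.
    by apply/(measurable_restrictT _ mD).
  apply: (@bounded_globally _ _ _ _ M) => -[s t] [/= Us]; rewrite in_itv/=.
  exact: gM.
have gsec t : 0 < t < T -> leb.-integrable U (EFin \o (fun s => g (s, t))).
  move=> tT; apply: measurable_bounded_integrable => //.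
    apply: open_continuous_measurable_fun => //.
    by have := continuous_subspaceW UV (cg t tT); rewrite continuous_open_subspace.
  by apply: (@bounded_globally _ _ _ _ M) => s Us; exact: gM.
rewrite (Fubini igt).
rewrite -[X in (`|X| <= _)%E]/(\int[leb]_t fubini_G leb (EFin \o gt) t)%E.
have h1 := le_abse_integral leb measurableT (measurable_fubini_G igt).
apply: (le_trans h1).
pose dN := \sum_(k < N) grid_defect U a h k.
pose zs k := grid_gaps a h oU cV UV k.
pose b t := \sum_(k < N) \sum_(z <- zs k) w (z, t) + 3 * M * dN.
have cb1 k : continuous (fun t => \sum_(z <- zs k) w (z, t)).
  by apply: continuous_big => [|z _]; [exact: add_continuous|exact: cw].
have cb2 : continuous (fun t => \sum_(k < N) \sum_(z <- zs k) w (z, t)).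
  by apply: continuous_big => [|k _]; [exact: add_continuous|exact: cb1].
have cb : continuous b.
  by move=> t; apply: (continuousD (cb2 t)); exact: cst_continuous.
apply: (@le_trans _ _ (\int[leb]_t ((b \_ `]0%R, T[) t)%:E)%E).
  apply: ge0_le_integral => //.
  - apply: measurableT_comp => //; exact: (measurable_fubini_G igt).
  - apply/measurable_EFinP; apply/(measurable_restrictT b (measurable_itv `]0, T[)).
    by apply: measurable_funTS; apply: continuous_measurable_fun.
  move=> t _; rewrite /fubini_G/=.
  have [tT|tT] := boolP (t \in `]0, T[); last first.
    rewrite integral0_eq ?abse0; last first.
      by move=> s _; rewrite /gt patchN// notin_setE => -[_ /=]; exact/negP.
    by rewrite patchN// notin_setE; exact/negP.
  have tT' : 0 < t < T by move: tT; rewrite in_itv.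
  rewrite patchT ?inE//.
  have -> : (\int[leb]_s (gt (s, t))%:E = (\int[leb]_(s in U) g (s, t))%:E)%E.
    rewrite /Rintegral fineK; last by apply: integrable_fin_num => //; exact: gsec.
    rewrite [RHS]integral_mkcond; apply: eq_integral => s _.
    rewrite /gt /patch /=.
    have [Us|Us] := boolP (s \in U).
      by rewrite mem_set//; split => //=; exact: set_mem.
    by rewrite memNset// => -[/= /mem_set]; rewrite (negbTE Us).
  have h2 := Rintegral_grid_le oU cV UV h0 (cf t tT') (cg t tT')
    (fun s Us => dfg s t Us tT') (fun s Us => gM s t Us tT') UaN.
  rewrite lee_fin; apply: (le_trans h2).
  rewrite big_split/= -mulr_sumr lerD2r; apply: ler_sum => k _.
  rewrite big_seq [leRHS]big_seq; apply: ler_sum => z /grid_gapsP[_ Vz _].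
  exact: fw.
have -> : (\int[leb]_t ((b \_ `]0%R, T[) t)%:E = (\int[leb]_(t in `]0%R, T[) b t)%:E)%E.
  rewrite /Rintegral fineK; last first.
    by apply: integrable_fin_num => //; exact: integrable_bounded_itv.
  by rewrite [RHS]integral_mkcond restrict_EFin.
rewrite lee_fin RintegralD//; last 2 first.
- exact: integrable_bounded_itv.
- by apply: integrable_bounded_itv; exact: cst_continuous.
rewrite Rintegral_cst// -[X in fine X]/(leb `]0, T[%classic) Too/= mulrAC.
rewrite lerD2r (Rintegral_sum_seq _ T (fun k : 'I_N => cb1 k)) ler_sum// => k _.
by rewrite Rintegral_sum_seq.
Qed.

End line_estimate.

(** * From lines to the whole domain: the divergence bound *)

Section divergence.
Context (R : realType).
Local Notation leb := (@lebesgue_measure R).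

Lemma sum_le_double (I : eqType) (s : seq I) (F : I -> \bar R) (m : \bar R) :
  (size s <= 2)%N -> (0 <= m)%E -> (forall z, z \in s -> (F z <= m)%E) ->
  (\sum_(z <- s) F z <= 2%:E * m)%E.
Proof.
have -> : (2%:E * m = m + m)%E by rewrite (mule_natl m 2).
case: s => [|x [|y [|]]]//= _ m0 Fm.
- by rewrite big_nil adde_ge0.
- by rewrite big_seq1; apply: le_trans (Fm _ _) _; rewrite ?leeDl// mem_head.
- rewrite big_cons big_seq1 leeD// Fm// !inE eqxx ?orbT//.
Qed.

(** A nonnegative integral is a supremum over simple functions below the integrand, hence monotone
    for all nonnegative integrands, measurable or not. *)
Lemma le_integral_nonneg d (T : measurableType d) (mu : {measure set T -> \bar R})
    (f1 f2 : T -> \bar R) : (forall x, (0 <= f1 x)%E) ->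
  (forall x, (f1 x <= f2 x)%E) -> (\int[mu]_x f1 x <= \int[mu]_x f2 x)%E.
Proof.
move=> f10 f12; have f20 x : (0 <= f2 x)%E := le_trans (f10 x) (f12 x).
rewrite ge0_integralE// [leRHS]ge0_integralE//.
apply: ereal_sup_le => _ [h /= hf <-]; exists h => //=.
by move=> x; apply: le_trans (hf x) _; rewrite !patch_setT.
Qed.

Lemma compact_closure_rV n (A : set 'rV[R]_n) : bounded_set A -> compact (closure A).
Proof.
move=> bA; apply: bounded_closed_compact; last exact: closed_closure.
have [M [Mr AM]] := bA; exists M; split => // r Mr' x clx.
have : closure [set z : 'rV[R]_n | `|z| <= r] x.
  by apply: closure_subset clx; exact: AM.
have /closure_id <- // : closed [set z : 'rV[R]_n | `|z| <= r].
rewrite (_ : mkset _ = (fun z : 'rV[R]_n => `|z|) @^-1` [set t | t <= r])//.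
by apply: closed_comp => [z _|]; [exact: norm_continuous|exact: closed_le].
Qed.

Lemma compact_boundary n (A : set 'rV[R]_n) : bounded_set A -> compact (boundary A).
Proof.
move=> bA; apply: (subclosed_compact _ (compact_closure_rV bA)); last by move=> x [].
rewrite /boundary setDE; apply: closedI; first exact: closed_closure.
by apply: open_closedC; exact: open_interior.
Qed.

Lemma sum_integral_setI_le d (T : measurableType d) (mu : {measure set T -> \bar R})
    (D : set T) (q : T -> R) (P : nat -> set T) (m : nat) (c : R) :
  measurable D -> measurable_fun D q -> (forall x, 0 <= q x) ->
  (forall k, measurable (P k)) -> 0 <= c ->
  (forall x, D x -> \sum_(k < m) \1_(P k) x <= c) ->
  (\sum_(k < m) \int[mu]_(x in D `&` P k) (q x)%:E <=
   c%:E * \int[mu]_(x in D) (q x)%:E)%E.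
Proof.
move=> mD mq q0 mP c0 Pc.
have mqP k : measurable_fun D (fun x => (q x * \1_(P k) x)%:E).
  by apply/measurable_EFinP; apply: measurable_funM.
have E k : (\int[mu]_(x in D `&` P k) (q x)%:E = \int[mu]_(x in D) (q x * \1_(P k) x)%:E)%E.
  rewrite integral_mkcondr; apply: eq_integral => x _; rewrite patchE indicE.
  by case: (x \in P k); rewrite ?mulr1 ?mulr0.
under eq_bigr do rewrite E.
rewrite -ge0_integral_sum//; last by move=> k x _; rewrite lee_fin mulr_ge0.
rewrite -ge0_integralZl//; last 2 first.
- exact/measurable_EFinP.
- by move=> x _; rewrite lee_fin.
apply: ge0_le_integral => //.
- by move=> x _; apply: sume_ge0 => k _; rewrite lee_fin mulr_ge0.
- by apply: emeasurable_sum => k.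
- by apply: measurable_funeM; exact/measurable_EFinP.
move=> x Dx; rewrite sumEFin -EFinM lee_fin -mulr_sumr mulrC ler_wpM2r//.
exact: Pc.
Qed.

(** [F] stands for one component of a field and [G] for its derivative in that direction. On each
    line the gaps lie on the boundary, and the value at a gap is below the majorant of the slab
    containing it; integrating the majorants over the lines gives surface integrals. In [4 * C], one
    factor 2 counts the gaps of a cell and the other the overlap of closed slabs. *)
Lemma divergence_bound n (i : 'I_n.+1) : exists2 C : R, 0 < C &
  forall (Omega : set 'rV[R]_n.+1) (T M : R) (F G W : spacetime R n.+1 -> R),
  open Omega -> bounded_set Omega -> 0 < T ->
  (forall t, 0 < t < T -> {within closure Omega, continuous (fun x => F (x, t))}) ->
  (forall t, 0 < t < T -> {within closure Omega, continuous (fun x => G (x, t))}) ->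
  (forall x t, Omega x -> 0 < t < T ->
    is_derive x (delta_mx 0 i) (fun x => F (x, t)) (G (x, t))) ->
  measurable_fun (cylinder Omega T) G ->
  (forall x t, Omega x -> 0 < t < T -> `|G (x, t)| <= M) ->
  continuous W -> (forall z, 0 <= W z) ->
  (forall x t, closure Omega x -> 0 < t < T -> `|F (x, t)| <= W (x, t)) ->
  (`|\int[spacetime_measure R n.+1]_(z in cylinder Omega T) G z|%:E <=
   C%:E * \int[surface_measure R n.+1]_(x in boundary Omega)
            (\int[leb]_(t in `]0%R, T[) W (x, t))%:E)%E.
Proof.
have [C C0 HC] := @fiber_majorant R n i.
exists (4 * C) => [|Omega T M F G W oO bO T0 cF cG dFG mG GM cW W0 FW].
  by rewrite mulr_gt0.
pose q (x : 'rV[R]_n.+1) := \int[leb]_(t in `]0, T[) W (x, t).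
have cq : continuous q by exact: continuous_Rintegral_param.
have q0 x : 0 <= q x by apply: Rintegral_ge0 => t _; exact: W0.
have mO : measurable Omega by exact: measurable_open_rV.
have mQ : measurable (cylinder Omega T) by exact: measurable_cylinder.
have Qoo := @cylinder_lty R n.+1 Omega T bO mO.
have [B B0 OB] : exists2 B : R, 0 < B & forall x, Omega x -> `|x 0 i| < B.
  have [A [_ OA]] := bO; exists (`|A| + 2) => [|x Ox]; first by rewrite ltr_wpDl.
  have A1 : A < `|A| + 1 by rewrite (le_lt_trans (ler_norm _))// ltrDl.
  apply: (@le_lt_trans _ _ (`|A| + 1)); last by rewrite ltrD2l ltr1n.
  apply: le_trans (OA _ A1 x Ox); rewrite [leRHS]mx_normrE.
  exact: (le_bigmax _ (fun ij : 'I_1 * 'I_n.+1 => `|x ij.1 ij.2|) (0, i)).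
pose gt := G \_ (cylinder Omega T).
have igt : (spacetime_measure R n.+1).-integrable setT (EFin \o gt).
  have -> : EFin \o gt = (EFin \o G) \_ (cylinder Omega T) by rewrite restrict_EFin.
  apply/(integrable_mkcond _ mQ); apply: measurable_bounded_integrable => //.
  apply: (@bounded_globally _ _ _ _ M) => -[x t] [/= Ox]; rewrite in_itv/=.
  exact: GM.
pose Phi (y : 'rV[R]_n) (s : R) := (\int[leb]_t (gt (rVinsert i s y, t))%:E)%E.
pose Theta y := (\int[leb]_s Phi y s)%E.
have GE : ((\int[spacetime_measure R n.+1]_(z in cylinder Omega T) G z)%:E =
    \int[lebesgue_rV R n]_y Theta y)%E.
  rewrite -(integral_spacetime_line i igt) /Rintegral fineK; last first.
    apply: integrable_fin_num => //; apply/(integrable_mkcond _ mQ).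
    by rewrite restrict_EFin.
  by rewrite integral_mkcond restrict_EFin.
have mTheta : measurable_fun setT Theta.
  exact: (measurable_fubini_F (integrable_rVinsert i (integrable_fubini_F igt))).
(* One grid on [-B, B] serves all lines, so the slabs and their majorants do not depend on [y]. *)
pose a : R := - B; pose h N : R := 2 * B / N.+1%:R.
have h0 N : 0 < h N by rewrite divr_gt0// mulr_gt0.
pose pt N k : R := a + k%:R * h N.
have ipt N k : pt N k < pt N k.+1.
  by rewrite ltrD2l ltr_pM2r// ltr_nat.
pose K N k := boundary Omega `&` [set x | pt N k <= x 0 i <= pt N k.+1].
have cK N k : compact (K N k).
  apply: (subclosed_compact _ (compact_boundary bO)); last by move=> x [].
  have -> : K N k = boundary Omega `&`
      (fun x : 'rV[R]_n.+1 => x 0 i) @^-1` `[pt N k, pt N k.+1]%classic.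
    by apply/seteqP; split => x [? h1]; split => //; move: h1; rewrite /= in_itv.
  apply: closedI.
    exact: compact_closed (@norm_hausdorff _ _) (compact_boundary bO).
  by apply: closed_comp => [x _|]; [exact: continuous_coord|exact: itv_closed].
pose m N k := sval (cid (HC _ q (cK N k) cq q0)).
have mm N k : measurable_fun setT (m N k) by case: (svalP (cid (HC _ q (cK N k) cq q0))).
have m0 N k y : (0 <= m N k y)%E.
  by case: (svalP (cid (HC _ q (cK N k) cq q0))) => _ hK _ _; exact: hK.
have mq N k x : K N k x -> ((q x)%:E <= m N k (col' i x))%E.
  by case: (svalP (cid (HC _ q (cK N k) cq q0))) => _ _ hK _; exact: hK.
have mint N k : (\int[lebesgue_rV R n]_y m N k y <=
    C%:E * \int[surface_measure R n.+1]_(x in K N k) (q x)%:E)%E.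
  by case: (svalP (cid (HC _ q (cK N k) cq q0))).
pose S N y := (\sum_(k < N.+1) 2%:E * m N k y)%E.
have S0 N y : (0 <= S N y)%E.
  by apply: sume_ge0 => k _; apply: mule_ge0.
have ThetaS y : (`|Theta y| <= limn_einf (S ^~ y))%E.
  pose U := [set s : R | Omega (rVinsert i s y)].
  pose V := [set s : R | closure Omega (rVinsert i s y)].
  have oU : open U.
    apply: (@open_comp _ _ (fun s : R => rVinsert i s y) Omega) => // s _.
    exact: continuous_rVinsert.
  have cV : closed V.
    apply: (@preimage_closed _ _ (fun s : R => rVinsert i s y) (closure Omega)) => [s _|].
      exact: continuous_rVinsert.
    exact: closed_closure.
  have UV : U `<=` V by move=> s Us; apply: subset_closure.
  have UB s : U s -> a < s < a + 2 * B.
    move=> /OB; rewrite rVinsert_id ltr_norml /a => /andP[-> /= sB].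
    by apply: lt_le_trans sB _; rewrite mulr_natl mulr2n addrA addNr add0r.
  have UaN N s : U s -> a < s < a + N.+1%:R * h N.
    by rewrite /h mulrCA divff ?mulr1 ?pnatr_eq0//; exact: UB.
  (* The defect of this line vanishes as the mesh is refined; since the rate depends on [y], what
     remains is a pointwise lower limit. *)
  apply: (@le_limn_einf_of_vanishing _ _
    (fun N => 3 * M * T * \sum_(k < N.+1) grid_defect U a (h N) k)); last first.
    rewrite -[X in _ --> X](mulr0 (3 * M * T)); apply: cvgMr.
    by apply: grid_defect_cvg0 => //; rewrite mulr_gt0.
  move=> N.
  have := @iterated_line_estimate R U V a (h N) T M N.+1 oU cV UV (h0 N)
    (fun p => F (rVinsert i p.1 y, p.2)) (fun p => G (rVinsert i p.1 y, p.2))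
    (fun p => W (rVinsert i p.1 y, p.2)) (UaN N) T0.
  have ThetaE : Theta y = (\int[leb]_s \int[leb]_t
     (((fun p : R * R => G (rVinsert i p.1 y, p.2)) \_ (U `*` `]0%R, T[)) (s, t))%:E)%E.
    apply: eq_integral => s _; apply: eq_integral => t _.
    by rewrite /gt /patch.
  rewrite -ThetaE => est.
  apply: (@le_trans _ _ (\sum_(k < N.+1) \sum_(z <- grid_gaps a (h N) oU cV UV k)
      q (rVinsert i z y) + 3 * M * T * \sum_(k < N.+1) grid_defect U a (h N) k)%:E); last first.
    rewrite EFinD leeD2r// -sumEFin; apply: lee_sum => k _.
    rewrite -sumEFin; apply: sum_le_double => //; first exact: size_grid_gaps.
    move=> z /grid_gapsP[zJ Vz Uz]; rewrite -[X in m N k X](col'_rVinsert i z).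
    apply: mq; split; last by rewrite /= rVinsert_id.
    (* A gap is in the closure but not in the open set [Omega], which is its own interior: it is a
       boundary point. *)
    by split => //; have /interior_id -> := oO.
  apply: est.
  - move=> t tT; apply: (@within_continuous_comp _ _ _ V (closure Omega)
      (fun s : R => rVinsert i s y) (fun x => F (x, t))) => //; last exact: cF.
    exact: continuous_rVinsert.
  - move=> t tT; apply: (@within_continuous_comp _ _ _ V (closure Omega)
      (fun s : R => rVinsert i s y) (fun x => G (x, t))) => //; last exact: cG.
    exact: continuous_rVinsert.
  - move=> s t Us tT /=.
    have -> : (fun r : R => F (rVinsert i r y, t)) =
        (fun r : R => (fun x => F (x, t)) (rVinsert i 0 y + r *: delta_mx 0 i)).
      by apply/funext => r; rewrite -rVinsertD add0r.
    apply: (is_derive_line (f := fun x => F (x, t))).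
    by rewrite -rVinsertD add0r; exact: dFG.
  - by move=> s t Us tT; exact: GM.
  - have -> : (fun p : R * R => G (rVinsert i p.1 y, p.2)) \_ (U `*` `]0, T[) =
        gt \o (fun p : measurableTypeR R * measurableTypeR R => (rVinsert i p.1 y, p.2)).
      by apply/funext => -[s t]; rewrite /gt /= /patch.
    apply: measurableT_comp; first by apply/(measurable_restrictT _ mQ).
    apply/measurable_fun_pairP; split => /=; last exact: measurable_snd.
    exact: measurableT_comp (measurable_rVinsert2 i y) measurable_fst.
  - by move=> z; exact: (@continuous_slice _ _ W (rVinsert i z y) cW).
  - by move=> s t Vs tT; exact: FW.
have intS N : (\int[lebesgue_rV R n]_y S N y <=
    (4 * C)%:E * \int[surface_measure R n.+1]_(x in boundary Omega) (q x)%:E)%E.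
  rewrite ge0_integral_sum//; last 2 first.
  - by move=> k; exact: measurable_funeM.
  - by move=> k y _; exact: mule_ge0.
  have mb : measurable (boundary Omega : set (surface R n.+1)).
    by apply: measurable_surface; apply: measurable_compact_rV; exact: compact_boundary.
  pose P k : set (surface R n.+1) := [set x | pt N k <= (x : 'rV[R]_n.+1) 0 i <= pt N k.+1].
  have mP k : measurable (P k).
    apply: measurable_surface; apply: measurable_closed_rV.
    rewrite (_ : P k = (fun x : 'rV[R]_n.+1 => x 0 i) @^-1` `[pt N k, pt N k.+1]%classic).
      by apply: closed_comp => [x _|]; [exact: continuous_coord|exact: itv_closed].
    by apply/seteqP; split => x; rewrite /P /= in_itv.
  have mq' : measurable_fun (boundary Omega : set (surface R n.+1)) q.
    by apply: measurable_funTS; exact: continuous_measurable_surface.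
  have P2 (x : surface R n.+1) : boundary Omega x -> \sum_(k < N.+1) \1_(P k) x <= 2 :> R.
    move=> _; apply: le_trans (@sum_indic_itvcc R (pt N) N.+1 ((x : 'rV[R]_n.+1) 0 i) (ipt N)).
    apply: ler_sum => k _; rewrite !indicE.
    case: (boolP (x \in P k)) => [/set_mem h1|_]; last exact: ler0n.
    by rewrite mem_set//= in_itv.
  have c2 : 0 <= 2 :> R by [].
  have h2 := sum_integral_setI_le (surface_measure R n.+1) mb mq' q0 mP c2 P2.
  apply: (@le_trans _ _ ((2 * C)%:E * (2%:E *
      \int[surface_measure R n.+1]_(x in boundary Omega) (q x)%:E))%E); last first.
    by rewrite muleA -EFinM mulrAC -natrM.
  apply: (@le_trans _ _ ((2 * C)%:E * \sum_(k < N.+1)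
     \int[surface_measure R n.+1]_(x in boundary Omega `&` P k) (q x)%:E)%E); last first.
    by apply: lee_wpmul2l; rewrite ?lee_fin ?mulr_ge0 ?(ltW C0)//.
  rewrite ge0_sume_distrr; last first.
    by move=> k _; apply: integral_ge0 => x _; rewrite lee_fin.
  apply: lee_sum => k _; rewrite ge0_integralZl// EFinM -muleA.
  by apply: lee_wpmul2l => //; exact: mint.
rewrite -[leLHS]/(`|(\int[spacetime_measure R n.+1]_(z in cylinder Omega T) G z)%:E|)%E GE.
have h1 := le_abse_integral (lebesgue_rV R n) measurableT mTheta.
apply: (le_trans h1).
apply: (@le_trans _ _ (\int[lebesgue_rV R n]_y limn_einf (S ^~ y))%E).
  apply: le_integral_nonneg => y; [exact: abse_ge0|exact: ThetaS].
have mS N : measurable_fun setT (S N).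
  by apply: emeasurable_sum => k; exact: measurable_funeM.
apply: le_trans (fatou _ measurableT mS (fun N y _ => S0 N y)) _.
exact: limn_einf_le.
Qed.

End divergence.

(** * Tonelli's inequality and the measure on the lateral boundary *)

Section tonelli.
Local Open Scope ereal_scope.
Context d1 d2 (T1 : measurableType d1) (T2 : measurableType d2) (R : realType).
Context (m1 : {measure set T1 -> \bar R}) (m2 : {sigma_finite_measure set T2 -> \bar R}).

Import HBNNSimple.

(** The product measure is defined by integrating the [m2]-measures of sections against [m1]; for
    indicators the identity is this definition, and linearity does the rest. *)
Lemma integral_nnsfun_product (h : {nnsfun T1 * T2 >-> R}) :
  \int[m1]_x \int[m2]_y (h (x, y))%:E = \int[m1 \x m2]_z (h z)%:E.
Proof.
rewrite integral_nnsfun// patch_setT sintegralE.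
transitivity (\int[m1]_x fubini_F m2 (EFin \o h) x); first by [].
rewrite sfun_fubini_tonelli_FE ge0_integral_fsum//; last 2 first.
- by move=> k; apply: measurable_funeM; exact: measurable_fun_xsection.
- move=> k x _; have [k0|k0] := leP 0%R k; first by rewrite mule_ge0.
  rewrite (_ : h @^-1` [set k] = set0) ?xsection0 ?measure0 ?mule0//.
  by apply/seteqP; split => // z /= hz; move: k0; rewrite -hz ltNge fun_ge0.
apply: eq_fsbigr => k /set_mem[z _ <-].
rewrite ge0_integralZl//; last by rewrite lee_fin fun_ge0.
exact: measurable_fun_xsection.
Qed.

(* Unlike the library's version, [m1] need not be sigma-finite. *)
Lemma le_integral_product (f : T1 * T2 -> \bar R) :
  measurable_fun setT f -> (forall z, 0 <= f z) ->
  \int[m1]_x \int[m2]_y f (x, y) <= \int[m1 \x m2]_z f z.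
Proof.
move=> mf f0; pose g := nnsfun_approx measurableT mf.
have gf z : (EFin \o g ^~ z) n @[n --> \oo] --> f z by exact: cvg_nnsfun_approx.
have fE z : f z = limn_einf (fun n => (g n z)%:E) by rewrite (cvg_limn_einf_sup (gf z)).1.
have gle n z : (g n z)%:E <= f z.
  have nd : nondecreasing_seq (fun n => (g n z)%:E).
    by move=> a b ab; rewrite lee_fin; exact/lefP/nd_nnsfun_approx.
  rewrite -(cvg_lim _ (gf z))// (cvg_lim _ (ereal_nondecreasing_cvgn nd))//.
  by apply: ereal_sup_ubound; exists n.
have mg n x : measurable_fun setT (fun y => (g n (x, y))%:E).
  by apply/measurable_EFinP; exact: measurableT_comp.
have g0 n z : 0 <= (g n z)%:E by rewrite lee_fin fun_ge0.
(* Fatou's lemma is used twice along simple functions converging to [f]: on each section for [m2],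
   then for [m1]. *)
apply: (@le_trans _ _ (\int[m1]_x limn_einf (fun n => \int[m2]_y (g n (x, y))%:E))).
  apply: le_integral_nonneg => x; first by apply: integral_ge0.
  under eq_integral do rewrite fE.
  exact: (fatou _ measurableT (fun n => mg n x) (fun n y _ => g0 n (x, y))).
apply: le_trans (fatou _ measurableT _ _) _.
- by move=> n; exact: sfun_measurable_fun_fubini_tonelli_F.
- by move=> n x _; exact: integral_ge0.
apply: limn_einf_le => n; rewrite integral_nnsfun_product.
by apply: le_integral_nonneg => z; [exact: g0|exact: gle].
Qed.

End tonelli.

Section lateral.
Context (R : realType).
Local Notation leb := (@lebesgue_measure R).

Lemma measurable_lateral_boundary d (A : set 'rV[R]_d) T : bounded_set A ->
  measurable (lateral_boundary A T).
Proof.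
move=> bA; apply: measurableX; last exact: measurable_itv.
by apply: measurable_surface; apply: measurable_compact_rV; exact: compact_boundary.
Qed.

Lemma continuous_measurable_lateral d (w : spacetime R d -> R) : continuous w ->
  measurable_fun [set: surface R d * measurableTypeR R]
    (fun z => w ((z.1 : 'rV[R]_d), z.2)).
Proof.
move=> /continuous_measurable_spacetime mw.
apply: (measurableT_comp mw); apply/measurable_fun_pairP; split => /=.
  exact: measurableT_comp (@measurable_surface_id R d) measurable_fst.
exact: measurable_snd.
Qed.

(** An instance of [le_integral_product] with the Hausdorff measure as outer factor. It converts the
    bound produced by [divergence_bound] into one by the lateral measure, in which traces are
    expressed. *)
Lemma integral_lateral_le d (A : set 'rV[R]_d) T (w : spacetime R d -> R) :
  bounded_set A -> continuous w -> (forall z, 0 <= w z) ->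
  (\int[surface_measure R d]_(x in boundary A) (\int[leb]_(t in `]0%R, T[) w (x, t))%:E <=
   \int[lateral_measure R d]_(z in lateral_boundary A T) (w ((z.1 : 'rV[R]_d), z.2))%:E)%E.
Proof.
move=> bA cw w0; pose D := lateral_boundary A T.
pose f (z : surface R d * measurableTypeR R) : \bar R :=
  (((fun z : surface R d * measurableTypeR R => w ((z.1 : 'rV[R]_d), z.2)) \_ D) z)%:E.
have mf : measurable_fun setT f.
  apply/measurable_EFinP; apply/(measurable_restrictT _ (measurable_lateral_boundary T bA)).
  by apply: measurable_funTS; exact: continuous_measurable_lateral.
have f0 z : (0 <= f z)%E by rewrite lee_fin /patch; case: ifP.
have le1 := le_integral_product (surface_measure R d) leb mf f0.
have -> : (\int[lateral_measure R d]_(z in lateral_boundary A T) (w ((z.1 : 'rV[R]_d), z.2))%:E =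
    \int[(surface_measure R d \x leb)%E]_z f z)%E.
  by rewrite integral_mkcond; apply: eq_integral => z _; rewrite /f /patch; case: ifP.
apply: (le_trans _ le1); rewrite [leLHS]integral_mkcond le_eqVlt; apply/orP; left; apply/eqP.
apply: eq_integral => x _; rewrite /patch; case: ifPn => xA; last first.
  rewrite integral0_eq// => t _; rewrite /f /patch memNset// => -[/= xA' _].
  by move: xA; rewrite mem_set.
rewrite /Rintegral fineK; last first.
  apply: integrable_fin_num; first exact: measurable_itv.
  by apply: integrable_bounded_itv; exact: continuous_slice.
rewrite integral_mkcond; apply: eq_integral => t _; rewrite /f /patch.
have [tT|tT] := boolP (t \in `]0, T[%classic).
  by rewrite mem_set//; split => /=; exact: set_mem.
by rewrite memNset// => -[_ /= tT']; move: tT; rewrite mem_set.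
Qed.

End lateral.

(** * The energy estimate for smooth functions *)

Section derivatives.
Context (R : realType).

Lemma smooth_C1 (V : normedModType R) (f : V -> R) : smooth f ->
  continuous f /\ forall v, (forall x, is_derive x v f ('D_v f x)) /\ continuous ('D_v f).
Proof.
move=> sf; have [cf df] := sf 1; split => // v; have [dv [cv _]] := df v.
by split => // x; exact: derivableP.
Qed.

Lemma is_derive_slice_space d (w : spacetime R d -> R) (x e : 'rV[R]_d) (t l : R) :
  is_derive ((x, t) : spacetime R d) (e, 0) w l -> is_derive x e (fun y => w (y, t)) l.
Proof.
move=> [df fE].
have E : (fun h : R => h^-1 *: (w (h *: e + x, t) - w (x, t))) =
   (fun h : R => h^-1 *: (w (h *: ((e, 0) : spacetime R d) + (x, t)) - w (x, t))).
  apply/funext => h; congr (_ *: (w _ - _)).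
  by congr pair; rewrite /= [h *: _]mulr0 add0r.
split; first by rewrite /derivable/= E; exact: df.
by rewrite /derive/= E; exact: fE.
Qed.

Lemma is_derive_slice_time d (w : spacetime R d -> R) (x : 'rV[R]_d) (t l : R) :
  is_derive ((x, t) : spacetime R d) (0, 1) w l -> is_derive t 1 (fun s => w (x, s)) l.
Proof.
move=> [df fE].
have E : (fun h : R => h^-1 *: (w (x, h *: (1 : R) + t) - w (x, t))) =
   (fun h : R => h^-1 *: (w (h *: ((0, 1) : spacetime R d) + (x, t)) - w (x, t))).
  apply/funext => h; congr (_ *: (w _ - _)).
  by congr pair; rewrite /= scaler0 add0r.
split; first by rewrite /derivable/= E; exact: df.
by rewrite /derive/= E; exact: fE.
Qed.

Lemma is_derive_coord (V : normedModType R) d (f : V -> 'rV[R]_d) (x v : V)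
    (l : 'rV[R]_d) (i : 'I_d) :
  is_derive x v f l -> is_derive x v (fun y => f y 0 i) (l 0 i).
Proof.
move=> [df fE].
have cv : (fun h : R => h^-1 *: (f (h *: v + x) 0 i - f x 0 i)) @ 0^' --> l 0 i.
  rewrite -fE; have -> : (fun h : R => h^-1 *: (f (h *: v + x) 0 i - f x 0 i)) =
      (fun u : 'rV[R]_d => u 0 i) \o (fun h : R => h^-1 *: (f (h *: v + x) - f x)).
    by apply/funext => h; rewrite /= !mxE.
  by apply: continuous_cvg; [exact: continuous_coord|exact: df].
split; first by apply/cvg_ex; exists (l 0 i); exact: cv.
exact: (cvg_lim _ cv).
Qed.

Lemma dotv_le_enorm d (x y : 'rV[R]_d) : `|dotv x y| <= enorm x * enorm y.
Proof.
have dot_ge0 (z : 'rV[R]_d) : 0 <= dotv z z.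
  by apply: sumr_ge0 => i _; rewrite -expr2 sqr_ge0.
have key : dotv x y ^+ 2 <= dotv x x * dotv y y.
  have [y0|y0] := eqVneq (dotv y y) 0.
    have yi i : y 0 i = 0.
      apply/eqP; rewrite -sqrf_eq0 expr2; apply/eqP.
      by apply: (psumr_eq0P _ y0) => // j _; rewrite -expr2 sqr_ge0.
    have -> : dotv x y = 0 by rewrite /dotv big1// => i _; rewrite yi mulr0.
    by rewrite y0 mulr0 expr0n.
  (* Taken with [b = dotv y y] and [c = dotv x y], this nonnegative sum is the Cauchy-Schwarz
     inequality multiplied by [dotv y y]. *)
  have E (b c : R) : \sum_(i < d) (b * x 0 i - c * y 0 i) ^+ 2 =
      b ^+ 2 * dotv x x - 2 * b * c * dotv x y + c ^+ 2 * dotv y y.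
    rewrite /dotv !mulr_sumr -sumrB -big_split/=; apply: eq_bigr => i _; ring.
  have := E (dotv y y) (dotv x y).
  have -> : dotv y y ^+ 2 * dotv x x - 2 * dotv y y * dotv x y * dotv x y +
      dotv x y ^+ 2 * dotv y y = dotv y y * (dotv x x * dotv y y - dotv x y ^+ 2) by ring.
  move=> E0; have : 0 <= dotv y y * (dotv x x * dotv y y - dotv x y ^+ 2).
    by rewrite -E0; apply: sumr_ge0 => i _; exact: sqr_ge0.
  by rewrite pmulr_rge0 ?subr_ge0// lt0r y0 dot_ge0.
by rewrite -sqrtr_sqr /enorm -sqrtrM// ler_sqrt// mulr_ge0.
Qed.

End derivatives.

Section time_integral.
Context (R : realType).
Local Notation leb := (@lebesgue_measure R).

Lemma integrable_cylinder_bounded d (A : set 'rV[R]_d) (T : R) (f : spacetime R d -> R) (M : R) :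
  bounded_set A -> measurable A -> measurable_fun (cylinder A T) f ->
  (forall z, cylinder A T z -> `|f z| <= M) ->
  (spacetime_measure R d).-integrable (cylinder A T) (EFin \o f).
Proof.
move=> bA mA mf fM; apply: measurable_bounded_integrable => //.
- exact: measurable_cylinder.
- exact: cylinder_lty.
- exact: bounded_globally fM.
Qed.

Lemma integral_cylinder_time d (A : set 'rV[R]_d) (T : R) (f g : spacetime R d -> R) :
  bounded_set A -> measurable A -> 0 < T -> continuous f -> continuous g ->
  (forall x (t : R), is_derive t (1 : R) (fun s : R => f (x, s)) (g (x, t))) ->
  (spacetime_measure R d).-integrable (cylinder A T) (EFin \o g) ->
  ((\int[spacetime_measure R d]_(z in cylinder A T) g z)%:E =
   \int[lebesgue_rV R d]_(x in A) (f (x, T) - f (x, 0%R))%:E)%E.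
Proof.
move=> bA mA T0 cf cg dfg ig.
have mQ := measurable_cylinder T mA.
have igT : (spacetime_measure R d).-integrable setT (EFin \o (g \_ (cylinder A T))).
  by rewrite -restrict_EFin; exact/(integrable_mkcond _ mQ).
rewrite /Rintegral fineK; last exact: integrable_fin_num.
rewrite [LHS]integral_mkcond restrict_EFin.
rewrite -(integral12_prod_meas1 igT) [RHS]integral_mkcond.
apply: eq_integral => x _; rewrite /fubini_F [RHS]patchE.
case: ifPn => xA; last first.
  rewrite integral0_eq// => t _; rewrite /= patchE memNset// => -[/= xA' _].
  by move: xA; rewrite mem_set.
have itv0T : leb.-integrable `]0, T[ (EFin \o (fun t => g (x, t))).
  by apply: integrable_bounded_itv; exact: continuous_slice.
have -> : (\int[leb]_t (EFin \o g \_ (cylinder A T)) (x, t) =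
    \int[leb]_(t in `]0%R, T[) (g (x, t))%:E)%E.
  rewrite [RHS]integral_mkcond; apply: eq_integral => t _; rewrite /= !patchE.
  have [tT|tT] := boolP (t \in `]0, T[%classic).
    by rewrite mem_set//; split => /=; exact: set_mem.
  by rewrite memNset// => -[_ /= tT']; move: tT; rewrite mem_set.
have FTC : \int[leb]_(t in `[0, T]) g (x, t) = f (x, T) - f (x, 0).
  apply: (@Rintegral_FTC R (fun t => f (x, t)) (fun t => g (x, t))) => //.
  - by apply: continuous_subspaceT; exact: continuous_slice.
  - by apply: continuous_subspaceT; exact: continuous_slice.
have icc : leb.-integrable `[0, T] (EFin \o (fun t => g (x, t))).
  apply: continuous_compact_integrable; first exact: segment_compact.
  by apply: continuous_subspaceT; exact: continuous_slice.
have ioc : leb.-integrable `]0, T] (EFin \o (fun t => g (x, t))).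
  by apply: integrableS icc => //; exact: subset_itv_oc_cc.
rewrite -FTC -(Rintegral_itv_obnd_cbnd ioc) -(Rintegral_itv_bndo_bndc itv0T).
by rewrite /Rintegral fineK//; apply: integrable_fin_num.
Qed.

End time_integral.

Section bounds.
Context (R : realType).

Lemma compact_within_bounded (T : topologicalType) (K : set T) (f : T -> R) :
  compact K -> {within K, continuous f} ->
  exists2 M, 0 <= M & forall x, K x -> `|f x| <= M.
Proof.
move=> cK cf; have /compact_bounded[M [Mr fM]] := continuous_compact cf cK.
exists (`|M| + 1) => [|x Kx]; first by rewrite addr_ge0.
apply: (fM (`|M| + 1)); last by exists x.
by rewrite (le_lt_trans (ler_norm M))// ltrDl.
Qed.

Lemma cylinder_bounded d (A : set 'rV[R]_d) (T : R) (f : spacetime R d -> R) :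
  bounded_set A -> continuous f ->
  exists2 M, 0 <= M & forall x t, closure A x -> 0 <= t <= T -> `|f (x, t)| <= M.
Proof.
move=> bA cf.
have cK : compact (closure A `*` `[0, T]%classic).
  by apply: compact_setX; [exact: compact_closure_rV|exact: segment_compact].
have [|M M0 fM] := @compact_within_bounded _ _ f cK; first exact: continuous_subspaceT.
by exists M => // x t Ax t0T; apply: fM; split => //=; rewrite in_itv.
Qed.

Lemma measurable_fst_cylinder d (A : set 'rV[R]_d) T (f : 'rV[R]_d -> R) :
  open A -> {within closure A, continuous f} ->
  measurable_fun (cylinder A T) (fun z => f z.1).
Proof.
move=> oA cf; have mA := measurable_open_rV oA.
apply: (@measurable_comp _ _ _ _ _ _ A f (cylinder A T) fst) => //.
- by move=> _ [z [Az _] <-].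
- by apply: (@within_continuous_measurable_rV R d A (closure A)) => //; exact: subset_closure.
- exact: measurable_funTS.
Qed.
End bounds.

Section sums_of_integrals.
Context d (T : measurableType d) (R : realType) (mu : {measure set T -> \bar R}).
Context (D : set T) (mD : measurable D).

Lemma Rintegral_sum m (G : 'I_m -> T -> R) :
  (forall i, mu.-integrable D (EFin \o G i)) ->
  mu.-integrable D (EFin \o (fun x => \sum_i G i x)) /\
  \int[mu]_(x in D) (\sum_i G i x) = \sum_i \int[mu]_(x in D) G i x.
Proof.
move=> iG; suff h (s : seq 'I_m) :
    mu.-integrable D (EFin \o (fun x => \sum_(i <- s) G i x)) /\
    \int[mu]_(x in D) (\sum_(i <- s) G i x) = \sum_(i <- s) \int[mu]_(x in D) G i x.
  exact: h.
elim: s => [|a s [is_ ih]].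
  have -> : (fun x => \sum_(i <- [::]) G i x) = cst 0.
    by apply/funext => x; rewrite big_nil.
  rewrite big_nil; split; first exact: (@integrable0 _ _ _ mu D).
  by rewrite /Rintegral integral0.
have E : (fun x => \sum_(i <- a :: s) G i x) = (fun x => G a x + \sum_(i <- s) G i x).
  by apply/funext => x; rewrite big_cons.
rewrite E big_cons RintegralD// ih; split => //.
by apply: (integrableD mD (iG a) is_).
Qed.

(** Designed for [G i] the spatial part and [g] the time part of a space-time divergence: a
    pointwise lower bound on the divergence becomes an upper bound on minus the integral of the time
    part, with the fluxes as remainder. *)
Lemma opp_Rintegral_le m (G : 'I_m -> T -> R) (g E : T -> R) :
  (forall i, mu.-integrable D (EFin \o G i)) -> mu.-integrable D (EFin \o g) ->
  measurable_fun D E -> (forall x, 0 <= E x) ->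
  {ae mu, forall x, D x -> - (\sum_i G i x + g x) <= E x} ->
  ((- (\int[mu]_(x in D) g x))%:E <=
   (\sum_i `|\int[mu]_(x in D) G i x|)%:E + \int[mu]_(x in D) (E x)%:E)%E.
Proof.
move=> iG ig mE E0 XE; have [iS Sint] := Rintegral_sum iG.
pose X x := \sum_i G i x + g x.
have iX : mu.-integrable D (EFin \o X) := integrableD mD iS ig.
have iNX : mu.-integrable D (EFin \o (fun x => - X x)) := integrableN iX.
have XD : \int[mu]_(x in D) X x =
    (\sum_i \int[mu]_(x in D) G i x) + (\int[mu]_(x in D) g x) by rewrite RintegralD// Sint.
have -> : - (\int[mu]_(x in D) g x) =
    (\sum_i \int[mu]_(x in D) G i x) - (\int[mu]_(x in D) X x) by rewrite XD; ring.
rewrite EFinD; apply: leeD.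
  by rewrite lee_fin ler_sum// => i _; exact: ler_norm.
have -> : ((- (\int[mu]_(x in D) X x))%:E = \int[mu]_(x in D) (- X x)%:E)%E.
  rewrite (_ : (fun x => (- X x)%:E) = (fun x => - (EFin \o X) x)%E)//.
  rewrite integralN; last by apply: integrable_add_def.
  by rewrite EFinN /Rintegral fineK//; exact: integrable_fin_num.
have mX : measurable_fun D (fun x => - X x).
  by apply/measurable_EFinP; exact: measurable_int iNX.
(* The integral of [E] may be infinite. The positive part of [- X] is integrable and, [E] being
   nonnegative, still lies below [E] almost everywhere; it links the comparison of integrable
   functions with that of nonnegative ones. *)
apply: (@le_trans _ _ (\int[mu]_(x in D) (Num.max (- X x) 0)%:E)%E).
  apply: le_integral => //.
    apply: (le_integrable mD _ _ iNX) => [|x _].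
      by apply/measurable_EFinP; exact: measurable_funrpos mX.
    rewrite /= lee_fin; have [h|h] := lerP (- X x) 0; first by rewrite normr0.
    by [].
  by move=> x _; rewrite lee_fin le_max lexx.
apply: ae_ge0_le_integral => //.
- by move=> x _; rewrite lee_fin le_max lexx orbT.
- by apply/measurable_EFinP; exact: measurable_funrpos mX.
- by move=> x _; rewrite lee_fin.
- exact/measurable_EFinP.
by apply: filterS XE => x h Dx; rewrite lee_fin ge_max E0 h.
Qed.

Lemma le_opp_Rintegral (f g k : T -> R) (c : R) :
  mu.-integrable D (EFin \o f) -> mu.-integrable D (EFin \o k) ->
  (forall x, D x -> k x <= - (c * f x)) ->
  (c%:E * \int[mu]_(x in D) (f x)%:E <= - (\int[mu]_(x in D) (k x)%:E))%E.
Proof.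
move=> i_f ik kf; rewrite -integralZl//.
rewrite -integralN; last by apply: integrable_add_def.
apply: le_integral => //.
- exact: integrableZl.
- exact: integrableN.
by move=> x /set_mem Dx; rewrite -EFinM -EFinN lee_fin lerNr kf.
Qed.
End sums_of_integrals.

Section weighted.
Context (R : realType) (n : nat).
Local Notation leb := (@lebesgue_measure R).
Local Notation mu := (spacetime_measure R n.+1).
Local Notation ex i := ((delta_mx 0 i, 0) : spacetime R n.+1).
Local Notation et := ((0, 1) : spacetime R n.+1).

Lemma continuous_mulr (T : topologicalType) (f g : T -> R) :
  continuous f -> continuous g -> continuous (fun z => f z * g z).
Proof. by move=> cf cg z; exact: (@continuousM _ _ f g z (cf z) (cg z)). Qed.

Lemma continuous_addr (T : topologicalType) (f g : T -> R) :
  continuous f -> continuous g -> continuous (fun z => f z + g z).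
Proof. by move=> cf cg z; exact: (@continuousD _ _ _ f g z (cf z) (cg z)). Qed.

Lemma continuous_exprn (T : topologicalType) (f : T -> R) k :
  continuous f -> continuous (fun z => f z ^+ k).
Proof.
move=> cf z; apply: (@continuous_comp _ _ _ f (fun y : R => y ^+ k)); first exact: cf.
exact: exprn_continuous.
Qed.

Lemma is_derive_mulr (V : normedModType R) (f g : V -> R) (x v : V) (df dg : R) :
  is_derive x v f df -> is_derive x v g dg ->
  is_derive x v (fun y => f y * g y) (f x * dg + g x * df).
Proof. by move=> hf hg; exact: is_deriveM. Qed.

Lemma integrable_continuous_bounded d (A : set 'rV[R]_d) (f : 'rV[R]_d -> R) :
  bounded_set A -> measurable A -> continuous f ->
  (lebesgue_rV R d).-integrable A (EFin \o f).
Proof.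
move=> bA mA cf.
have [|M _ hM] := @compact_within_bounded R _ _ f (compact_closure_rV bA).
  exact: continuous_subspaceT.
apply: measurable_bounded_integrable => //.
- exact: lebesgue_bounded_lty.
- by apply: measurable_funTS; exact: continuous_measurable_rV.
- by apply: (@bounded_globally _ _ _ _ M) => x Ax; apply: hM; exact: subset_closure.
Qed.

(* Integrating [d_t (psi w^2) + div (psi w^2 H)] over the cylinder. *)
Lemma weighted_energy (Omega : set 'rV[R]_n.+1) (T c : R) (H : 'rV[R]_n.+1 -> 'rV[R]_n.+1)
    (h : 'I_n.+1 -> 'rV[R]_n.+1 -> R) (psi psit : spacetime R n.+1 -> R)
    (psix : 'I_n.+1 -> spacetime R n.+1 -> R) :
  open Omega -> bounded_set Omega -> 0 < T ->
  (forall i, {within closure Omega, continuous (fun x => H x 0 i)}) ->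
  (forall i, {within closure Omega, continuous (h i)}) ->
  (forall i x, Omega x -> is_derive x (delta_mx 0 i) (fun y => H y 0 i) (h i x)) ->
  continuous psi -> continuous psit -> (forall i, continuous (psix i)) ->
  (forall i x (t : R), is_derive x (delta_mx 0 i) (fun y => psi (y, t)) (psix i (x, t))) ->
  (forall x (t : R), is_derive t (1 : R) (fun s : R => psi (x, s)) (psit (x, t))) ->
  (forall x, Omega x -> psi (x, T) <= 0) -> (forall x, Omega x -> c <= psi (x, 0)) ->
  exists2 C : R, 0 < C & forall w E : spacetime R n.+1 -> R, smooth w ->
    measurable_fun (cylinder Omega T) E -> (forall z, 0 <= E z) ->
    {ae mu, forall z, cylinder Omega T z ->
       - (w z ^+ 2 * (psi z * \sum_i h i z.1 + \sum_i H z.1 0 i * psix i z + psit z) +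
          2 * w z * psi z * (\sum_i H z.1 0 i * 'D_(ex i) w z + 'D_et w z)) <= E z} ->
    (c%:E * \int[lebesgue_rV R n.+1]_(x in Omega) (w (x, 0%R) ^+ 2)%:E <=
     C%:E * (\int[lateral_measure R n.+1]_(z in lateral_boundary Omega T)
              (w ((z.1 : 'rV[R]_n.+1), z.2) ^+ 2)%:E) +
     \int[mu]_(z in cylinder Omega T) (E z)%:E)%E.
Proof.
move=> oO bO T0 cH ch dH cpsi cpsit cpsix dpsix dpsit psiT psi0.
have mO := measurable_open_rV oO; have mQ := measurable_cylinder T mO.
have cO := compact_closure_rV bO.
pose K i := s2val (cid2 (@divergence_bound R n i)).
have K0 i : 0 < K i := s2valP (cid2 (@divergence_bound R n i)).
have hK i := s2valP' (cid2 (@divergence_bound R n i)).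
have BHex i := cid2 (compact_within_bounded cO (cH i)).
pose BH i := s2val (BHex i).
have BH0 i : 0 <= BH i := s2valP (BHex i).
have hBH i x : closure Omega x -> `|H x 0 i| <= BH i := s2valP' (BHex i) x.
have [Bp Bp0 hBp] := cylinder_bounded T bO cpsi.
have B0 i : 0 <= BH i * Bp by rewrite mulr_ge0.
(* The flux component [H_i psi w^2] is at most [BH i * Bp * w^2], and [K i] is the constant of
   [divergence_bound]; the term 1 ensures positivity. *)
exists (1 + \sum_i K i * (BH i * Bp)).
  by rewrite ltr_pwDl// sumr_ge0// => i _; rewrite mulr_ge0// ltW.
move=> w E sw mE E0 XE.
have [cw dw] := smooth_C1 sw.
have [dwt cwt] := dw et.
(* By the product rule [G i] is the derivative of [psi w^2 H_i] along axis [i], and [g] that of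
   [psi w^2] in time. *)
pose G i z := h i z.1 * (w z ^+ 2 * psi z) +
   H z.1 0 i * (2 * w z * 'D_(ex i) w z * psi z + w z ^+ 2 * psix i z).
pose g z := 2 * w z * 'D_et w z * psi z + w z ^+ 2 * psit z.
have cw2 : continuous (fun z => w z ^+ 2) by exact: continuous_exprn.
have c2 (f : spacetime R n.+1 -> R) : continuous f ->
    continuous (fun z => 2 * w z * f z * psi z).
  move=> cf; apply: continuous_mulr => //; apply: continuous_mulr => //.
  by apply: continuous_mulr => //; exact: cst_continuous.
have cwp : continuous (fun z => w z ^+ 2 * psi z) by exact: continuous_mulr.
have cg : continuous g.
  by apply: continuous_addr; [exact: c2|exact: continuous_mulr].
have cg1 i : continuous (fun z => 2 * w z * 'D_(ex i) w z * psi z + w z ^+ 2 * psix i z).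
  apply: continuous_addr; first by apply: c2; have [] := dw (ex i).
  exact: continuous_mulr.
have mG i : measurable_fun (cylinder Omega T) (G i).
  apply: (@measurable_funD _ _ _ _ (fun z => h i z.1 * _) (fun z => H z.1 0 i * _)).
    apply: (@measurable_funM _ _ _ _ (fun z => h i z.1)).
      exact (@measurable_fst_cylinder R _ Omega T (h i) oO (ch i)).
    by apply: measurable_funTS; exact: continuous_measurable_spacetime.
  apply: (@measurable_funM _ _ _ _ (fun z => H z.1 0 i)).
    exact: (@measurable_fst_cylinder _ _ _ T (fun x => H x 0 i) oO (cH i)).
  by apply: measurable_funTS; exact: continuous_measurable_spacetime.
have inQ x t : closure Omega x -> 0 < t < T -> 0 <= t <= T.
  by move=> _ /andP[? ?]; rewrite !ltW.
have GM i : exists M, forall z, cylinder Omega T z -> `|G i z| <= M.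
  have [M1 M10 hM1] := compact_within_bounded cO (ch i).
  have [M2 M20 hM2] := cylinder_bounded T bO cwp.
  have [M3 M30 hM3] := cylinder_bounded T bO (cg1 i).
  exists (M1 * M2 + BH i * M3) => -[x t] [/= Ox]; rewrite in_itv/= => t0T.
  have clx : closure Omega x by exact: subset_closure.
  rewrite (le_trans (ler_normD _ _))// lerD// normrM ler_pM//.
  - exact: hM1.
  - by apply: hM2 => //; exact: (inQ x).
  - exact: hBH.
  - by apply: hM3 => //; exact: (inQ x).
have iG i : mu.-integrable (cylinder Omega T) (EFin \o G i).
  by have [M hM] := GM i; exact: (integrable_cylinder_bounded bO mO (mG i) hM).
have ig : mu.-integrable (cylinder Omega T) (EFin \o g).
  have [M M0 hM] := cylinder_bounded T bO cg.
  apply: (@integrable_cylinder_bounded _ _ _ _ _ M bO mO).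
    by apply: measurable_funTS; exact: continuous_measurable_spacetime.
  move=> [x t] [/= Ox]; rewrite in_itv/= => t0T.
  by apply: hM; [exact: subset_closure|exact: (inQ x) (subset_closure Ox) t0T].
set J := (\int[lateral_measure R n.+1]_(z in lateral_boundary Omega T) _)%E.
have divG i : (`|\int[mu]_(z in cylinder Omega T) G i z|%:E <= (K i * (BH i * Bp))%:E * J)%E.
  have [M hM] := GM i.
  pose F z := H z.1 0 i * (w z ^+ 2 * psi z).
  pose W z := BH i * Bp * w z ^+ 2.
  have cW : continuous W by apply: continuous_mulr => //; exact: cst_continuous.
  have W0 z : 0 <= W z by rewrite mulr_ge0// sqr_ge0.
  have JW : (\int[surface_measure R n.+1]_(x in boundary Omega)
      (\int[leb]_(t in `]0%R, T[) W (x, t))%:E <= (BH i * Bp)%:E * J)%E.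
    apply: (le_trans (integral_lateral_le T bO cW W0)).
    rewrite /W; under eq_integral do rewrite EFinM.
    rewrite ge0_integralZl_EFin//.
    - exact: measurable_lateral_boundary.
    - by move=> z _; rewrite lee_fin sqr_ge0.
    - apply/measurable_EFinP; apply: measurable_funTS.
      exact: (@continuous_measurable_lateral R n.+1 (fun z => w z ^+ 2)).
  apply: (@le_trans _ _ ((K i)%:E * ((BH i * Bp)%:E * J))%E); last by rewrite muleA EFinM.
  refine (le_trans (hK i Omega T M F (G i) W oO bO T0 _ _ _ (mG i) _ cW W0 _) _).
  - move=> t _; apply: (@continuous_mulr (subspace (closure Omega)) (fun x => H x 0 i)
        (fun x => w (x, t) ^+ 2 * psi (x, t))); first exact: cH.
    apply: (@continuous_subspaceT _ _ (closure Omega) (fun x => w (x, t) ^+ 2 * psi (x, t))).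
    exact: (@continuous_slice1 R n.+1 _ t cwp).
  - move=> t _; apply: (@continuous_addr (subspace (closure Omega))
        (fun x => h i x * (w (x, t) ^+ 2 * psi (x, t)))
        (fun x => H x 0 i * (2 * w (x, t) * 'D_(ex i) w (x, t) * psi (x, t) +
          w (x, t) ^+ 2 * psix i (x, t)))).
      apply: (@continuous_mulr (subspace (closure Omega)) (h i)
        (fun x => w (x, t) ^+ 2 * psi (x, t))); first exact: ch.
      apply: (@continuous_subspaceT _ _ (closure Omega) (fun x => w (x, t) ^+ 2 * psi (x, t))).
      exact: (@continuous_slice1 R n.+1 _ t cwp).
    apply: (@continuous_mulr (subspace (closure Omega)) (fun x => H x 0 i)
      (fun x => 2 * w (x, t) * 'D_(ex i) w (x, t) * psi (x, t) +
          w (x, t) ^+ 2 * psix i (x, t))); first exact: cH.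
    apply: (@continuous_subspaceT _ _ (closure Omega) (fun x => 2 * w (x, t) *
      'D_(ex i) w (x, t) * psi (x, t) + w (x, t) ^+ 2 * psix i (x, t))).
    exact: (@continuous_slice1 R n.+1 _ t (cg1 i)).
  - move=> x t Ox t0T.
    have D1 := is_derive_slice_space ((dw (ex i)).1 (x, t)).
    have DD := is_derive_mulr (dH i x Ox) (is_derive_mulr (is_derive_mulr D1 D1) (dpsix i x t)).
    by apply: (is_derive_eq (DD : is_derive _ _ (fun y => F (y, t)) _)); rewrite /G /=; ring.
  - by move=> x t Ox t0T; apply: hM; split => //=; rewrite in_itv.
  - move=> x t clx t0T; rewrite /F /W normrM normrM (ger0_norm (sqr_ge0 _)).
    have hp := hBp _ _ clx (inQ x t clx t0T); have hh := hBH i x clx.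
    rewrite [leLHS](_ : _ = `|H x 0 i| * `|psi (x, t)| * w (x, t) ^+ 2); last by ring.
    by rewrite ler_wpM2r ?sqr_ge0// ler_pM.
  by apply: lee_wpmul2l; [rewrite lee_fin; exact: ltW (K0 i)|exact: JW].
have init : (c%:E * \int[lebesgue_rV R n.+1]_(x in Omega) (w (x, 0%R) ^+ 2)%:E <=
    (- (\int[mu]_(z in cylinder Omega T) g z))%:E)%E.
  have dwp x (t : R) : is_derive t (1 : R) (fun s : R => w (x, s) ^+ 2 * psi (x, s)) (g (x, t)).
    have D1 := is_derive_slice_time (dwt (x, t)).
    have DD := is_derive_mulr (is_derive_mulr D1 D1) (dpsit x t).
    apply: (is_derive_eq (DD : is_derive _ _ (fun s : R => w (x, s) ^+ 2 * psi (x, s)) _)).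
    by rewrite /g /=; ring.
  have E1 := integral_cylinder_time bO mO T0 cwp cg dwp ig.
  rewrite EFinN E1; apply: le_opp_Rintegral => //.
  - apply: integrable_continuous_bounded => //.
    exact: (@continuous_slice1 R n.+1 _ 0 cw2).
  - apply: integrable_continuous_bounded => //.
    apply: continuous_addr; first exact: (@continuous_slice1 R n.+1 _ T cwp).
    move=> x; apply: (@continuousN _ _ _ (fun x => w (x, 0) ^+ 2 * psi (x, 0))).
    exact: (@continuous_slice1 R n.+1 _ 0 cwp).
  - move=> x Ox; have h1 := psiT x Ox; have h2 := psi0 x Ox.
    have : w (x, T) ^+ 2 * psi (x, T) <= 0 by rewrite mulr_ge0_le0// sqr_ge0.
    have : c * w (x, 0) ^+ 2 <= w (x, 0) ^+ 2 * psi (x, 0).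
      by rewrite mulrC ler_wpM2l// sqr_ge0.
    lra.
have XE' : {ae mu, forall z, cylinder Omega T z -> - (\sum_i G i z + g z) <= E z}.
  apply: filterS XE => z XEz Qz; apply: le_trans (XEz Qz); rewrite le_eqVlt; apply/orP; left.
  apply/eqP; congr (- _); rewrite /G /g.
  have -> : \sum_i (h i z.1 * (w z ^+ 2 * psi z) +
      H z.1 0 i * (2 * w z * 'D_(ex i) w z * psi z + w z ^+ 2 * psix i z)) =
      (w z ^+ 2 * psi z) * (\sum_i h i z.1) + w z ^+ 2 * (\sum_i H z.1 0 i * psix i z) +
      2 * w z * psi z * (\sum_i H z.1 0 i * 'D_(ex i) w z).
    by rewrite !mulr_sumr -!big_split/=; apply: eq_bigr => i _; ring.
  ring.
have := opp_Rintegral_le mQ iG ig mE E0 XE'.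
move=> /(le_trans init) /le_trans; apply; apply: leeD => //.
have J0 : (0 <= J)%E by apply: integral_ge0 => z _; rewrite lee_fin sqr_ge0.
rewrite -sumEFin; apply: (@le_trans _ _ (\sum_i (K i * (BH i * Bp))%:E * J)%E).
  exact: lee_sum.
rewrite -ge0_sume_distrl; last by move=> i _; rewrite lee_fin mulr_ge0// ltW.
by rewrite sumEFin; apply: lee_wpmul2r => //; rewrite lee_fin lerDr.
Qed.
End weighted.

Section energy.
Context (R : realType).

Lemma is_derive_exprn (V : normedModType R) (f : V -> R) (x v : V) (df : R) k :
  is_derive x v f df ->
  is_derive x v (fun y => f y ^+ k.+1) (k.+1%:R * f x ^+ k * df).
Proof.
move=> hf; elim: k => [|k ih].
  by rewrite expr0 mulr1 mul1r.
have h := is_derive_mulr hf ih.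
rewrite (_ : (fun y => f y ^+ k.+2) = (fun y => f y * f y ^+ k.+1)).
  by apply: (is_derive_eq h); rewrite -[k.+2%:R]natr1 exprS; ring.
by apply/funext => y; rewrite exprS.
Qed.

Lemma is_derive_dotv d (v x : 'rV[R]_d) (i : 'I_d) :
  is_derive x (delta_mx 0 i) (fun y => dotv y v) (v 0 i).
Proof.
have h j : is_derive x (delta_mx 0 i) (fun y : 'rV[R]_d => y 0 j * v 0 j)
    ((j == i)%:R * v 0 j).
  have h1 := is_derive_coord j (is_derive_id x (delta_mx 0 i : 'rV[R]_d)).
  have h2 := is_derive_mulr h1 (is_derive_cst (v 0 j) x (delta_mx 0 i)).
  by apply: (is_derive_eq h2); rewrite mulr0 add0r mxE eqxx/= mulrC.
suff H (s : seq 'I_d) : is_derive x (delta_mx 0 i)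
    (fun y : 'rV[R]_d => \sum_(j <- s) y 0 j * v 0 j) (\sum_(j <- s) (j == i)%:R * v 0 j).
  apply: (is_derive_eq (H (index_enum _))).
  by rewrite (bigD1 i)//= eqxx mul1r big1 ?addr0// => j /negPf ->; rewrite mul0r.
elim: s => [|a s ih].
  rewrite big_nil (_ : (fun _ => _) = cst 0); first exact: is_derive_cst.
  by apply/funext => y; rewrite big_nil.
rewrite big_cons (_ : (fun _ => _) = (fun y : 'rV[R]_d => y 0 a * v 0 a) \+
  (fun y : 'rV[R]_d => \sum_(j <- s) y 0 j * v 0 j)); first exact: is_deriveD.
by apply/funext => y; rewrite big_cons.
Qed.

Lemma lee_divl_sum (c C K : R) (x y z : \bar R) :
  0 < c -> 0 <= C -> 0 <= K -> (0 <= y)%E -> (0 <= z)%E ->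
  (c%:E * x <= C%:E * y + K%:E * z)%E -> (x <= (c^-1 * (C + K))%:E * (y + z))%E.
Proof.
move=> c0 C0 K0 y0 z0 cx.
have -> : x = ((c^-1)%:E * (c%:E * x))%E by rewrite muleA -EFinM mulVf ?gt_eqF// mul1e.
rewrite EFinM -muleA; apply: lee_wpmul2l; first by rewrite lee_fin invr_ge0 ltW.
apply: (le_trans cx); rewrite ge0_muleDr//; apply: leeD; apply: lee_wpmul2r => //.
  by rewrite lee_fin lerDl.
by rewrite lee_fin lerDr.
Qed.

(** Here [q] is the even power of the base of the weight, [S] the divergence of [H], [N] the
    derivative of the weight along the flow, and [L] the transport derivative of [w]. Substituting
    [L = L' - p * w] and applying Young's inequality to [2 * w * psi * L'] leaves [|psi|] times [D],
    [2 * P] and 1 in front of [w ^+ 2], which [N] dominates. *)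
Lemma absorb_zeroth_order (w psi S p L N q Xi K D P : R) :
  `|psi| <= Xi * q -> `|psi| <= K -> `|S| <= D -> `|p| <= P ->
  Xi * q * (D + 2 * P + 1) <= N ->
  - (w ^+ 2 * (psi * S + N) + 2 * w * psi * L) <= K * (L + p * w) ^+ 2.
Proof.
move=> psiX psiK SD pP XN; set L' := L + p * w.
have h1 : - (psi * (S - 2 * p)) <= Xi * q * (D + 2 * P).
  rewrite (le_trans (ler_norm _))// normrN normrM ler_pM//.
  rewrite (le_trans (ler_normB _ _))// lerD// normrM ger0_norm//.
  by rewrite ler_wpM2l.
have h1' := ler_wpM2l (sqr_ge0 w) h1.
have h2 : - (2 * w * psi * L') <= `|psi| * (w ^+ 2 + L' ^+ 2).
  rewrite (le_trans (ler_norm _))// normrN.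
  have -> : 2 * w * psi * L' = psi * (2 * w * L') by ring.
  rewrite normrM ler_wpM2l// ler_norml.
  have e1 : (w + L') ^+ 2 = w ^+ 2 + L' ^+ 2 + 2 * w * L' by ring.
  have e2 : (w - L') ^+ 2 = w ^+ 2 + L' ^+ 2 - 2 * w * L' by ring.
  have := sqr_ge0 (w + L'); have := sqr_ge0 (w - L'); rewrite e1 e2.
  by move: (2 * w * L') (w ^+ 2) (L' ^+ 2) => b a c; lra.
have h3 := ler_wpM2r (sqr_ge0 w) psiX.
have h4 := ler_wpM2r (sqr_ge0 L') psiK.
have h5 := ler_wpM2l (sqr_ge0 w) XN.
have -> : L = L' - p * w by rewrite /L'; ring.
move: h1' h2 h3 h4 h5; move: (L' ^+ 2) => L2.
move: `|psi| => a; move: L' => b.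
lra.
Qed.

Local Notation ex i := ((delta_mx 0 i, 0) : spacetime R _).
Local Notation et := ((0, 1) : spacetime R _).

(* The weight is an odd power of [xi = x . v - beta t - a] with [M - beta T = a],
   nonpositive at [t = T] and positive at [t = 0]; its derivative along the
   characteristics dominates the zeroth-order terms once the power is large. *)
Lemma energy_estimate n (Omega : set 'rV[R]_n.+1) (T M P delta : R)
    (H : 'rV[R]_n.+1 -> 'rV[R]_n.+1) (p : 'rV[R]_n.+1 -> R) (v : 'rV[R]_n.+1) :
  open Omega -> bounded_set Omega -> 0 < T -> C1_closure Omega H ->
  0 <= M -> (forall x, Omega x -> `|dotv x v| <= M) ->
  (forall x, closure Omega x -> delta <= dotv (H x) v) -> 2 * M < delta * T ->
  0 <= P ->
  {ae spacetime_measure R n.+1, forall z, cylinder Omega T z -> `|p z.1| <= P} ->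
  exists2 C : R, 0 < C & forall w E : spacetime R n.+1 -> R, smooth w ->
    measurable_fun (cylinder Omega T) E -> (forall z, 0 <= E z) ->
    {ae spacetime_measure R n.+1, forall z, cylinder Omega T z ->
       (\sum_i H z.1 0 i * 'D_(ex i) w z + 'D_et w z + p z.1 * w z) ^+ 2 <= E z} ->
    (\int[lebesgue_rV R n.+1]_(x in Omega) (w (x, 0%R) ^+ 2)%:E <=
     C%:E * (\int[lateral_measure R n.+1]_(z in lateral_boundary Omega T)
               (w ((z.1 : 'rV[R]_n.+1), z.2) ^+ 2)%:E +
             \int[spacetime_measure R n.+1]_(z in cylinder Omega T) (E z)%:E))%E.
Proof.
move=> oO bO T0 [cH dH] M0 hM Hv MT P0 pP.
have cO := compact_closure_rV bO.
pose hC i := cid (dH (delta_mx 0 i : 'rV[R]_n.+1)).2.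
pose h i x := sval (hC i) x 0 i.
have coordc (A : set 'rV[R]_n.+1) (f : 'rV[R]_n.+1 -> 'rV[R]_n.+1) i :
    {within A, continuous f} -> {within A, continuous (fun x => f x 0 i)}.
  move=> cf x; apply: (@continuous_comp (subspace A) _ _ f (fun y => y 0 i)); first exact: cf.
  exact: continuous_coord.
have ch i : {within closure Omega, continuous (h i)}.
  by apply: coordc; exact: (proj1 (svalP (hC i))).
have dh i x : Omega x -> is_derive x (delta_mx 0 i) (fun y => H y 0 i) (h i x).
  move=> Ox; rewrite /h -(proj2 (svalP (hC i)) x Ox).
  by apply: is_derive_coord; apply: derivableP; exact: (dH _).1.
have [D D0 hD] : exists2 D, 0 <= D & forall x, closure Omega x -> `|\sum_i h i x| <= D.
  pose Dex i := cid2 (compact_within_bounded cO (ch i)).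
  exists (\sum_i s2val (Dex i)); first by apply: sumr_ge0 => i _; exact: (s2valP (Dex i)).
  move=> x clx; apply: (le_trans (ler_norm_sum _ _ _)); apply: ler_sum => i _.
  exact: (s2valP' (Dex i) x clx).
(* The midpoint of [2 * M / T] and [delta]: slower than the growth of x . v along the flow, yet fast
   enough to give [2 * M < beta * T]. *)
pose beta := (2 * M / T + delta) / 2.
have MTd : 2 * M / T < delta by rewrite ltr_pdivrMr.
have betad : beta < delta by rewrite /beta; lra.
have betaT : 2 * M < beta * T.
  by rewrite -ltr_pdivrMr// /beta; lra.
pose xi (z : spacetime R n.+1) := dotv z.1 v + (- beta * z.2 + (beta * T - M)).
have cxi : continuous xi.
  apply: continuous_addr.
    move=> z; apply: (@continuous_comp _ _ _ fst (fun y => dotv y v)); first exact: cvg_fst.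
    exact: continuous_dotv.
  apply: continuous_addr; last exact: cst_continuous.
  by apply: continuous_mulr; [exact: cst_continuous|move=> z; exact: cvg_snd].
have [Xi Xi0 hXi] := cylinder_bounded T bO cxi.
(* The exponent needed to absorb the zeroth-order terms. Since [k] is at most [2k + 1], doubling it
   preserves the inequality, makes [m] even and the power [m.+1] of the weight odd. *)
have [k hk] : exists k : nat, Xi * (D + 2 * P + 1) <= k%:R * (delta - beta).
  have db : 0 < delta - beta by rewrite subr_gt0.
  have q0 : 0 <= Xi * (D + 2 * P + 1) / (delta - beta).
    by rewrite divr_ge0 ?(ltW db)// mulr_ge0// !addr_ge0// mulr_ge0.
  exists (Num.bound (Xi * (D + 2 * P + 1) / (delta - beta))).
  by rewrite -ler_pdivrMr// ltW// archi_boundP.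
pose m := k.*2.
pose psi z := xi z ^+ m.+1.
pose psix (i : 'I_n.+1) z := m.+1%:R * xi z ^+ m * v 0 i.
pose psit z := m.+1%:R * xi z ^+ m * - beta.
have even0 z : 0 <= xi z ^+ m by rewrite /m -mul2n exprM exprn_ge0// sqr_ge0.
(* At [t = 0] the base [xi] is at least [beta * T - 2 * M], because [x . v] is at least [- M]. *)
pose c := (beta * T - 2 * M) ^+ m.+1.
have c0 : 0 < c by rewrite exprn_gt0// subr_gt0.
have dxix i x (t : R) : is_derive x (delta_mx 0 i) (fun y => xi (y, t)) (v 0 i).
  have hd := is_deriveD (is_derive_dotv v x i)
    (is_derive_cst (- beta * t + (beta * T - M)) x (delta_mx 0 i : 'rV[R]_n.+1)).
  by apply: (is_derive_eq hd); rewrite addr0.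
have dxit x (t : R) : is_derive t (1 : R) (fun s : R => xi (x, s)) (- beta).
  have h1 := is_derive_mulr (is_derive_cst (- beta) t (1 : R)) (is_derive_id t (1 : R)).
  have hd := is_deriveD (is_derive_cst (dotv x v) t (1 : R))
    (is_deriveD h1 (is_derive_cst (beta * T - M) t (1 : R))).
  by apply: (is_derive_eq hd); rewrite mulr0 !addr0 mulr1 add0r.
have psiT x : Omega x -> psi (x, T) <= 0.
  move=> Ox; rewrite /psi exprS mulr_le0_ge0//.
  by rewrite /xi/=; have := hM x Ox; rewrite ler_norml => /andP[_ ?]; lra.
have psi0 x : Omega x -> c <= psi (x, 0).
  move=> Ox; rewrite /psi /c lerXn2r ?nnegrE//; [lra| |];
  by rewrite /xi/=; have := hM x Ox; rewrite ler_norml => /andP[? _]; lra.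
have cpsi : continuous psi by exact: continuous_exprn.
have cxim (r : R) : continuous (fun z => m.+1%:R * xi z ^+ m * r).
  apply: continuous_mulr; last exact: cst_continuous.
  by apply: continuous_mulr; [exact: cst_continuous|exact: continuous_exprn].
have [C C0 hC'] := @weighted_energy R n Omega T c H h psi psit psix oO bO T0
  (fun i => coordc _ _ i cH) ch dh cpsi (cxim _) (fun i => cxim _)
  (fun i x t => is_derive_exprn m (dxix i x t)) (fun x t => is_derive_exprn m (dxit x t))
  psiT psi0.
exists (c^-1 * (C + Xi ^+ m.+1)).
  by rewrite mulr_gt0 ?invr_gt0// ltr_pwDl// exprn_ge0.
move=> w E sw mE E0 LE.
have mQ := measurable_cylinder T (measurable_open_rV oO).
have key := hC' w (fun z => Xi ^+ m.+1 * E z) sw.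
set J := (\int[lateral_measure R n.+1]_(z in lateral_boundary Omega T) _)%E.
set IE := (\int[spacetime_measure R n.+1]_(z in _) (E z)%:E)%E.
set I0 := (\int[lebesgue_rV R n.+1]_(x in Omega) _)%E.
have J0 : (0 <= J)%E by apply: integral_ge0 => z _; rewrite lee_fin sqr_ge0.
have IE0 : (0 <= IE)%E by apply: integral_ge0 => z _; rewrite lee_fin.
have XE : (\int[spacetime_measure R n.+1]_(z in cylinder Omega T) (Xi ^+ m.+1 * E z)%:E =
    (Xi ^+ m.+1)%:E * IE)%E.
  under eq_integral do rewrite EFinM.
  rewrite ge0_integralZl_EFin//.
  - by move=> z _; rewrite lee_fin.
  - exact/measurable_EFinP.
  - exact: exprn_ge0.
have : (c%:E * I0 <= C%:E * J + (Xi ^+ m.+1)%:E * IE)%E.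
  rewrite -XE; apply: key.
  - by apply: measurable_funM.
  - by move=> z; rewrite mulr_ge0// exprn_ge0.
  apply: filterS2 pP LE => z pz Lz Qz; have {}pz := pz Qz; have {}Lz := Lz Qz.
  have clz : closure Omega z.1 by apply: subset_closure; have [] := Qz.
  have t0T : 0 <= z.2 <= T by have [_] := Qz; rewrite /= in_itv/= => /andP[? ?]; rewrite !ltW.
  have xiz : `|xi z| <= Xi by rewrite (surjective_pairing z); exact: hXi.
  have psiX : `|psi z| <= Xi * xi z ^+ m.
    by rewrite /psi exprS normrM (ger0_norm (even0 z)) ler_wpM2r.
  have psiK : `|psi z| <= Xi ^+ m.+1 by rewrite normrX lerXn2r ?nnegrE.
  have XN : Xi * xi z ^+ m * (D + 2 * P + 1) <=
      \sum_i H z.1 0 i * psix i z + psit z.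
    have -> : \sum_i H z.1 0 i * psix i z = m.+1%:R * xi z ^+ m * dotv (H z.1) v.
      by rewrite mulr_sumr; apply: eq_bigr => i _; rewrite /psix; ring.
    have hb : m.+1%:R * (delta - beta) <= m.+1%:R * (dotv (H z.1) v - beta).
      by rewrite ler_wpM2l// lerB// Hv.
    have hkm : k%:R * (delta - beta) <= m.+1%:R * (delta - beta).
      apply: ler_wpM2r; first by rewrite subr_ge0 ltW.
      rewrite ler_nat /m -addnn.
      by rewrite (leq_trans (leq_addr k k)).
    have := ler_wpM2l (even0 z) (le_trans hk (le_trans hkm hb)).
    by rewrite /psit; move: (xi z ^+ m) => q; lra.
  have := absorb_zeroth_order (w z) (\sum_i H z.1 0 i * 'D_(ex i) w z + 'D_et w z)
    psiX psiK (hD _ clz) pz XN.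
  rewrite addrA => /le_trans; apply; apply: ler_wpM2l => //.
  exact: exprn_ge0.
by apply: lee_divl_sum => //; [exact: ltW|exact: exprn_ge0].
Qed.
End energy.

(** * Traces *)

Section square_integrals.
Local Open Scope ereal_scope.
Context d (T : measurableType d) (R : realType) (mu : {measure set T -> \bar R}).
Implicit Types (D : set T) (f g h : T -> R).

(** The square of the L^2 norm. The estimates are naturally linear in squares, so square roots are
    taken only in the final statement. *)
Definition sqint D f : \bar R := \int[mu]_(x in D) (f x ^+ 2)%:E.

Lemma sqint_ge0 D f : 0 <= sqint D f.
Proof. by apply: integral_ge0 => x _; rewrite lee_fin sqr_ge0. Qed.

Lemma poweR_L2norm D f : L2norm mu D f `^ 2 = sqint D f.
Proof.
rewrite /L2norm poweR_Lnorm// /sqint [RHS]integral_mkcond; apply: eq_integral => x _.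
rewrite /= !patchE; case: ifPn => _ /=; last by rewrite normr0 powR0.
by rewrite -[2%R]/(2%:R)%R powR_mulrn// real_normK// num_real.
Qed.

Lemma L2norm_sqint D f : L2norm mu D f = sqint D f `^ 2^-1.
Proof. by rewrite -poweR_L2norm -poweRrM mulfV// poweRe1// Lnorm_ge0. Qed.

Lemma L2norm_cvg0_sqint D (f : nat -> T -> R) :
  L2norm mu D (f n) @[n --> \oo] --> 0 -> sqint D (f n) @[n --> \oo] --> 0.
Proof.
move=> f0; have E n : sqint D (f n) = L2norm mu D (f n) * L2norm mu D (f n).
  rewrite -poweR_L2norm; have := Lnorm_ge0 mu 2%:E (EFin \o (f n \_ D)).
  rewrite -/(L2norm mu D (f n)); case: (L2norm mu D (f n)) => [r| |]//.
    by rewrite lee_fin => r0; rewrite poweR_EFin -[2%R]/(2%:R)%R powR_mulrn// expr2 EFinM.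
  by move=> _; rewrite poweRyr// mulyy.
rewrite (_ : (fun n => sqint D (f n)) = fun n => L2norm mu D (f n) * L2norm mu D (f n)).
  by rewrite -[X in _ --> X](mule0 0); apply: cvgeM.
exact/funext.
Qed.

Lemma measurable_in_Lp p D f : measurable D -> in_Lp mu p D f -> measurable_fun D f.
Proof.
by move=> mD /andP[/[!inE] mf _]; apply/(measurable_restrictT _ mD).
Qed.

(** From (b + c)^2 <= 2 b^2 + 2 c^2; it takes the place of the triangle inequality while keeping
    squares. *)
Lemma sqint_le D f g h : measurable D ->
  measurable_fun D f -> measurable_fun D g -> measurable_fun D h ->
  (forall x, D x -> `|f x| <= `|g x| + `|h x|)%R ->
  sqint D f <= 2%:E * sqint D g + 2%:E * sqint D h.
Proof.
move=> mD mf mg mh fgh.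
have msq (k : T -> R) : measurable_fun D k -> measurable_fun D (fun x => (k x ^+ 2)%:E).
  by move=> mk; apply/measurable_EFinP; exact: measurable_funX.
have sq0 (k : T -> R) x : D x -> 0 <= (k x ^+ 2)%:E by move=> _; rewrite lee_fin sqr_ge0.
rewrite /sqint -!ge0_integralZl_EFin//; [|exact: sq0|exact: msq|exact: sq0|exact: msq].
rewrite -ge0_integralD//.
- apply: ge0_le_integral => //.
  + exact: sq0.
  + exact: msq.
  + by apply: emeasurable_funD; apply: measurable_funeM; exact: msq.
  + move=> x Dx; rewrite -!EFinM -EFinD lee_fin -(real_normK (num_real (f x))).
    rewrite -(real_normK (num_real (g x))) -(real_normK (num_real (h x))).
    have := fgh x Dx; have := normr_ge0 (f x).
    move: `|f x|%R `|g x|%R `|h x|%R => a b c a0 abc.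
    have : (a ^+ 2 <= (b + c) ^+ 2)%R by rewrite lerXn2r ?nnegrE//; lra.
    by have := sqr_ge0 (b - c)%R; nra.
- by move=> x Dx; apply: mule_ge0; [rewrite lee_fin|exact: sq0].
- by apply: measurable_funeM; exact: msq.
- by move=> x Dx; apply: mule_ge0; [rewrite lee_fin|exact: sq0].
- by apply: measurable_funeM; exact: msq.
Qed.

Lemma in_Loo_bounded D f : in_Lp mu +oo D f ->
  exists2 P : R, (0 <= P)%R & {ae mu, forall x, D x -> (`|f x| <= P)%R}.
Proof.
move=> /andP[_]; rewrite inE/= /finite_norm unlock.
(* If the whole space has measure zero, the norm is zero by convention and carries no information,
   but then everything holds almost everywhere. *)
case: ifPn => mu0 hf; last first.
  exists 0%R => //; apply: measure0_ae; apply/eqP; rewrite eq_le measure_ge0 andbT.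
  by rewrite leNgt.
have fP := ess_sup_ge mu (abse \o (EFin \o (f \_ D))).
exists (Num.max 0%R (fine (ess_sup mu (abse \o (EFin \o (f \_ D)))))).
  by rewrite le_max lexx.
apply: filterS fP => x /= + Dx; rewrite patchE mem_set// => fx.
move: hf fx; case: (ess_sup _ _) => [r| |]//= _; rewrite lee_fin => fr.
by rewrite le_max fr orbT.
Qed.
End square_integrals.

Section traces.
Context (R : realType).

(** The exceptional set becomes a null set times the whole time axis, of measure zero times
    infinity, that is zero. *)
Lemma ae_cylinder d (A : set 'rV[R]_d) (T : R) (P : 'rV[R]_d -> Prop) :
  {ae lebesgue_rV R d, forall x, A x -> P x} ->
  {ae spacetime_measure R d, forall z, cylinder A T z -> P z.1}.
Proof.
move=> [B [mB B0 AB]]; exists (B `*` setT); split.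
- exact: measurableX.
- have E : spacetime_measure R d (B `*` setT) =
      (lebesgue_rV R d B * @lebesgue_measure R setT)%E by exact: product_measure1E.
  exact: etrans E (etrans (congr1 (fun x => x * _)%E B0) (mul0e _)).
move=> z /= nz; split => //; apply: AB => /= Pz; apply: nz => -[Az _].
exact: Pz.
Qed.

(** Integrate the time derivative of (T - t) w^2: the multiplier vanishes at [t = T] and leaves [T]
    times the initial value. Young's inequality on the cross term gives the constants [1 + T] and
    [T]. This continuity of the initial trace reconciles the two approximating sequences. *)
Lemma sqint_initial_le d (A : set 'rV[R]_d) (T : R) (w wt : spacetime R d -> R) :
  bounded_set A -> measurable A -> 0 < T -> continuous w -> continuous wt ->
  (forall x (t : R), is_derive t (1 : R) (fun s : R => w (x, s)) (wt (x, t))) ->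
  (T%:E * sqint (lebesgue_rV R d) A (fun x => w (x, 0%R)) <=
   (1 + T)%:E * sqint (spacetime_measure R d) (cylinder A T) w +
   T%:E * sqint (spacetime_measure R d) (cylinder A T) wt)%E.
Proof.
move=> bA mA T0 cw cwt dw; have mQ := measurable_cylinder T mA.
pose f (z : spacetime R d) := w z ^+ 2 * (T - z.2).
pose g (z : spacetime R d) := 2 * w z * wt z * (T - z.2) - w z ^+ 2.
have cT : continuous (fun z : spacetime R d => T - z.2).
  apply: continuous_addr; first exact: cst_continuous.
  by move=> z; apply: (@continuousN _ _ _ snd); exact: cvg_snd.
have cf : continuous f by apply: continuous_mulr => //; exact: continuous_exprn.
have cg : continuous g.
  apply: continuous_addr.
    apply: continuous_mulr => //; apply: continuous_mulr => //.
    by apply: continuous_mulr => //; exact: cst_continuous.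
  move=> z; apply: (@continuousN _ _ _ (fun z => w z ^+ 2)).
  exact: continuous_exprn.
have dfg x (t : R) : is_derive t (1 : R) (fun s : R => f (x, s)) (g (x, t)).
  have h1 := is_derive_exprn 1 (dw x t).
  have h2 : is_derive t (1 : R) (fun s : R => T - s) (0 - 1) :=
    is_deriveB (is_derive_cst T t (1 : R)) (is_derive_id t (1 : R)).
  apply: (is_derive_eq (is_derive_mulr h1 h2)).
  by rewrite /g /= expr1; ring.
have mc (k : spacetime R d -> R) : continuous k -> measurable_fun (cylinder A T) k.
  by move=> ck; apply: measurable_funTS; exact: continuous_measurable_spacetime.
have ig : (spacetime_measure R d).-integrable (cylinder A T) (EFin \o g).
  have [M _ hM] := cylinder_bounded T bA cg.
  apply: (@integrable_cylinder_bounded _ _ _ _ _ M bA mA); first exact: mc.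
  move=> [x t] [/= Ax]; rewrite in_itv/= => /andP[t0 tT].
  by apply: hM; [exact: subset_closure|rewrite !ltW].
pose E z := (1 + T) * w z ^+ 2 + T * wt z ^+ 2.
have E0 z : 0 <= E z by rewrite addr_ge0// mulr_ge0 ?sqr_ge0// ?addr_ge0// ltW.
have cE : continuous E.
  by apply: continuous_addr; apply: continuous_mulr;
    [exact: cst_continuous|exact: continuous_exprn|
     exact: cst_continuous|exact: continuous_exprn].
have EE : (\int[spacetime_measure R d]_(z in cylinder A T) (E z)%:E =
   (1 + T)%:E * sqint (spacetime_measure R d) (cylinder A T) w +
   T%:E * sqint (spacetime_measure R d) (cylinder A T) wt)%E.
  have msq (k : spacetime R d -> R) : continuous k ->
      measurable_fun (cylinder A T) (fun z => (k z ^+ 2)%:E).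
    by move=> ck; apply/measurable_EFinP; apply: mc; exact: continuous_exprn.
  rewrite /sqint -!ge0_integralZl_EFin//.
  - rewrite -ge0_integralD//.
    + by move=> z _; rewrite -EFinM lee_fin mulr_ge0 ?sqr_ge0// addr_ge0// ltW.
    + by apply: measurable_funeM; exact: msq.
    + by move=> z _; rewrite -EFinM lee_fin mulr_ge0 ?sqr_ge0// ltW.
    + by apply: measurable_funeM; exact: msq.
  - by move=> z _; rewrite lee_fin sqr_ge0.
  - exact: msq.
  - exact: ltW.
  - by move=> z _; rewrite lee_fin sqr_ge0.
  - exact: msq.
  - by rewrite addr_ge0// ltW.
(* Only time is integrated, so the family of spatial terms is empty. *)
have key := @opp_Rintegral_le _ _ R (spacetime_measure R d) _ mQ 0 (fun _ _ => 0) g E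
  (fun i => integrable0 _ _) ig (mc _ cE) E0.
rewrite -EE; apply: le_trans (le_trans (key _) _).
- rewrite EFinN (integral_cylinder_time bA mA T0 cf cg dfg ig).
  apply: le_opp_Rintegral => //.
  + apply: integrable_continuous_bounded => //; apply: continuous_exprn.
    exact: (@continuous_slice1 R d w 0 cw).
  + apply: integrable_continuous_bounded => //.
    apply: continuous_addr; first exact: (@continuous_slice1 R d _ T cf).
    move=> x; apply: (@continuousN _ _ _ (fun x => f (x, 0))).
    exact: (@continuous_slice1 R d _ 0 cf).
  + by move=> x _; rewrite /f/= subrr mulr0 subr0 add0r mulrC.
- apply: aeW => -[x t] [/= _]; rewrite in_itv/= => /andP[t0 tT].
  rewrite big_ord0 add0r /g /E/=.
  have h1 := sqr_ge0 (w (x, t) + wt (x, t)); have h2 := sqr_ge0 (w (x, t) - wt (x, t)).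
  have h3 : 0 <= (T - t) * (w (x, t) + wt (x, t)) ^+ 2 by rewrite mulr_ge0// subr_ge0 ltW.
  have h4 : 0 <= t * w (x, t) ^+ 2 by rewrite mulr_ge0 ?sqr_ge0// ltW.
  have h5 : 0 <= t * wt (x, t) ^+ 2 by rewrite mulr_ge0 ?sqr_ge0// ltW.
  by move: h3 h4 h5; move: (w (x, t)) (wt (x, t)) => a b; lra.
by rewrite big_ord0 add0e.
Qed.

(** Read pointwise, with [h] the value of [H], [b] and [D] the gradients of an approximation [w] and
    of [u]. Subtracting the equation of [u] turns the residual of [w] into that of [w - u]; the
    factor 3 comes from squaring a sum of three terms. *)
Lemma transport_residual_le d (h b D : 'rV[R]_d) (B P dt ut p w u : R) :
  ut + dotv h D + p * u = 0 -> enorm h <= B -> `|p| <= P ->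
  (\sum_i h 0 i * b 0 i + dt + p * w) ^+ 2 <=
  3 * (1 + B ^+ 2 + P ^+ 2) *
    ((dt - ut) ^+ 2 + \sum_i (b 0 i - D 0 i) ^+ 2 + (w - u) ^+ 2).
Proof.
move=> eq0 hB pP.
pose q : 'rV[R]_d := b - D.
have qq : \sum_i (b 0 i - D 0 i) ^+ 2 = dotv q q.
  by apply: eq_bigr => i _; rewrite !mxE expr2.
have q0 : 0 <= dotv q q by rewrite -qq sumr_ge0// => i _; exact: sqr_ge0.
have e0 (x : 'rV[R]_d) : 0 <= enorm x by exact: sqrtr_ge0.
have -> : \sum_i h 0 i * b 0 i + dt + p * w = (dt - ut) + dotv h q + p * (w - u).
  have -> : dotv h q = (\sum_i h 0 i * b 0 i) - dotv h D.
    by rewrite /dotv -sumrB; apply: eq_bigr => i _; rewrite !mxE mulrBr.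
  by move: (\sum_i _) eq0 => s; move: (dotv h D) => r eq0; lra.
have hq : dotv h q ^+ 2 <= B ^+ 2 * dotv q q.
  rewrite -[dotv q q]sqr_sqrtr// -exprMn -(real_normK (num_real (dotv h q))).
  rewrite lerXn2r ?nnegrE ?mulr_ge0// ?(le_trans (e0 h))//.
  by rewrite (le_trans (dotv_le_enorm _ _))// ler_wpM2r// e0.
have hp : (p * (w - u)) ^+ 2 <= P ^+ 2 * (w - u) ^+ 2.
  rewrite exprMn ler_wpM2r ?sqr_ge0// -(real_normK (num_real p)).
  by rewrite lerXn2r ?nnegrE// (le_trans _ pP).
rewrite qq; move: (dt - ut) (dotv h q) (p * (w - u)) hq hp (sqr_ge0 (w - u)) => x y z.
move: (dotv q q) ((w - u) ^+ 2) q0 => s r s0 hy hz r0.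
have h1 : (x + y + z) ^+ 2 <= 3 * (x ^+ 2 + y ^+ 2 + z ^+ 2).
  by have := sqr_ge0 (x - y); have := sqr_ge0 (x - z); have := sqr_ge0 (y - z); lra.
have B0 := sqr_ge0 B; have P0 := sqr_ge0 P; have x0 := sqr_ge0 x.
have m1 := mulr_ge0 B0 x0; have m2 := mulr_ge0 B0 r0.
have m3 := mulr_ge0 P0 x0; have m4 := mulr_ge0 P0 s0.
lra.
Qed.
End traces.

Lemma lee_divl_add (R : realType) (T c : R) (x y z : \bar R) :
  0 < T -> 0 <= c -> (0 <= y)%E -> (0 <= z)%E ->
  (T%:E * x <= c%:E * y + T%:E * z)%E -> (x <= (T^-1 * c)%:E * y + 1%:E * z)%E.
Proof.
move=> T0 c0 y0 z0 Tx.
have -> : x = ((T^-1)%:E * (T%:E * x))%E by rewrite muleA -EFinM mulVf ?gt_eqF// mul1e.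
apply: (@le_trans _ _ ((T^-1)%:E * (c%:E * y + T%:E * z))%E).
  by apply: lee_wpmul2l => //; rewrite lee_fin invr_ge0 ltW.
have TT : (1 : R) = T^-1 * T by rewrite mulVf ?gt_eqF.
rewrite TT !EFinM -!muleA ge0_muleDr//; apply: mule_ge0 => //.
by rewrite lee_fin ltW.
Qed.

Lemma le_sum7 (R : realType) (a b c d x y z : \bar R) :
  (0 <= a)%E -> (0 <= b)%E -> (0 <= c)%E -> (0 <= d)%E -> (0 <= x)%E -> (0 <= y)%E ->
  (0 <= z)%E -> let e := (a + (b + (c + (d + (x + (y + z))))))%E in
  [/\ (0 <= e)%E, (a <= e)%E, (b <= e)%E & [/\ (c <= e)%E, (d <= e)%E, (x <= e)%E,
    (y <= e)%E & (z <= e)%E]].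
Proof.
move=> a0 b0 c0 d0 x0 y0 z0 /=.
have s1 := adde_ge0 y0 z0; have s2 := adde_ge0 x0 s1; have s3 := adde_ge0 d0 s2.
have s4 := adde_ge0 c0 s3; have s5 := adde_ge0 b0 s4.
have l1 := leeDr (b + (c + (d + (x + (y + z)))))%E a0.
have l2 := le_trans (leeDr _ b0) l1; have l3 := le_trans (leeDr _ c0) l2.
have l4 := le_trans (leeDr _ d0) l3; have l5 := le_trans (leeDr _ x0) l4.
split; [exact: adde_ge0|exact: leeDl|exact: le_trans (leeDl _ s4) l1|split].
- exact: le_trans (leeDl _ s3) l2.
- exact: le_trans (leeDl _ s2) l3.
- exact: le_trans (leeDl _ s1) l4.
- exact: le_trans (leeDl _ z0) l5.
- exact: le_trans (leeDr _ y0) l5.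
Qed.

(** * Bookkeeping of errors and passage to the limit *)

Section domination.
Local Open Scope ereal_scope.
Context (R : realType) (g e : \bar R) (g0 : 0 <= g) (e0 : 0 <= e).

(** [g] is the fixed lateral term and [e] an error destined to vanish. Keeping both coefficients
    explicit lets a chain of inequalities be composed mechanically and shows that they do not depend
    on the approximation. *)
Definition dominated (y : \bar R) (a b : R) :=
  [/\ (0 <= a)%R, (0 <= b)%R & y <= a%:E * g + b%:E * e].

Lemma dominated_ref : dominated g 1 0.
Proof. by split => //; rewrite mul1e mul0e adde0. Qed.

Lemma dominated_err y : y <= e -> dominated y 0 1.
Proof. by move=> ye; split => //; rewrite mul0e add0e mul1e. Qed.

Lemma dominated_lin y z x (a b a' b' c c' : R) : (0 <= c)%R -> (0 <= c')%R ->
  dominated y a b -> dominated z a' b' -> x <= c%:E * y + c'%:E * z ->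
  dominated x (c * a + c' * a') (c * b + c' * b').
Proof.
move=> c0 c'0 [a0 b0 yab] [a'0 b'0 zab] xyz.
split; [by rewrite addr_ge0// mulr_ge0|by rewrite addr_ge0// mulr_ge0|].
apply: (le_trans xyz).
have s1 : c%:E * y <= c%:E * (a%:E * g + b%:E * e) by apply: lee_wpmul2l.
have s2 : c'%:E * z <= c'%:E * (a'%:E * g + b'%:E * e) by apply: lee_wpmul2l.
apply: (le_trans (leeD s1 s2)).
have nn (r : R) t : (0 <= r)%R -> 0 <= t -> 0 <= r%:E * t by move=> *; apply: mule_ge0.
have split4 (r r' : R) t : (0 <= r)%R -> (0 <= r')%R ->
    (c * r + c' * r')%:E * t = c%:E * (r%:E * t) + c'%:E * (r'%:E * t).
  move=> r0 r'0; rewrite EFinD ge0_muleDl ?lee_fin ?mulr_ge0//.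
  by rewrite !EFinM -!muleA.
rewrite !split4// ge0_muleDr; [|exact: nn|exact: nn].
by rewrite ge0_muleDr; [rewrite addeACA|exact: nn|exact: nn].
Qed.

Lemma dominated_cvg0 (x : \bar R) (r : nat -> \bar R) (b : R) :
  (forall n, x <= g + b%:E * r n) -> r n @[n --> \oo] --> 0 -> x <= g.
Proof.
move=> xg r0; have br : b%:E * r n @[n --> \oo] --> 0.
  by rewrite -[X in _ --> X](mule0 b%:E); apply: cvgeZl.
apply: (@cvge_ge _ \oo _ R (fun n => g + b%:E * r n) g x); first exact: nearW.
rewrite -[X in _ --> X](adde0 g); apply: cvgeD => //.
- exact: fin_num_adde_defl.
- exact: cvg_cst.
Qed.
End domination.

Lemma cvge_add0 (R : realType) (a b : nat -> \bar R) :
  a n @[n --> \oo] --> 0%E -> b n @[n --> \oo] --> 0%E ->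
  (a n + b n)%E @[n --> \oo] --> 0%E.
Proof.
move=> a0 b0; suff h : (a n + b n)%E @[n --> \oo] --> (0 + 0)%E by rewrite adde0 in h.
exact: (@cvgeD _ _ _ R a b 0%E 0%E).
Qed.

Lemma cvge_sum0 (R : realType) (I : Type) (s : seq I) (f : I -> nat -> \bar R) :
  (forall i, f i n @[n --> \oo] --> 0%E) ->
  (\sum_(i <- s) f i n)%E @[n --> \oo] --> 0%E.
Proof.
move=> f0; elim: s => [|i s ih].
  by rewrite (_ : (fun _ => _) = cst 0%E); [exact: cvg_cst|apply/funext => n; rewrite big_nil].
rewrite (_ : (fun _ => _) = (fun n => f i n + \sum_(j <- s) f j n)%E); last first.
  by apply/funext => n; rewrite big_cons.
exact: cvge_add0.
Qed.

Section limits.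
Context (R : realType).
Local Notation ex i := ((delta_mx 0 i, 0) : spacetime R _).
Local Notation et := ((0, 1) : spacetime R _).

Lemma ler_norm_split (a b c : R) : c = a + b -> `|c| <= `|a| + `|b|.
Proof. by move=> ->; exact: ler_normD. Qed.

Lemma integral_sum_squares dT (T : measurableType dT) (mu : {measure set T -> \bar R})
    (D : set T) (K : R) (m : nat) (a c : T -> R) (b : 'I_m -> T -> R) :
  measurable D -> 0 <= K -> measurable_fun D a -> measurable_fun D c ->
  (forall i, measurable_fun D (b i)) ->
  (forall x, 0 <= a x) -> (forall x, 0 <= c x) -> (forall i x, 0 <= b i x) ->
  (\int[mu]_(x in D) (K * (a x + \sum_i b i x + c x))%:E =
   K%:E * (\int[mu]_(x in D) (a x)%:E +
     (\sum_i \int[mu]_(x in D) (b i x)%:E + \int[mu]_(x in D) (c x)%:E)))%E.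
Proof.
move=> mD K0 ma mc mb a0 c0 b0.
have s0 x : 0 <= \sum_i b i x by apply: sumr_ge0.
have ms : measurable_fun D (fun x => \sum_i b i x) by exact: measurable_sum.
have mE (h : T -> R) : measurable_fun D h -> measurable_fun D (fun x => (h x)%:E).
  by move=> mh; exact/measurable_EFinP.
transitivity (\int[mu]_(x in D) (K%:E * ((a x)%:E + ((\sum_i b i x)%:E + (c x)%:E))))%E.
  by apply: eq_integral => x _; rewrite -!EFinD -EFinM addrA.
have msc : measurable_fun D (fun x => (\sum_i b i x)%:E + (c x)%:E)%E.
  by apply: emeasurable_funD; exact: mE.
rewrite ge0_integralZl_EFin//; last first.
- by apply: emeasurable_funD => //; exact: mE.
- by move=> x _; rewrite -!EFinD lee_fin !addr_ge0.
rewrite ge0_integralD//; [|by move=> x _; rewrite lee_fin|exact: mE|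
  by move=> x _; rewrite -EFinD lee_fin addr_ge0].
rewrite ge0_integralD//; [|by move=> x _; rewrite lee_fin|exact: mE|
  by move=> x _; rewrite lee_fin|exact: mE].
congr (_ * (_ + (_ + _)))%E.
under eq_integral do rewrite -sumEFin.
rewrite ge0_integral_sum//.
- by move=> i; exact: mE.
- by move=> i x _; rewrite lee_fin.
Qed.

(** The sequence [k] approximates the initial trace and [f] the lateral one; the energy estimate is
    applied to [f]. The constant [8 * C] is a product: 2 for passing from [u0] to [k], 2 from [k] to
    [f] at time zero, [C] for the energy estimate, 2 from [f] to [g] on the lateral boundary. *)
Lemma trace_estimate d (Omega : set 'rV[R]_d) (T B P C : R)
    (H : 'rV[R]_d -> 'rV[R]_d) (p : 'rV[R]_d -> R) :
  open Omega -> bounded_set Omega -> 0 < T -> 0 < C ->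
  (forall x, Omega x -> enorm (H x) <= B) ->
  {ae spacetime_measure R d, forall z, cylinder Omega T z -> `|p z.1| <= P} ->
  (forall w E : spacetime R d -> R, smooth w ->
    measurable_fun (cylinder Omega T) E -> (forall z, 0 <= E z) ->
    {ae spacetime_measure R d, forall z, cylinder Omega T z ->
       (\sum_i H z.1 0 i * 'D_(ex i) w z + 'D_et w z + p z.1 * w z) ^+ 2 <= E z} ->
    (\int[lebesgue_rV R d]_(x in Omega) (w (x, 0%R) ^+ 2)%:E <=
     C%:E * (\int[lateral_measure R d]_(z in lateral_boundary Omega T)
               (w ((z.1 : 'rV[R]_d), z.2) ^+ 2)%:E +
             \int[spacetime_measure R d]_(z in cylinder Omega T) (E z)%:E))%E) ->
  forall u u0 g, H1 (cylinder Omega T) u -> transport_equation Omega T H p u ->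
    is_initial_trace Omega T u u0 -> is_lateral_trace Omega T u g ->
    (sqint (lebesgue_rV R d) Omega u0 <=
     (8 * C)%:E * sqint (lateral_measure R d) (lateral_boundary Omega T) g)%E.
Proof.
move=> oO bO T0 C0 HB pP energy u u0 g [Lu _] [ut [Du [wut wDu eqn]]].
move=> [Lu0 [k [sk [ku kD] k0]]] [Lg [f [sf [fu fD] fg]]].
pose mu := spacetime_measure R d; pose Q := cylinder Omega T.
pose lam := lebesgue_rV R d; pose S := lateral_boundary Omega T.
have mO := measurable_open_rV oO; have mQ : measurable Q := measurable_cylinder T mO.
have mS : measurable S := measurable_lateral_boundary T bO.
have mu_ := measurable_in_Lp mQ Lu.
have mut := measurable_in_Lp mQ wut.1.
have mDu i := measurable_in_Lp mQ (wDu i).1.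
have mu0 := measurable_in_Lp mO Lu0.
have mg := measurable_in_Lp mS Lg.
have mc (h : spacetime R d -> R) : continuous h -> measurable_fun Q h.
  by move=> ch; apply: measurable_funTS; exact: continuous_measurable_spacetime.
pose Xk n := sqint mu Q (k n \- u).
pose Xf n := sqint mu Q (f n \- u).
pose Yk n := sqint mu Q ('D_et (k n) \- ut).
pose Yf n := sqint mu Q ('D_et (f n) \- ut).
pose Z i n := sqint mu Q ('D_(ex i) (f n) \- (fun z => Du z 0 i)).
pose A n := sqint lam Omega ((k n \o (fun x => (x, 0))) \- u0).
pose L n := sqint (lateral_measure R d) S ((f n \o (fun z => (z.1 : 'rV[R]_d, z.2))) \- g).
pose ZZ n := (\sum_i Z i n)%E.
(* All approximation errors are added into one sequence, so that a single limit is taken at the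
   end. *)
pose e n := (A n + (L n + (Xk n + (Xf n + (Yk n + (Yf n + ZZ n))))))%E.
have e0 : e n @[n --> \oo] --> 0%E.
  apply: cvge_add0; first exact: L2norm_cvg0_sqint k0.
  apply: cvge_add0; first exact: L2norm_cvg0_sqint fg.
  apply: cvge_add0; first exact: L2norm_cvg0_sqint ku.
  apply: cvge_add0; first exact: L2norm_cvg0_sqint fu.
  apply: cvge_add0; first exact: L2norm_cvg0_sqint (kD _ _ wut).
  apply: cvge_add0; first exact: L2norm_cvg0_sqint (fD _ _ wut).
  by apply: cvge_sum0 => i; exact: L2norm_cvg0_sqint (fD _ _ (wDu i)).
set G := sqint (lateral_measure R d) S g.
have ZZ0 n : (0 <= ZZ n)%E by apply: sume_ge0 => i _; exact: sqint_ge0.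
have sum7 n := @le_sum7 R (A n) (L n) (Xk n) (Xf n) (Yk n) (Yf n) (ZZ n) (sqint_ge0 _ _ _)
  (sqint_ge0 _ _ _) (sqint_ge0 _ _ _) (sqint_ge0 _ _ _) (sqint_ge0 _ _ _) (sqint_ge0 _ _ _)
  (ZZ0 n).
have en0 n : (0 <= e n)%E by have [] := sum7 n.
have G0 : (0 <= G)%E by exact: sqint_ge0.
pose K := 3 * (1 + B ^+ 2 + P ^+ 2).
have K0 : 0 <= K by rewrite mulr_ge0// !addr_ge0// sqr_ge0.
have [b bound] : exists b, forall n, dominated G (e n) (sqint lam Omega u0) (8 * C) b.
  (* The coefficient [b] of the error is left open; the chain of [dominated_lin] below determines
     it, from quantities that do not involve [n]. *)
  eexists => n.
  have [ck dk] := smooth_C1 (sk n); have [cf df] := smooth_C1 (sf n).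
  have [dkt ckt] := dk et; have [dft cft] := df et.
  have ckx := @continuous_slice1 R d (k n) 0 ck.
  have cfx := @continuous_slice1 R d (f n) 0 cf.
  have mO' (h : 'rV[R]_d -> R) : continuous h -> measurable_fun Omega h.
    by move=> ch; apply: measurable_funTS; exact: continuous_measurable_rV.
  have fS : measurable_fun S (f n \o (fun z => (z.1 : 'rV[R]_d, z.2))).
    by apply: measurable_funTS; exact: continuous_measurable_lateral.
  have [_ leA leL [leXk leXf leYk leYf leZ]] := sum7 n.
  have dq : (sqint mu Q (k n \- f n)%R <= 2%:E * Xk n + 2%:E * Xf n)%E.
    apply: sqint_le => //.
    - by apply: measurable_funB; exact: mc.
    - by apply: measurable_funB => //; exact: mc.
    - by apply: measurable_funB => //; exact: mc.
    - move=> z _; rewrite -[X in _ + X]normrN; apply: ler_norm_split.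
      by rewrite /=; ring.
  have dqt : (sqint mu Q ('D_et (k n) \- 'D_et (f n))%R <= 2%:E * Yk n + 2%:E * Yf n)%E.
    apply: sqint_le => //.
    - by apply: measurable_funB; exact: mc.
    - by apply: measurable_funB => //; exact: mc.
    - by apply: measurable_funB => //; exact: mc.
    - move=> z _; rewrite -[X in _ + X]normrN; apply: ler_norm_split.
      by rewrite /=; ring.
  have dlat : (sqint (lateral_measure R d) S (f n \o (fun z => (z.1 : 'rV[R]_d, z.2))) <=
      2%:E * L n + 2%:E * G)%E.
    apply: sqint_le => //; first by apply: measurable_funB.
    by move=> z _; apply: ler_norm_split; rewrite /=; ring.
  have dk0 : (sqint lam Omega (fun x => k n (x, 0%R)) <=
      2%:E * sqint lam Omega (fun x => k n (x, 0) - f n (x, 0))%R +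
      2%:E * sqint lam Omega (fun x => f n (x, 0%R)))%E.
    apply: sqint_le => //.
    - exact: mO'.
    - by apply: measurable_funB; exact: mO'.
    - exact: mO'.
    - by move=> z _; apply: ler_norm_split; rewrite /=; ring.
  have du0 : (sqint lam Omega u0 <= 2%:E * A n +
      2%:E * sqint lam Omega (fun x => k n (x, 0%R)))%E.
    apply: sqint_le => //.
    - by apply: measurable_funB => //; exact: mO'.
    - exact: mO'.
    - move=> z _; rewrite -[X in X + _]normrN; apply: ler_norm_split.
      by rewrite /=; ring.
  have dkf : (sqint lam Omega (fun x => k n (x, 0) - f n (x, 0))%R <=
      (T^-1 * (1 + T))%:E * sqint mu Q (k n \- f n)%R +
      1%:E * sqint mu Q ('D_et (k n) \- 'D_et (f n))%R)%E.
    (* Both sequences converge to [u] and their time derivatives to [ut], so the difference of their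
       initial values is controlled by errors alone. *)
    have := @sqint_initial_le R d Omega T (k n \- f n) ('D_et (k n) \- 'D_et (f n))
      bO mO T0.
    have ckf : continuous (k n \- f n).
      by move=> z; apply: continuousB; [exact: ck|exact: cf].
    have ckft : continuous ('D_et (k n) \- 'D_et (f n)).
      by move=> z; apply: continuousB; [exact: ckt|exact: cft].
    move=> /(_ ckf ckft) h; apply: lee_divl_add => //.
    - by rewrite addr_ge0// ltW.
    - exact: sqint_ge0.
    - exact: sqint_ge0.
    apply: h => x t.
    by apply: is_deriveB; apply: is_derive_slice_time.
  pose E z := K * (('D_et (f n) z - ut z) ^+ 2 +
    \sum_i ('D_(ex i) (f n) z - Du z 0 i) ^+ 2 + (f n z - u z) ^+ 2).
  have E0 z : 0 <= E z.
    apply: mulr_ge0; first exact: K0.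
    apply: addr_ge0; last exact: sqr_ge0.
    apply: addr_ge0; first exact: sqr_ge0.
    by apply: sumr_ge0 => i _; exact: sqr_ge0.
  have mXf : measurable_fun Q (fun z => (f n z - u z) ^+ 2).
    by apply: measurable_funX; apply: measurable_funB => //; exact: mc.
  have mYf : measurable_fun Q (fun z => ('D_et (f n) z - ut z) ^+ 2).
    by apply: measurable_funX; apply: measurable_funB => //; exact: mc.
  have mZ i : measurable_fun Q (fun z => ('D_(ex i) (f n) z - Du z 0 i) ^+ 2).
    apply: measurable_funX; apply: measurable_funB => //; apply: mc.
    by have [_ ?] := df (ex i).
  have mE : measurable_fun Q E.
    apply: measurable_funM => //; apply: measurable_funD => //.
    by apply: measurable_funD => //; exact: measurable_sum.
  have IE : (\int[mu]_(z in Q) (E z)%:E <= K%:E * Yf n + K%:E * (1%:E * ZZ n + 1%:E * Xf n))%E.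
    rewrite !mul1e -ge0_muleDr; [|exact: sqint_ge0|by apply: adde_ge0 (ZZ0 n) (sqint_ge0 _ _ _)].
    rewrite le_eqVlt; apply/orP; left; apply/eqP.
    apply: (@integral_sum_squares _ _ mu Q K d _ _ _ mQ K0 mYf mXf mZ).
    - by move=> z; exact: sqr_ge0.
    - by move=> z; exact: sqr_ge0.
    - by move=> i z; exact: sqr_ge0.
  have df0 : (sqint lam Omega (fun x => f n (x, 0%R)) <=
      C%:E * sqint (lateral_measure R d) S (f n \o (fun z => (z.1 : 'rV[R]_d, z.2))) +
      C%:E * \int[mu]_(z in Q) (E z)%:E)%E.
    rewrite -ge0_muleDr; [|exact: sqint_ge0|by apply: integral_ge0 => z _; rewrite lee_fin].
    apply: (energy (f n) E (sf n) mE E0).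
    apply: filterS2 pP eqn => z pz ez Qz.
    have := transport_residual_le (\row_i 'D_(ex i) (f n) z) ('D_et (f n) z) (f n z)
      (ez Qz) (HB z.1 Qz.1) (pz Qz).
    rewrite /E; under eq_bigr do rewrite mxE.
    by under [in X in _ <= X -> _]eq_bigr do rewrite mxE.
  have Ti : 0 <= T^-1 * (1 + T) by rewrite mulr_ge0 ?invr_ge0 ?addr_ge0// ltW.
  have C0' := ltW C0; have p2 : 0 <= 2 :> R by [].
  have err y := @dominated_err R G (e n) y.
  have r1 := dominated_lin G0 (en0 n) p2 p2 (err _ leXk) (err _ leXf) dq.
  have r2 := dominated_lin G0 (en0 n) p2 p2 (err _ leYk) (err _ leYf) dqt.
  have r3 := dominated_lin G0 (en0 n) Ti ler01 r1 r2 dkf.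
  have r4 := dominated_lin G0 (en0 n) p2 p2 (err _ leL) (dominated_ref G (e n)) dlat.
  have r5 := dominated_lin G0 (en0 n) ler01 ler01 (err _ leZ) (err _ leXf) (lexx _).
  have r6 := dominated_lin G0 (en0 n) K0 K0 (err _ leYf) r5 IE.
  have r7 := dominated_lin G0 (en0 n) C0' C0' r4 r6 df0.
  have r8 := dominated_lin G0 (en0 n) p2 p2 r3 r7 dk0.
  have := dominated_lin G0 (en0 n) p2 p2 (err _ leA) r8 du0.
  rewrite (_ : 2 * 0 + _ = 8 * C); last by ring.
  exact.
apply: (dominated_cvg0 _ e0) => n.
by have [_ _] := bound n; exact.
Qed.
End limits.

(** Continuity on the compact closure bounds the set under [sup], whose value would otherwise be a
    meaningless default. *)
Lemma enorm_le_sup_norm (R : realType) d (A : set 'rV[R]_d) (f : 'rV[R]_d -> 'rV[R]_d) :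
  bounded_set A -> {within closure A, continuous f} ->
  forall x, closure A x -> enorm (f x) <= sup_norm (closure A) f.
Proof.
move=> bA cf x clx.
have cE : {within closure A, continuous (fun y => enorm (f y))}.
  move=> y; apply: (@continuous_comp (subspace (closure A)) _ _ f (@enorm R d)); first exact: cf.
  exact: continuous_enorm.
have [M _ hM] := compact_within_bounded (compact_closure_rV bA) cE.
apply: ub_le_sup; last by exists x.
by exists M => _ [y cly <-]; rewrite (le_trans (ler_norm _))// hM.
Qed.

Theorem proposition1p2 (R : realType) (d : nat)
    (Omega : set 'rV[R]_d) (H : 'rV[R]_d -> 'rV[R]_d) (p : 'rV[R]_d -> R)
    (v : 'rV[R]_d) (delta0 delta1 T : R)
    (domOmega : smooth_bounded_domain Omega)
    (C1H : C1_closure Omega H)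
    (delta0_gt0 : 0 < delta0)
    (H_ge : forall x, closure Omega x -> delta0 <= enorm (H x))
    (Lp : in_Lp (lebesgue_rV R d) +oo%E Omega p)
    (v_unit : enorm v = 1)
    (delta1_gt0 : 0 < delta1)
    (Hv_ge : forall x, closure Omega x -> delta1 <= dotv (H x) v)
    (T_gt : 2 * sup_norm (closure Omega) id *
              (delta1 + sup_norm (closure Omega) H) / delta1 ^+ 2 < T) :
  exists2 C : R, 0 < C &
    forall u : spacetime R d -> R,
      H1 (cylinder Omega T) u ->
      transport_equation Omega T H p u ->
      forall (u0 : 'rV[R]_d -> R) (g : surface R d * measurableTypeR R -> R),
        is_initial_trace Omega T u u0 ->
        is_lateral_trace Omega T u g ->
        (L2norm (lebesgue_rV R d) Omega u0 <=
           C%:E * L2norm (lateral_measure R d) (lateral_boundary Omega T) g)%E.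
Proof.
case: d Omega H p v domOmega C1H H_ge Lp v_unit Hv_ge T_gt => [|n] Omega H p v.
  (* In dimension zero there is no unit vector. *)
  move=> _ _ _ _ + _ _; rewrite /enorm /dotv big_ord0 sqrtr0 => /eqP.
  by rewrite eq_sym oner_eq0.
move=> [oO _ [x0 Ox0] bO _] C1H H_ge Lp v1 Hv_ge T_gt.
have MH := enorm_le_sup_norm bO C1H.1.
have Mid : forall x, closure Omega x -> enorm x <= sup_norm (closure Omega) id.
  by apply: (enorm_le_sup_norm bO); apply: continuous_subspaceT => x; exact: cvg_id.
have clx0 : closure Omega x0 by exact: subset_closure.
have MH0 : 0 <= sup_norm (closure Omega) H by exact: le_trans (sqrtr_ge0 _) (MH _ clx0).
have M0 : 0 <= sup_norm (closure Omega) id by exact: le_trans (sqrtr_ge0 _) (Mid _ clx0).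
(* Since [delta1] is at most [delta1] plus the norm of [H], the lower bound on [T] exceeds 2 max|x|
   / delta1: the weight can travel across the width of the domain in direction [v] before time
   [T]. *)
have MT : 2 * sup_norm (closure Omega) id < delta1 * T.
  move: T_gt; rewrite ltr_pdivrMr ?exprn_gt0// => T_gt.
  have h : 2 * sup_norm (closure Omega) id * delta1 <=
      2 * sup_norm (closure Omega) id * (delta1 + sup_norm (closure Omega) H).
    by rewrite ler_wpM2l ?mulr_ge0// lerDl.
  rewrite -(ltr_pM2r delta1_gt0) (le_lt_trans h)// (lt_le_trans T_gt)//.
  by rewrite le_eqVlt; apply/orP; left; apply/eqP; ring.
have T0 : 0 < T.
  by rewrite -(pmulr_rgt0 _ delta1_gt0); apply: le_lt_trans MT; rewrite mulr_ge0.
have [P P0 pP] := in_Loo_bounded Lp.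
have pQ := @ae_cylinder R n.+1 Omega T (fun x => `|p x| <= P) pP.
have xv x : Omega x -> `|dotv x v| <= sup_norm (closure Omega) id.
  move=> Ox; rewrite (le_trans (dotv_le_enorm _ _))// v1 mulr1.
  by apply: Mid; exact: subset_closure.
have [C C0 energy] := energy_estimate oO bO T0 C1H M0 xv Hv_ge MT P0 pQ.
have C8 : 0 < 8 * C by rewrite mulr_gt0.
(* A square root, because [trace_estimate] compares squared norms. *)
exists ((8 * C) `^ 2^-1) => [|u Hu equ u0 g tu0 tg]; first exact: powR_gt0.
have HB x : Omega x -> enorm (H x) <= sup_norm (closure Omega) H.
  by move=> Ox; apply: MH; exact: subset_closure.
have key := trace_estimate oO bO T0 C0 HB pQ energy Hu equ tu0 tg.
rewrite !L2norm_sqint -poweR_EFin -poweRM ?sqint_ge0//; last by rewrite lee_fin ltW.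
apply: gt0_ler_poweR key; rewrite ?invr_ge0// in_itv/= leey andbT ?sqint_ge0//.
by apply: mule_ge0; [rewrite lee_fin ltW|exact: sqint_ge0].
Qed.
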